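(* Let $I\subset\mathbb R$ be a bounded open interval, $n\ge1$, and let $F=\varphi\colon\mathbb R^n\to[0,\infty)$ be a coercive anisotropy. Let $v_0\in L^2(I,\mathbb R^n)$ and let $v$ be the gradient flow of $\mathcal F$ in $L^2(I,\mathbb R^n)$ starting from $v_0$. If $v_0\in BV(U,\mathbb R^n)$ with $U\subset I$ open, then for a.e. $t>0$, $|v_x(t)|\le|v_{0,x}|$ in the sense of Borel measures on $U$, i.e. $$|v_x(t)|(E)\le|v_{0,x}|(E)\quad\text{for any Borel set }E\subset U.$$
   Context: An anisotropy on $\mathbb R^n$ is a convex function $\varphi\colon\mathbb R^n\to[0,\infty)$ that is positively $1$-homogeneous: $\varphi(tp)=t\varphi(p)$ for $p\in\mathbb R^n$, $t\ge0$. It is coercive if $\min_{p\neq0}\varphi(p)/|p|>0$. The functional $\mathcal F\colon L^2(I,\mathbb R^n)\to[0,\infty]$ is the convex lower semicontinuous functional $$\mathcal F(w)=\inf\Big\{\liminf_{\ell\to\infty}\int_I F(w^\ell_x)\,d\mathcal L^1:\ (w^\ell)\subset C^1(I,\mathbb R^n),\ w^\ell\to w\text{ in }L^1_{loc}(I,\mathbb R^n)\Big\}.$$ For $F=\varphi$ a coercive anisotropy, $\mathcal F$ is finite exactly on $L^2\cap BV(I,\mathbb R^n)$, where $\mathcal F(w)=\int_I\varphi\big(\tfrac{w_x}{|w_x|}\big)\,d|w_x|$. The gradient flow of $\mathcal F$ starting from $v_0\in L^2(I,\mathbb R^n)$ is the unique function $v\in C([0,\infty),L^2(I,\mathbb R^n))\cap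 W^{1,2}_{loc}((0,\infty);L^2(I,\mathbb R^n))$ such that $v_t(t)\in-\partial\mathcal F(v(t))$ for a.e. $t>0$ and $v(0)=v_0$, where $\partial\mathcal F$ is the convex subdifferential in $L^2(I,\mathbb R^n)$. $v_x(t)$ is the distributional derivative in the space variable of $v(t)$ (the claim includes that it is a measure on $U$ for which the bound holds), and $|\mu|$ denotes the total variation measure of a vector measure $\mu$. *)

(* Defs.v *)
From HB Require Import structures.
From mathcomp Require Import all_boot all_order all_algebra.
From mathcomp Require Import all_classical all_reals all_analysis.
Import Order.TTheory GRing.Theory Num.Theory.
Import numFieldNormedType.Exports.

Set Implicit Arguments.
Unset Strict Implicit.
Unset Printing Implicit Defensive.

Local Open Scope classical_set_scope.
Local Open Scope ring_scope.

(* R^n is 'rV[R]_n. The library norm `|p| on 'rV[R]_n is the sup norm, so the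
   Euclidean norm and inner product are introduced here; both norms induce the
   same topology. *)
Definition dotp {R : realType} {n : nat} (p q : 'rV[R]_n) : R :=
  \sum_(i < n) p 0 i * q 0 i.

Definition enorm {R : realType} {n : nat} (p : 'rV[R]_n) : R :=
  Num.sqrt (dotp p p).

Section anisotropy.
Context {R : realType} {n : nat}.
Implicit Type phi : 'rV[R]_n -> R.

Definition anisotropy phi : Prop :=
  [/\ forall p, 0 <= phi p,
      convex_function [set: 'rV[R]_n] phi &
      forall p t, 0 <= t -> phi (t *: p) = t * phi p].

(* min_{p != 0} phi(p) / |p| > 0: the minimum is attained, at some p0, and is
   positive. *)
Definition coercive phi : Prop :=
  exists p0, [/\ p0 != 0, 0 < phi p0 / enorm p0 &
    forall p, p != 0 -> phi p0 / enorm p0 <= phi p / enorm p].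

End anisotropy.

(* C_c^oo(J), for J open in R. *)
Definition test_fun {R : realType} (J : set R) (f : R -> R) : Prop :=
  (forall k x, derivable (derive1n k f) x 1) /\
  exists K : set R,
    [/\ compact K, K `<=` J & forall x, ~ K x -> f x = 0].

(* Elements of L^2(I, R^n) are given by Borel representatives R -> 'rV[R]_n,
   of which only the values on I matter. *)
Section L2.
Context {R : realType} {n : nat}.
Variable I : set R.
Local Notation mu := (@lebesgue_measure R).
Implicit Types w z : R -> 'rV[R]_n.

Definition L2norm w : \bar R :=
  Lnorm mu 2%:E ((fun x => (enorm (w x))%:E) \_ I).

Definition is_L2 w : Prop :=
  (forall i, measurable_fun I (fun x => w x 0 i)) /\ (L2norm w < +oo)%E.

Definition L2dot w z : R := \int[mu]_(x in I) dotp (w x) (z x).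

End L2.

Section relaxed_functional.
Context {R : realType} {n : nat}.
Variables (I : set R) (F : 'rV[R]_n -> R).
Local Notation mu := (@lebesgue_measure R).
Implicit Types w z xi : R -> 'rV[R]_n.

(* C^1(I, R^n), for I open. *)
Definition is_C1 w : Prop :=
  forall x, I x -> derivable w x 1 /\ {for x, continuous (derive1 w)}.

Definition cvg_L1loc (u : nat -> R -> 'rV[R]_n) w : Prop :=
  forall K : set R, compact K -> K `<=` I ->
    (\int[mu]_(x in K) (enorm (u l x - w x))%:E)%E @[l --> \oo] --> 0%E.

Definition relaxed w : \bar R :=
  ereal_inf
    [set limn_einf (fun l => \int[mu]_(x in I) (F (derive1 (u l) x))%:E)%E
    | u in [set u : nat -> R -> 'rV[R]_n |
             (forall l, is_C1 (u l)) /\ cvg_L1loc u w]].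

(* xi belongs to the subdifferential at w of the relaxed functional, seen as a
   convex function on L^2(I, R^n). *)
Definition subdiff w xi : Prop :=
  [/\ is_L2 I w, is_L2 I xi, (relaxed w < +oo)%E &
    forall z, is_L2 I z ->
      (relaxed w + (L2dot I xi (z - w)%R)%:E <= relaxed z)%E].

End relaxed_functional.

(* Functions of time t in J with values in L^2(I, R^n). *)
Section bochner.
Context {R : realType} {n : nat}.
Variables (I J : set R).
Local Notation mu := (@lebesgue_measure R).
Implicit Types (g : R -> R -> 'rV[R]_n) (y : R -> 'rV[R]_n).

Record L2_simple := {
  simple_size : nat ;
  simple_set : 'I_simple_size -> set R ;
  simple_coef : 'I_simple_size -> R -> 'rV[R]_n ;
  simple_measurable : forall i, measurable (simple_set i) ;
  simple_sub : forall i, simple_set i `<=` J ;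
  simple_finite : forall i, (mu (simple_set i) < +oo)%E ;
  simple_L2 : forall i, is_L2 I (simple_coef i) }.

Definition simple_fun (s : L2_simple) (t : R) : R -> 'rV[R]_n :=
  fun x => \sum_i \1_(@simple_set s i) t *: @simple_coef s i x.

Definition simple_integral (s : L2_simple) : R -> 'rV[R]_n :=
  fun x => \sum_i fine (mu (@simple_set s i)) *: @simple_coef s i x.

Definition strongly_measurable g : Prop :=
  {ae mu, forall t, J t -> is_L2 I (g t)} /\
  exists s : nat -> L2_simple,
    {ae mu, forall t, J t ->
      L2norm I (g t - simple_fun (s k) t) @[k --> \oo] --> 0%E}.

(* g is Bochner integrable on J and its integral is (the class of) y. *)
Definition bochner_integral g y : Prop :=
  [/\ strongly_measurable g, is_L2 I y &
    exists s : nat -> L2_simple,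
      (\int[mu]_(t in J) L2norm I (g t - simple_fun (s k) t)%R)%E
        @[k --> \oo] --> 0%E /\
      L2norm I (simple_integral (s k) - y) @[k --> \oo] --> 0%E].

(* L^2_loc(J; L^2(I, R^n)), for J open. *)
Definition is_L2loc g : Prop :=
  strongly_measurable g /\
  forall K : set R, compact K -> K `<=` J ->
    (\int[mu]_(t in K) (L2norm I (g t) ^+ 2) < +oo)%E.

(* v belongs to W^{1,2}_loc(J; L^2(I, R^n)) with weak time derivative g. *)
Definition W12loc_deriv (v g : R -> R -> 'rV[R]_n) : Prop :=
  [/\ is_L2loc v, is_L2loc g &
    forall psi, test_fun J psi -> exists y,
      bochner_integral (fun t x => derive1 psi t *: v t x) y /\
      bochner_integral (fun t x => psi t *: g t x) (- y)].

End bochner.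

Definition gradient_flow {R : realType} {n : nat} (I : set R)
    (F : 'rV[R]_n -> R) (v0 : R -> 'rV[R]_n) (v : R -> R -> 'rV[R]_n) : Prop :=
  [/\ forall t, 0 <= t -> is_L2 I (v t),
      forall t0, 0 <= t0 ->
        L2norm I (v t - v t0) @[t --> within [set t | 0 <= t] (nbhs t0)]
          --> 0%E,
      exists g, W12loc_deriv I `]0, +oo[ v g /\
        {ae @lebesgue_measure R, forall t, 0 < t ->
          subdiff I F (v t) (- g t)} &
      {ae @lebesgue_measure R, forall x, I x -> v 0 x = v0 x}].

(* An R^n-valued measure on an open set U is represented by n finite signed
   Borel measures on R, of which only the values on Borel subsets of U matter. *)
Section vector_measures.
Context {R : realType} {n : nat}.
Local Notation mu := (@lebesgue_measure R).

(* The integral against the signed measure nu; the Hahn decomposition is chosen,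
   but the Jordan decomposition, hence the integral, does not depend on it. *)
Definition charge_integral (nu : {charge set (measurableTypeR R) -> \bar R})
    (D : set R) (f : R -> R) : R :=
  let hP := cid (Hahn_decomposition nu) in
  let hN := cid (projT2 hP) in
  \int[jordan_pos (projT2 hN)]_(x in D) f x -
  \int[jordan_neg (projT2 hN)]_(x in D) f x.

Variable nu : 'I_n -> {charge set (measurableTypeR R) -> \bar R}.

Definition vec_measure (E : set R) : 'rV[R]_n := \row_i fine (nu i E).

(* The total variation measure |nu|(E), a supremum over countable Borel
   partitions of E. *)
Definition vec_variation (E : set R) : \bar R :=
  ereal_sup
    [set (\sum_(0 <= k <oo) (enorm (vec_measure (A k)))%:E)%E
    | A in [set A : nat -> set R |
             [/\ forall k, measurable (A k), trivIset setT A &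
                 \bigcup_k A k = E]]].

(* w belongs to BV(U, R^n) and its distributional derivative on U is nu. *)
Definition BV_deriv (U : set R) (w : R -> 'rV[R]_n) : Prop :=
  (forall i, mu.-integrable U (fun x => (w x 0 i)%:E)) /\
  (forall i f, test_fun U f ->
    \int[mu]_(x in U) (w x 0 i * derive1 f x) = - charge_integral (nu i) U f).

End vector_measures.

(* Main.v *)
(** Cut the interval into cells of length h and write D_k for the jump between
    neighbouring cell means of v0. For weights b_k >= 0, let H(w) be the minimum
    over cellwise constant P of |w - P|^2 + h sum_k b_k |P_k - P_(k-1)|^2. The
    minimiser P solves a discrete elliptic equation in divergence form, and
    convexity gives F(P) <= sum_k phi(jump of the cell means of w) <= F(w),
    whence <xi, w - P> >= 0 for xi in the subdifferential at w. Therefore H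
    decreases along the flow, and H(v(t)) is at most
    |v0 - cell means|^2 + h sum_k b_k |D_k|^2. With h b_k close to
    eps |f(x_k)| / |D_k|, summing by parts and letting h, then eps, tend to 0
    gives |int v(t) f'| <= int |f| d|v0_x| for every test function f on U.
    A functional with this bound is integration against a vector measure
    dominated by |v0_x|. *)

Require Import Defs.
From HB Require Import structures.
From mathcomp Require Import all_boot all_order all_algebra.
From mathcomp Require Import all_classical all_reals all_analysis.
From mathcomp Require Import measurable_realfun ring lra.
Import Order.TTheory GRing.Theory Num.Theory.
Import numFieldNormedType.Exports.

Set Implicit Arguments.
Unset Strict Implicit.
Unset Printing Implicit Defensive.

Local Open Scope classical_set_scope.
Local Open Scope ring_scope.

(** * Euclidean norm and sublinear functions *)

(** The space derivative of [v t] is not known to be a measure, so no estimate can be written on it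
    directly. The functional H makes sense on all of L^2 and asks for no regularity of [phi]. Its
    penalty is quadratic so that the Euler equation is linear, its solution operator is
    nonexpansive, and the flux on each edge is a nonnegative multiple of the jump: a subgradient of
    [phi] at the jump pairs with this flux exactly. The weights make the penalty a tangent majorant
    of the weighted variation: |q| <= q^2 / (2 r) + r / 2, with equality at |q| = r, is used with r
    close to the jumps of v0, so that almost nothing is lost at the initial datum. The small eps
    makes the bound on H small, which forces P towards v(t). The relaxation enters only through two
    one-sided bounds: from below by linear functions of the cell means, which survive local L^1
    limits, and from above by one explicit sequence. The inclusion holds for almost every time and
    is used in integrated form, so differentiating H along the flow is replaced by quadratic bounds
    on its increments. *)

Section euclid.
Context {R : realType} {n : nat}.
Implicit Types p q r : 'rV[R]_n.

Lemma dotpC p q : dotp p q = dotp q p.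
Proof. by apply: eq_bigr => i _; rewrite mulrC. Qed.

Lemma dotpDl p q r : dotp (p + q) r = dotp p r + dotp q r.
Proof. by rewrite -big_split; apply: eq_bigr => i _; rewrite !mxE mulrDl. Qed.

Lemma dotpDr p q r : dotp r (p + q) = dotp r p + dotp r q.
Proof. by rewrite !(dotpC r) dotpDl. Qed.

Lemma dotpZl k p q : dotp (k *: p) q = k * dotp p q.
Proof. by rewrite /dotp mulr_sumr; apply: eq_bigr => i _; rewrite !mxE mulrA. Qed.

Lemma dotpZr k p q : dotp q (k *: p) = k * dotp q p.
Proof. by rewrite !(dotpC q) dotpZl. Qed.

Lemma dotpNl p q : dotp (- p) q = - dotp p q.
Proof. by rewrite -scaleN1r dotpZl mulN1r. Qed.

Lemma dotpNr p q : dotp q (- p) = - dotp q p.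
Proof. by rewrite !(dotpC q) dotpNl. Qed.

Lemma dotpBl p q r : dotp (p - q) r = dotp p r - dotp q r.
Proof. by rewrite dotpDl dotpNl. Qed.

Lemma dotpBr p q r : dotp r (p - q) = dotp r p - dotp r q.
Proof. by rewrite dotpDr dotpNr. Qed.

Lemma dot0p q : dotp 0 q = 0.
Proof. by rewrite -(scale0r 0) dotpZl mul0r. Qed.

Lemma dotp0 q : dotp q 0 = 0.
Proof. by rewrite dotpC dot0p. Qed.

Lemma dotp_suml (I : Type) (s : seq I) (P : pred I) (F : I -> 'rV[R]_n) q :
  dotp (\sum_(i <- s | P i) F i) q = \sum_(i <- s | P i) dotp (F i) q.
Proof. by apply: (big_morph (dotp^~ q)) => [p r|]; rewrite ?dotpDl ?dot0p. Qed.

Lemma dotp_sumr (I : Type) (s : seq I) (P : pred I) (F : I -> 'rV[R]_n) q :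
  dotp q (\sum_(i <- s | P i) F i) = \sum_(i <- s | P i) dotp q (F i).
Proof. by rewrite dotpC dotp_suml; apply: eq_bigr => i _; rewrite dotpC. Qed.

Lemma dotp_ge0 p : 0 <= dotp p p.
Proof. by apply: sumr_ge0 => i _; rewrite -expr2 sqr_ge0. Qed.

Lemma dotp_sqrD p q : dotp (p + q) (p + q) = dotp p p + 2 * dotp p q + dotp q q.
Proof. by rewrite dotpDl !dotpDr (dotpC q p); lra. Qed.

Lemma dotp_sqrB p q : dotp (p - q) (p - q) = dotp p p - 2 * dotp p q + dotp q q.
Proof. by rewrite dotp_sqrD dotpNr dotpNl dotpNr; lra. Qed.

Lemma enorm_ge0 p : 0 <= enorm p.
Proof. exact: sqrtr_ge0. Qed.

Lemma enorm_sqr p : enorm p ^+ 2 = dotp p p.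
Proof. by rewrite sqr_sqrtr// dotp_ge0. Qed.

Lemma dotp_eq0 p : dotp p p = 0 -> p = 0.
Proof.
move=> /eqP; rewrite psumr_eq0; last by move=> i _; rewrite -expr2 sqr_ge0.
move=> /allP h; apply/rowP => i; rewrite mxE.
by have /= := h i (mem_index_enum _); rewrite -expr2 sqrf_eq0 => /eqP.
Qed.

Lemma enorm0 : enorm (0 : 'rV[R]_n) = 0.
Proof. by rewrite /enorm dot0p sqrtr0. Qed.

Lemma enorm_eq0 p : enorm p = 0 -> p = 0.
Proof. by move=> p0; apply: dotp_eq0; rewrite -enorm_sqr p0 expr0n. Qed.

Lemma enormZ k p : enorm (k *: p) = `|k| * enorm p.
Proof.
rewrite /enorm dotpZl dotpZr mulrA -expr2 sqrtrM ?sqr_ge0//.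
by rewrite sqrtr_sqr.
Qed.

Lemma enormN p : enorm (- p) = enorm p.
Proof. by rewrite /enorm dotpNl dotpNr opprK. Qed.

Lemma dotp_le p q : dotp p q <= enorm p * enorm q.
Proof.
have [->|p0] := eqVneq p 0; first by rewrite dot0p enorm0 mul0r.
have [->|q0] := eqVneq q 0; first by rewrite dotp0 enorm0 mulr0.
have ep : 0 < enorm p by rewrite lt_neqAle enorm_ge0 andbT; apply: contra p0 => /eqP/esym/enorm_eq0/eqP.
have eq : 0 < enorm q by rewrite lt_neqAle enorm_ge0 andbT; apply: contra q0 => /eqP/esym/enorm_eq0/eqP.
have := dotp_ge0 (enorm q *: p - enorm p *: q).
rewrite dotpBl !dotpBr !dotpZl !dotpZr -!enorm_sqr (dotpC q p) => h.
have : 0 <= 2 * (enorm p * enorm q) * (enorm p * enorm q - dotp p q) by nra.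
by rewrite pmulr_rge0 ?subr_ge0// !mulr_gt0.
Qed.

Lemma enormD p q : enorm (p + q) <= enorm p + enorm q.
Proof.
rewrite -(@ler_pXn2r _ 2)// ?nnegrE ?addr_ge0 ?enorm_ge0//.
rewrite enorm_sqr dotpDl !dotpDr (dotpC q p) sqrrD -!enorm_sqr.
by have := dotp_le p q; lra.
Qed.

Lemma enormB p q : enorm (p - q) <= enorm p + enorm q.
Proof. by rewrite -(enormN q) enormD. Qed.

Lemma enorm_sum (I : Type) (s : seq I) (P : pred I) (F : I -> 'rV[R]_n) :
  enorm (\sum_(i <- s | P i) F i) <= \sum_(i <- s | P i) enorm (F i).
Proof.
elim/big_ind2 : _ => [|x y z t hx hz|//]; first by rewrite enorm0.
by rewrite (le_trans (enormD _ _))// lerD.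
Qed.

(** The test vector [e = p] is enough. Norm bounds on limits are proved in this dual form, where
    only scalar sequences have to converge. *)
Lemma enorm_le_dual p (C : R) : 0 <= C ->
  (forall e, dotp e p <= C * enorm e) -> enorm p <= C.
Proof.
move=> C0 h; have [->//|p0] := eqVneq (enorm p) 0.
have pp : 0 < enorm p by rewrite lt_neqAle eq_sym p0 enorm_ge0.
by have := h p; rewrite -enorm_sqr expr2 ler_pM2r.
Qed.

Lemma coord_le_enorm p i : `|p 0 i| <= enorm p.
Proof.
rewrite -sqrtr_sqr ler_sqrt ?dotp_ge0// /dotp (bigD1 i)//= -expr2 lerDl.
by apply: sumr_ge0 => j _; rewrite -expr2 sqr_ge0.
Qed.

Lemma enorm_le_sum p : enorm p <= \sum_(i < n) `|p 0 i|.
Proof.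
rewrite {1}(_ : p = \sum_(i < n) p 0 i *: delta_mx 0 i); last first.
  by rewrite -row_sum_delta.
rewrite (le_trans (enorm_sum _ _ _))// ler_sum// => i _.
rewrite enormZ ler_piMr// /enorm /dotp (bigD1 i)//= big1 ?mxE ?eqxx ?mulr1 ?addr0 ?sqrtr1//.
by move=> j ji; rewrite !mxE eqxx (negbTE ji) mulr0.
Qed.

End euclid.

(** * Subgradients of sublinear functions *)

Section sublinear.
Context {R : realType} {n : nat}.
Implicit Types (p q : 'rV[R]_n) (phi : 'rV[R]_n -> R).

Definition sublinear phi :=
  (forall p q, phi (p + q) <= phi p + phi q) /\
  (forall t p, 0 <= t -> phi (t *: p) = t * phi p).

(** Convexity at the midpoint of [2 *: p] and [2 *: q], with the factors removed by homogeneity. *)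
Lemma anisotropy_sublinear phi : anisotropy phi -> sublinear phi.
Proof.
move=> [_ cvx hom]; split; last by move=> t p t0; rewrite hom.
move=> p q.
have h0 : 0 <= 2^-1 :> R by lra.
have h1 : 2^-1 <= 1 :> R by lra.
have := cvx (Itv01 h0 h1) (2 *: p) (2 *: q).
rewrite !in_setT => /(_ isT isT).
rewrite /conv /= !scalerA !hom ?ler0n// /unstable.onem.
rewrite mulVf ?pnatr_eq0// scale1r (_ : (1 - 2^-1) * 2 = 1); last by lra.
rewrite scale1r => h; apply: (le_trans h).
rewrite le_eqVlt; apply/orP; left; apply/eqP.
by change (2^-1 * (2 * phi p) + (1 - 2^-1) * (2 * phi q) = phi p + phi q); lra.
Qed.

Lemma sublinear0 phi : sublinear phi -> phi 0 = 0.
Proof. by move=> [_ /(_ 0 0 (lexx _))]; rewrite scale0r mul0r. Qed.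

Lemma sublinearN_ge phi p : sublinear phi -> - phi (- p) <= phi p.
Proof.
move=> sl; have := sl.1 p (- p); rewrite subrr sublinear0//.
by lra.
Qed.

(* Replacing phi by [q |-> inf_t (phi (q + t p) - t phi p)] keeps it sublinear
   and makes it linear along p. *)
Lemma sublinear_improve phi p : sublinear phi ->
  exists psi, [/\ sublinear psi, forall q, psi q <= phi q,
    psi p = phi p & psi (- p) = - phi p].
Proof.
move=> sl; have [slD slZ] := sl.
pose S q := [set phi (q + t *: p) - t * phi p | t in [set t | 0 <= t]].
have lbS q : lbound (S q) (- phi (- q)).
  move=> _ [t /= t0 <-].
  have := slD (q + t *: p) (- q); rewrite addrAC subrr add0r slZ//; lra.
have S0 q : S q !=set0 by exists (phi (q + 0 *: p) - 0 * phi p), 0 => //=.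
have hlb q : has_inf (S q) by split => //; exists (- phi (- q)).
pose psi q := inf (S q).
have psile q t : 0 <= t -> psi q <= phi (q + t *: p) - t * phi p.
  by move=> t0; apply: ge_inf; [exists (- phi (- q))|exists t].
have gepsi q c : (forall t, 0 <= t -> c <= phi (q + t *: p) - t * phi p) -> c <= psi q.
  by move=> h; apply: lb_le_inf => // _ [t /= t0 <-]; exact: h.
have psi_phi q : psi q <= phi q.
  by have := psile q 0 (lexx _); rewrite scale0r mul0r addr0 subr0.
have psiD q r : psi (q + r) <= psi q + psi r.
  rewrite -lerBlDr; apply: (gepsi) => t t0.
  rewrite lerBlDr -lerBlDl; apply: (gepsi) => s s0.
  have := psile (q + r) (t + s) (addr_ge0 t0 s0).
  have := slD (q + t *: p) (r + s *: p).
  rewrite scalerDl addrACA; lra.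
have psi0 : psi 0 = 0.
  apply/le_anti/andP; split; first by rewrite -[leRHS](sublinear0 sl).
  by apply: (gepsi) => t t0; rewrite add0r slZ// subrr.
have psiZ_le t q : 0 < t -> psi (t *: q) <= t * psi q.
  move=> t0; rewrite -ler_pdivrMl//; apply: (gepsi) => s s0.
  rewrite ler_pdivrMl//.
  have := psile (t *: q) (t * s) (mulr_ge0 (ltW t0) s0).
  by rewrite -scalerA -scalerDr slZ ?(ltW t0)// mulrBr mulrA.
have psiZ t q : 0 <= t -> psi (t *: q) = t * psi q.
  rewrite le_eqVlt => /predU1P[<-|t0]; first by rewrite scale0r mul0r.
  apply/le_anti; rewrite psiZ_le//=.
  have := @psiZ_le t^-1 (t *: q); rewrite invr_gt0 => /(_ t0).
  by rewrite scalerA mulVf ?gt_eqF// scale1r ler_pdivlMl.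
have slpsi : sublinear psi by split.
have psiNp : psi (- p) <= - phi p.
  by have := psile (- p) 1 ler01; rewrite scale1r mul1r addNr sublinear0// add0r.
exists psi; split => //.
  apply/le_anti; rewrite psi_phi/=.
  by have := sublinearN_ge p slpsi; lra.
apply/le_anti; rewrite psiNp/= lerNl.
by have := sublinearN_ge p slpsi; have := psi_phi p; lra.
Qed.

(** Expanding q in the basis gives psi q <= <zeta, q>. The same bound at - q, together with - psi (-
    q) <= psi q, gives equality. *)
Lemma sublinear_linear psi : sublinear psi ->
  (forall i, psi (- delta_mx 0 i) = - psi (delta_mx 0 i)) ->
  exists zeta, forall q, psi q = dotp zeta q.
Proof.
move=> sl lin; have [slD slZ] := sl.
pose zeta : 'rV[R]_n := \row_i psi (delta_mx 0 i).
have psi_le q : psi q <= dotp zeta q.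
  rewrite {1}(row_sum_delta q) /dotp.
  elim/big_ind2 : _ => [|x y z t hx hz|i _].
  - by rewrite sublinear0.
  - by rewrite (le_trans (slD _ _))// lerD.
  - rewrite mxE; have [q0|q0] := leP 0 (q 0 i); first by rewrite slZ// mulrC.
    rewrite (_ : q 0 i *: _ = - q 0 i *: - delta_mx 0 i); last by rewrite scaleNr scalerN opprK.
    rewrite slZ; last by rewrite oppr_ge0 ltW.
    by rewrite lin mulrNN mulrC.
exists zeta => q; apply/le_anti; rewrite psi_le/=.
have := psi_le (- q); rewrite dotpNr; have := sublinearN_ge q sl; lra.
Qed.

(** Hahn-Banach in finite dimension: [sublinear_improve] is applied along p and then along each
    basis vector in turn, until the minorant is linear. *)
Lemma sublinear_subgradient phi p : sublinear phi ->
  exists zeta, dotp zeta p = phi p /\ forall q, dotp zeta q <= phi q.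
Proof.
move=> /(@sublinear_improve _ p)[psi0 [sl0 le0 psi0p psi0Np]].
have [psi [sl le lin psiNp]] : exists psi, [/\ sublinear psi,
    forall q, psi q <= psi0 q,
    forall i, psi (- delta_mx 0 i) = - psi (delta_mx 0 i) &
    psi (- p) = - phi p].
  suff [psi [sl le lin psip]] : exists psi, [/\ sublinear psi,
      forall q, psi q <= psi0 q,
      forall i, i \in enum 'I_n -> psi (- delta_mx 0 i) = - psi (delta_mx 0 i) &
      psi (- p) = - phi p].
    by exists psi; split => // i; apply: lin; rewrite mem_enum.
  elim: (enum 'I_n) => [|j s [psi [sl le lin psip]]]; first by exists psi0; split.
  (* A sublinear minorant cannot move on a line where [psi] is already linear, so each improvement
     preserves the earlier ones. *)
  have keep chi q : sublinear chi -> (forall q, chi q <= psi q) ->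
      psi (- q) = - psi q -> chi q = psi q /\ chi (- q) = - psi q.
    move=> slc lec lq; have := sublinearN_ge q slc.
    by have := lec q; have := lec (- q); rewrite lq => *; split; lra.
  have [chi [slc lec chij chiNj]] := sublinear_improve (delta_mx 0 j) sl.
  exists chi; split => //.
  - by move=> q; rewrite (le_trans (lec q)).
  - move=> i; rewrite inE => /predU1P[->|/lin lini]; first by rewrite chiNj chij.
    by have [-> ->] := keep _ _ slc lec lini.
  - have psipp : psi p = phi p.
      have := sublinearN_ge p sl; rewrite psip opprK => h.
      by apply/le_anti; rewrite h andbT (le_trans (le p)) ?psi0p.
    by have [_ ->] := keep _ p slc lec (etrans psip (congr1 -%R (esym psipp))); rewrite psipp.
have [zeta hz] := sublinear_linear sl lin.
exists zeta; split.
  by apply: oppr_inj; rewrite -dotpNr -hz psiNp.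
by move=> q; rewrite -hz (le_trans (le q)).
Qed.

End sublinear.

(** * The discrete resolvent *)

Section discrete_resolvent.
Context {R : realType} {n : nat}.
Variables (N : nat) (b : nat -> R).
Hypothesis b_ge0 : forall k, 0 <= b k.
Implicit Types (P w : nat -> 'rV[R]_n).

(* Edges are numbered by their right end point. *)
Definition incr P (k : nat) : 'rV[R]_n := P k - P k.-1.

(** The guard sets the flux to zero at both ends of the chain: this is the natural boundary
    condition of the minimisation over P. *)
Definition edge_flux P (k : nat) : 'rV[R]_n :=
  if (0 < k < N)%N then b k *: incr P k else 0.

(** The Euler equation of the sum of the |w_i - P_i|^2 and of the b_k |P_k - P_(k-1)|^2. The zero
    flux at N keeps [P N] out of it. *)
Definition resolves P w := forall i, (i < N)%N ->
  P i + edge_flux P i - edge_flux P i.+1 = w i.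

Lemma sum_nat_delta (g : nat -> R) j :
  \sum_(1 <= k < N) g k * (j == k)%:R = if (0 < j < N)%N then g j else 0.
Proof.
rewrite -(big_nat1_eq +%R) [RHS]big_mkcond/=; apply: eq_bigr => k _.
by rewrite eq_sym mulr_natr mulrb.
Qed.

(** The matrix of the system is the identity plus the sum of the b_k u_k^T u_k. It is positive
    definite, hence invertible, and the system is solved separately for each coordinate. *)
Lemma resolves_exists w : exists P, resolves P w.
Proof.
(* For a row x, [x *m (u k)^T] is the difference of its entries k and k - 1. *)
pose u (k : nat) : 'rV[R]_N := \row_j ((j == k :> nat)%:R - (j.+1 == k :> nat)%:R).
pose A : 'M[R]_N := 1%:M + \sum_(1 <= k < N) b k *: ((u k)^T *m u k).
have xAE (x : 'rV_N) : x *m A = x + \sum_(1 <= k < N) b k *: (x *m (u k)^T *m u k).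
  rewrite mulmxDr mulmx1 mulmx_sumr; congr (_ + _).
  by apply: eq_bigr => k _; rewrite -scalemxAr mulmxA.
have Aunit : A \in unitmx.
  (* A vector x of the kernel satisfies 0 = x A x^T = |x|^2 + sum of the b_k <x, u_k>^2, so it
     vanishes. *)
  rewrite -row_free_unit -kermx_eq0; apply/eqP/row_matrixP => i; rewrite row0.
  set x := row i _.
  have xA0 : x *m A = 0.
    exact: (sub_kermxP (row_sub i (kermx A))).
  have : (x *m A *m x^T) 0 0 = 0 by rewrite xA0 mul0mx mxE.
  rewrite xAE mulmxDl mxE mulmx_suml summxE => h.
  apply: dotp_eq0; apply/le_anti; rewrite dotp_ge0 andbT.
  have <- : (x *m x^T) 0 0 = dotp x x.
    by rewrite mxE; apply: eq_bigr => j _; rewrite [x^T _ _]mxE.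
  rewrite -h lerDl; apply: sumr_ge0 => k _.
  rewrite -scalemxAl mxE mulr_ge0// -(mulmxA _ (u k)).
  have -> : u k *m x^T = (x *m (u k)^T)^T by rewrite trmx_mul trmxK.
  by rewrite mxE big_ord1 [_^T _ _]mxE -expr2 sqr_ge0.
have [X XA] : exists X : 'I_n -> 'rV[R]_N, forall c, X c *m A = \row_j w j 0 c.
  by exists (fun c => (\row_j w j 0 c) *m invmx A) => c; rewrite mulmxKV.
(* The value 0 at indices from N on is a filler. *)
pose P i : 'rV[R]_n := \row_c (if insub i is Some j then X c 0 j else 0).
have PE (j : 'I_N) c : P j 0 c = X c 0 j by rewrite mxE valK.
exists P => i iN; apply/rowP => c.
have : (X c *m A) 0 (Ordinal iN) = w i 0 c by rewrite XA mxE.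
rewrite xAE mxE summxE -(PE (Ordinal iN)) => <-.
have addE (p q : 'rV[R]_n) : (p + q) 0 c = p 0 c + q 0 c by rewrite mxE.
have oppE (p : 'rV[R]_n) : (- p) 0 c = - p 0 c by rewrite mxE.
rewrite -addrA !addE oppE; congr (_ + _).
have Xu k : (1 <= k < N)%N -> (X c *m (u k)^T) 0 0 = incr P k 0 c.
  case: k => // k /= kN; rewrite mxE.
  under eq_bigr => j _ do rewrite !mxE mulrBr.
  rewrite sumrB /incr !mxE/= (bigD1 (Ordinal kN))//= eqxx mulr1 big1 ?addr0; last first.
    by move=> j /eqP jk; rewrite (_ : _ == _ = false) ?mulr0//; apply/eqP => e; apply: jk; apply: val_inj.
  rewrite (bigD1 (Ordinal (ltnW kN)))//= eqxx mulr1 big1 ?addr0; last first.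
    by move=> j /eqP jk; rewrite (_ : _ == _ = false) ?mulr0//; apply/eqP => -[e]; apply: jk; apply: val_inj.
  by rewrite -(PE (Ordinal kN)) -(PE (Ordinal (ltnW kN))) !mxE.
have -> : \sum_(1 <= k < N) (b k *: (X c *m (u k)^T *m u k)) 0 (Ordinal iN) =
    \sum_(1 <= k < N) (b k * incr P k 0 c) * (i == k)%:R
    - \sum_(1 <= k < N) (b k * incr P k 0 c) * (i.+1 == k)%:R.
  rewrite -sumrB [LHS]big_nat [RHS]big_nat; apply: eq_bigr => k kN.
  have uE : u k 0 (Ordinal iN) = (i == k)%:R - (i.+1 == k)%:R by rewrite mxE.
  by rewrite mxE [X in _ * X = _]mxE big_ord1 Xu// uE -mulrBr mulrA.
rewrite !sum_nat_delta /edge_flux; congr (_ - _).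
  by case: ifP => _; rewrite !mxE.
by case: ifP => _; rewrite !mxE.
Qed.

(** Abel summation. It serves for the fluxes and, later, for the values of a test function at the
    nodes; both vanish at the two ends. *)
Lemma sum_by_parts (y d : nat -> 'rV[R]_n) : (0 < N)%N -> y 0 = 0 -> y N = 0 ->
  \sum_(0 <= i < N) dotp (y i - y i.+1) (d i) =
  \sum_(1 <= k < N) dotp (y k) (incr d k).
Proof.
case: N => // M _ y0 yM.
have -> : \sum_(0 <= i < M.+1) dotp (y i - y i.+1) (d i) =
    \sum_(0 <= i < M.+1) dotp (y i) (d i) - \sum_(0 <= i < M.+1) dotp (y i.+1) (d i).
  by rewrite -sumrB; apply: eq_bigr => i _; rewrite dotpBl.
rewrite big_nat_recl// [X in _ - X]big_nat_recr//= y0 yM !dot0p add0r addr0.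
rewrite big_add1/= -sumrB; apply: eq_bigr => i _.
by rewrite /incr/= dotpBr.
Qed.

Lemma edge_fluxN P : edge_flux P N = 0.
Proof. by rewrite /edge_flux ltnn andbF. Qed.

(** The weak form of the equation: summation by parts moves the difference from the flux to the test
    sequence d. *)
Lemma resolves_dot P w d : (0 < N)%N -> resolves P w ->
  \sum_(0 <= i < N) dotp (w i - P i) (d i) =
  \sum_(1 <= k < N) b k * dotp (incr P k) (incr d k).
Proof.
move=> N0 h; rewrite -[LHS](@eq_big_nat _ _ _ _ _ (fun i =>
  dotp (edge_flux P i - edge_flux P i.+1) (d i))); last first.
  move=> i iN; congr (dotp _ _); rewrite -h//.
  by apply/rowP => j; rewrite !mxE; ring.
rewrite sum_by_parts ?edge_fluxN//; apply: eq_big_nat => k k1N.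
by rewrite /edge_flux k1N dotpZl.
Qed.

(** Writing P' = P + d, the terms linear in d cancel by the weak form and those quadratic in d are
    nonnegative. *)
Lemma resolves_min P w P' : (0 < N)%N -> resolves P w ->
  \sum_(0 <= i < N) enorm (w i - P i) ^+ 2 +
    \sum_(1 <= k < N) b k * enorm (incr P k) ^+ 2 <=
  \sum_(0 <= i < N) enorm (w i - P' i) ^+ 2 +
    \sum_(1 <= k < N) b k * enorm (incr P' k) ^+ 2.
Proof.
move=> N0 /(resolves_dot (fun i => P' i - P i) N0) h.
have -> : \sum_(0 <= i < N) enorm (w i - P' i) ^+ 2 =
    \sum_(0 <= i < N) enorm (w i - P i) ^+ 2
    - 2 * (\sum_(0 <= i < N) dotp (w i - P i) (P' i - P i))
    + \sum_(0 <= i < N) enorm (P' i - P i) ^+ 2.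
  rewrite mulr_sumr -sumrB -big_split; apply: eq_bigr => i _ /=.
  have -> : w i - P' i = (w i - P i) - (P' i - P i) by apply/rowP => j; rewrite !mxE; ring.
  by rewrite !enorm_sqr dotp_sqrB.
have -> : \sum_(1 <= k < N) b k * enorm (incr P' k) ^+ 2 =
    \sum_(1 <= k < N) b k * enorm (incr P k) ^+ 2
    + 2 * (\sum_(1 <= k < N) b k * dotp (incr P k) (incr (fun i => P' i - P i) k))
    + \sum_(1 <= k < N) b k * enorm (incr (fun i => P' i - P i) k) ^+ 2.
  rewrite mulr_sumr -!big_split; apply: eq_bigr => k _ /=.
  have -> : incr P' k = incr P k + incr (fun i => P' i - P i) k.
    by apply/rowP => j; rewrite /incr !mxE; ring.
  by rewrite !enorm_sqr dotp_sqrD; ring.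
rewrite h.
have h1 : 0 <= \sum_(0 <= i < N) enorm (P' i - P i) ^+ 2.
  by apply: sumr_ge0 => i _; rewrite sqr_ge0.
have h2 : 0 <= \sum_(1 <= k < N) b k * enorm (incr (fun i => P' i - P i) k) ^+ 2.
  by apply: sumr_ge0 => i _; rewrite mulr_ge0 ?sqr_ge0.
lra.
Qed.

Lemma resolvesB P w P' w' : resolves P w -> resolves P' w' ->
  resolves (fun i => P i - P' i) (fun i => w i - w' i).
Proof.
move=> h h' i iN; rewrite -h// -h'//.
have fluxB k : edge_flux (fun i => P i - P' i) k = edge_flux P k - edge_flux P' k.
  rewrite /edge_flux; case: ifP => _; last by rewrite subr0.
  by apply/rowP => j; rewrite /incr !mxE; ring.
rewrite !fluxB; apply/rowP => j; rewrite !mxE; ring.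
Qed.

(** With x = w - w' and y = P - P', the weak form of the difference of the equations, tested with y,
    gives <x - y, y> >= 0; then |x|^2 - |y|^2 >= 2 <x - y, y> concludes. *)
Lemma resolves_contraction P w P' w' : (0 < N)%N ->
  resolves P w -> resolves P' w' ->
  \sum_(0 <= i < N) enorm (P i - P' i) ^+ 2 <=
  \sum_(0 <= i < N) enorm (w i - w' i) ^+ 2.
Proof.
move=> N0 h h'; have hB := resolvesB h h'.
have := resolves_dot (fun i => P i - P' i) N0 hB.
set S := (X in _ = X) => e.
have S0 : 0 <= S.
  by apply: sumr_ge0 => k _; rewrite mulr_ge0 ?dotp_ge0.
rewrite -subr_ge0 -sumrB.
apply: (@le_trans _ _ (2 * S)); first by rewrite mulr_ge0.
rewrite -e mulr_sumr; apply: ler_sum => i _.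
move: (w i - w' i) (P i - P' i) => x y.
rewrite !enorm_sqr; have := dotp_ge0 (x - y).
by rewrite dotp_sqrB dotpBl; lra.
Qed.

(* The second difference of a flux pointing along the gradient pairs
   nonnegatively with the subgradients: the diagonal terms are exact, the
   off-diagonal ones only lose. *)
Lemma resolves_energy (phi : 'rV[R]_n -> R) (zeta : nat -> 'rV[R]_n) P w :
  (0 < N)%N -> resolves P w -> (forall p, 0 <= phi p) -> sublinear phi ->
  (forall k, dotp (zeta k) (incr P k) = phi (incr P k)) ->
  (forall k q, dotp (zeta k) q <= phi q) ->
  \sum_(1 <= k < N) phi (incr P k) <= \sum_(1 <= k < N) dotp (zeta k) (incr w k).
Proof.
move=> N0 h phi0 sl ze zle.
pose f k := if (0 < k < N)%N then b k * phi (incr P k) else 0.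
have f0 k : 0 <= f k by rewrite /f; case: ifP => // _; rewrite mulr_ge0.
have zf k j : dotp (zeta k) (edge_flux P j) <= f j.
  rewrite /edge_flux /f; case: ifP => _; last by rewrite dotp0.
  by rewrite dotpZr ler_wpM2l.
have zfk k : dotp (zeta k) (edge_flux P k) = f k.
  rewrite /edge_flux /f; case: ifP => _; last by rewrite dotp0.
  by rewrite dotpZr ze.
have step k : (1 <= k < N)%N ->
    phi (incr P k) + ((f k - f k.-1) + (f k - f k.+1)) <= dotp (zeta k) (incr w k).
  case: k => // k /= kN.
  have -> : incr w k.+1 = incr P k.+1 + ((edge_flux P k.+1 - edge_flux P k)
      + (edge_flux P k.+1 - edge_flux P k.+2)).
    rewrite /incr/= -h// -h//; last exact: ltnW.
    by apply/rowP => j; rewrite !mxE; ring.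
  rewrite dotpDr ze dotpDr !dotpBr !zfk; have := zf k.+1 k; have := zf k.+1 k.+2; lra.
apply: (@le_trans _ _ (\sum_(1 <= k < N)
    (phi (incr P k) + ((f k - f k.-1) + (f k - f k.+1))))); last first.
  by rewrite big_nat [leRHS]big_nat; exact: ler_sum.
rewrite big_split/= lerDl big_split/= addr_ge0//.
(* The two telescoping sums leave [f N.-1 - f 0] and [f 1 - f N], and [f] vanishes at 0 and at N
   because the flux does. *)
- case: N N0 => // M _; rewrite big_add1/= telescope_sumr//.
  by rewrite {2}/f/= subr0 f0.
- rewrite (eq_bigr (fun k => - (f k.+1 - f k))); last by move=> k _; rewrite opprB.
  have fN : f N = 0 by rewrite /f ltnn andbF.
  by rewrite sumrN telescope_sumr// fN sub0r opprK.
Qed.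

End discrete_resolvent.

(** * Integrals and the space L^2 *)

Section integral_tools.
Context d (T : measurableType d) (R : realType).
Variable mu : {measure set T -> \bar R}.
Implicit Types (D : set T).

(** The integral of a nonnegative function is a supremum over the simple functions below it, so
    monotonicity holds without measurability. This spares any discussion of the measurability of
    [phi (derive1 u x)] in x or of [L2norm] in time. *)
Lemma ge0_le_integralW D (f g : T -> \bar R) : (forall x, D x -> 0 <= f x)%E ->
  (forall x, D x -> f x <= g x)%E ->
  (\int[mu]_(x in D) f x <= \int[mu]_(x in D) g x)%E.
Proof.
move=> f0 fg; have g0 x : D x -> (0 <= g x)%E by move=> Dx; rewrite (le_trans (f0 x Dx)) ?fg.
rewrite !ge0_integralE//; apply: le_ereal_sup => _ [h /= hf <-]; exists h => //= x.
apply: (le_trans (hf x)); rewrite !patchE; case: ifPn => // xD.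
by apply: fg; rewrite inE in xD.
Qed.

Lemma Rintegral_sum (J : Type) (s : seq J) (F : J -> T -> R) D :
  measurable D -> (forall j, mu.-integrable D (EFin \o F j)) ->
  \int[mu]_(x in D) (\sum_(j <- s) F j x) = \sum_(j <- s) \int[mu]_(x in D) F j x.
Proof.
move=> mD intF; elim: s => [|j s ih].
  rewrite big_nil; under eq_Rintegral do rewrite big_nil.
  by rewrite Rintegral_cst// mul0r.
rewrite big_cons -ih; under eq_Rintegral do rewrite big_cons.
rewrite RintegralD//.
have := @integrable_sum _ _ _ mu D mD _ s xpredT (fun j => EFin \o F j) (fun j _ => intF j).
by apply: eq_integrable => // x _ /=; rewrite sumEFin.
Qed.

Lemma integrable_Rsum (J : Type) (s : seq J) (F : J -> T -> R) D :
  measurable D -> (forall j, mu.-integrable D (EFin \o F j)) ->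
  mu.-integrable D (EFin \o (fun x => \sum_(j <- s) F j x)).
Proof.
move=> mD intF.
have := @integrable_sum _ _ _ mu D mD _ s xpredT (fun j => EFin \o F j) (fun j _ => intF j).
by apply: eq_integrable => // x _ /=; rewrite sumEFin.
Qed.

Lemma integrable_RD D (f g : T -> R) : measurable D ->
  mu.-integrable D (EFin \o f) -> mu.-integrable D (EFin \o g) ->
  mu.-integrable D (EFin \o (fun x => f x + g x)).
Proof. by move=> mD hf hg; have := integrableD mD hf hg; apply: eq_integrable. Qed.

Lemma integrable_RB D (f g : T -> R) : measurable D ->
  mu.-integrable D (EFin \o f) -> mu.-integrable D (EFin \o g) ->
  mu.-integrable D (EFin \o (fun x => f x - g x)).
Proof. by move=> mD hf hg; have := integrableB mD hf hg; apply: eq_integrable. Qed.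

Lemma integrable_RZ D (f : T -> R) k : measurable D ->
  mu.-integrable D (EFin \o f) -> mu.-integrable D (EFin \o (fun x => k * f x)).
Proof. by move=> mD hf; have := integrableZl mD k hf; apply: eq_integrable. Qed.

Lemma integrable_Rle D (f g : T -> R) : measurable D -> measurable_fun D f ->
  (forall x, D x -> `|f x| <= g x) ->
  mu.-integrable D (EFin \o g) -> mu.-integrable D (EFin \o f).
Proof.
move=> mD mf fg intg; apply: (le_integrable mD _ _ intg).
  exact/measurable_EFinP.
move=> x Dx /=; rewrite lee_fin (le_trans (fg _ Dx))// ler_norm//.
Qed.

Lemma integrable_Rmeasurable D (f : T -> R) :
  mu.-integrable D (EFin \o f) -> measurable_fun D f.
Proof. by move=> /integrableP[/measurable_EFinP]. Qed.

Lemma Rintegral_EFin D (f : T -> R) : measurable D -> mu.-integrable D (EFin \o f) ->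
  (\int[mu]_(x in D) (f x)%:E)%E = (\int[mu]_(x in D) f x)%:E.
Proof. by move=> mD hf; rewrite /Rintegral fineK//; exact: integrable_fin_num. Qed.

Lemma ge0_integrable D (f : T -> R) : measurable D -> measurable_fun D f ->
  (forall x, D x -> 0 <= f x) -> (\int[mu]_(x in D) (f x)%:E < +oo)%E ->
  mu.-integrable D (EFin \o f).
Proof.
move=> mD mf f0 fi; apply/integrableP; split; first exact/measurable_EFinP.
under eq_integral => x xD.
  rewrite /= ger0_norm ?f0//; last by rewrite inE in xD.
  over.
by [].
Qed.

Lemma Rdominated_cvg D (f_ : nat -> T -> R) (f g : T -> R) :
  measurable D -> (forall k, measurable_fun D (f_ k)) ->
  (forall x, D x -> f_ k x @[k --> \oo] --> f x) ->
  (forall k x, D x -> `|f_ k x| <= g x) -> mu.-integrable D (EFin \o g) ->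
  mu.-integrable D (EFin \o f) /\
  \int[mu]_(x in D) f_ k x @[k --> \oo] --> \int[mu]_(x in D) f x.
Proof.
move=> mD mf_ cvf domf intg.
have mf : measurable_fun D f by apply: measurable_fun_cvg mf_ _.
have [] := @dominated_convergence _ _ _ mu D mD (fun k => EFin \o f_ k) (EFin \o f) (EFin \o g).
- by move=> k; exact/measurable_EFinP.
- exact/measurable_EFinP.
- by apply: aeW => x Dx; apply: cvg_EFin; [exact: nearW|exact: cvf].
- exact: intg.
- by apply: aeW => x k Dx /=; rewrite lee_fin; exact: domf.
move=> intf _ cv; split => //.
by apply: fine_cvg; rewrite -(Rintegral_EFin mD intf).
Qed.

End integral_tools.

Section L2_space.
Context {R : realType} {n : nat}.
Variable I : set R.
Hypothesis mI : measurable (I : set (measurableTypeR R)).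
Local Notation mu := (@lebesgue_measure R).
Implicit Types w z : R -> 'rV[R]_n.

Definition L2sq w : R := L2dot I w w.

Lemma measurable_dotp w z : (forall i, measurable_fun I (fun x => w x 0 i)) ->
  (forall i, measurable_fun I (fun x => z x 0 i)) ->
  measurable_fun I (fun x => dotp (w x) (z x)).
Proof. by move=> mw mz; apply: measurable_sum => i; exact: measurable_funM. Qed.

Lemma L2normE w : L2norm I w =
  ((\int[mu]_(x in I) (dotp (w x) (w x))%:E) `^ 2^-1)%E.
Proof.
rewrite /L2norm unlock /Lnorm; congr (_ `^ _)%E.
rewrite [RHS]integral_mkcond; apply: eq_integral => x _.
rewrite !patchE; case: ifPn => _; last by rewrite abse0 poweR0r.
by rewrite /= ger0_norm ?enorm_ge0// powR_mulrn ?enorm_ge0// enorm_sqr.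
Qed.

Lemma is_L2P w : is_L2 I w <->
  (forall i, measurable_fun I (fun x => w x 0 i)) /\
  mu.-integrable I (EFin \o (fun x => dotp (w x) (w x))).
Proof.
split=> [[mw]|[mw intw]].
  rewrite L2normE => /lty_poweRy h; split => //.
  apply: ge0_integrable => //; first exact: measurable_dotp.
    by move=> x _; exact: dotp_ge0.
  by apply: h; rewrite invr_neq0// pnatr_eq0.
split => //; rewrite L2normE poweR_lty//.
by rewrite Rintegral_EFin// ltry.
Qed.

Lemma L2norm_fin w : is_L2 I w -> L2norm I w = (Num.sqrt (L2sq w))%:E.
Proof.
move=> /is_L2P[mw intw]; rewrite L2normE Rintegral_EFin//=.
by rewrite powR12_sqrt// Rintegral_ge0// => x _; exact: dotp_ge0.
Qed.

Lemma L2sq_ge0 w : 0 <= L2sq w.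
Proof. by apply: Rintegral_ge0 => x _; exact: dotp_ge0. Qed.

Lemma L2dot_integrable w z : is_L2 I w -> is_L2 I z ->
  mu.-integrable I (EFin \o (fun x => dotp (w x) (z x))).
Proof.
move=> /is_L2P[mw intw] /is_L2P[mz intz].
apply: (integrable_Rle mI (measurable_dotp mw mz) _ (integrable_RD mI intw intz)).
move=> x _; have := dotp_ge0 (w x - z x); have := dotp_ge0 (w x + z x).
  rewrite dotp_sqrD dotp_sqrB ler_norml; have := dotp_ge0 (w x); have := dotp_ge0 (z x); lra.
Qed.

Lemma is_L2D w z : is_L2 I w -> is_L2 I z -> is_L2 I (w + z).
Proof.
move=> hw hz; have /is_L2P[mw intw] := hw; have /is_L2P[mz intz] := hz; apply/is_L2P; split.
  move=> i; apply: (eq_measurable_fun (fun x => w x 0 i + z x 0 i)).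
    by move=> x _; rewrite mxE.
  exact: measurable_funD.
have := integrable_RD mI (integrable_RD mI intw (integrable_RZ 2 mI (L2dot_integrable hw hz))) intz.
by apply: eq_integrable => // x _ /=; rewrite dotp_sqrD.
Qed.

Lemma is_L2Z k w : is_L2 I w -> is_L2 I (fun x => k *: w x).
Proof.
move=> hw; have /is_L2P[mw intw] := hw; apply/is_L2P; split.
  move=> i; apply: (eq_measurable_fun (fun x => k * w x 0 i)).
    by move=> x _; rewrite mxE.
  exact: measurable_funM.
have := integrable_RZ (k * k) mI intw.
by apply: eq_integrable => // x _ /=; rewrite dotpZl dotpZr mulrA.
Qed.

Lemma is_L2N w : is_L2 I w -> is_L2 I (- w).
Proof.
by move=> /(@is_L2Z (-1)); congr is_L2; apply: funext => x; rewrite scaleN1r.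
Qed.

Lemma is_L2B w z : is_L2 I w -> is_L2 I z -> is_L2 I (w - z).
Proof. by move=> hw hz; apply: is_L2D => //; exact: is_L2N. Qed.

Lemma is_L2_sum (J : Type) (s : seq J) (c : J -> R) (w : J -> R -> 'rV[R]_n) :
  (forall j, is_L2 I (w j)) -> is_L2 I (fun x => \sum_(j <- s) c j *: w j x).
Proof.
move=> hw; elim: s => [|j s ih].
  apply/is_L2P; split.
    move=> i; rewrite (_ : (fun x => _) = cst 0); first exact: measurable_cst.
    by apply: funext => x; rewrite big_nil mxE.
  have := integrable0 mu I; apply: eq_integrable => // x _ /=.
  by rewrite big_nil dot0p.
have := is_L2D (is_L2Z (c j) (hw j)) ih; congr is_L2; apply: funext => x.
by rewrite big_cons.
Qed.

Lemma L2dotC w z : L2dot I w z = L2dot I z w.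
Proof. by apply: eq_Rintegral => x _; rewrite dotpC. Qed.

Lemma L2dotDl w z y : is_L2 I w -> is_L2 I z -> is_L2 I y ->
  L2dot I (w + z) y = L2dot I w y + L2dot I z y.
Proof.
move=> hw hz hy; rewrite -RintegralD//; try exact: L2dot_integrable.
by apply: eq_Rintegral => x _; rewrite dotpDl.
Qed.

Lemma L2dotZl k w z : is_L2 I w -> is_L2 I z ->
  L2dot I (fun x => k *: w x) z = k * L2dot I w z.
Proof.
move=> hw hz; rewrite -RintegralZl//; try exact: L2dot_integrable.
by apply: eq_Rintegral => x _; rewrite dotpZl.
Qed.

Lemma L2dotNl w z : is_L2 I w -> is_L2 I z ->
  L2dot I (- w) z = - L2dot I w z.
Proof.
move=> hw hz; rewrite -mulN1r -L2dotZl//.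
by apply: eq_Rintegral => x _; rewrite scaleN1r.
Qed.

Lemma L2dotBl w z y : is_L2 I w -> is_L2 I z -> is_L2 I y ->
  L2dot I (w - z) y = L2dot I w y - L2dot I z y.
Proof. by move=> hw hz hy; rewrite L2dotDl ?L2dotNl//; exact: is_L2N. Qed.

Lemma L2dotBr w z y : is_L2 I w -> is_L2 I z -> is_L2 I y ->
  L2dot I y (w - z) = L2dot I y w - L2dot I y z.
Proof. by move=> *; rewrite !(L2dotC y) L2dotBl. Qed.

Lemma L2dotDr w z y : is_L2 I w -> is_L2 I z -> is_L2 I y ->
  L2dot I y (w + z) = L2dot I y w + L2dot I y z.
Proof. by move=> *; rewrite !(L2dotC y) L2dotDl. Qed.

Lemma L2sqD w z : is_L2 I w -> is_L2 I z ->
  L2sq (w + z) = L2sq w + 2 * L2dot I w z + L2sq z.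
Proof.
move=> hw hz; have hwz := is_L2D hw hz.
by rewrite /L2sq L2dotDl// !L2dotDr// (L2dotC z w); lra.
Qed.

Lemma L2sqB w z : is_L2 I w -> is_L2 I z ->
  L2sq (w - z) = L2sq w - 2 * L2dot I w z + L2sq z.
Proof.
move=> hw hz; have hwz := is_L2B hw hz.
by rewrite /L2sq L2dotBl// !L2dotBr// (L2dotC z w); lra.
Qed.

Lemma L2sq_sub_le w z : is_L2 I w -> is_L2 I z ->
  L2sq (w - z) <= 2 * L2sq w + 2 * L2sq z.
Proof.
by move=> hw hz; have := L2sq_ge0 (w + z); rewrite L2sqD// L2sqB//; lra.
Qed.

Lemma L2sqZ k w : is_L2 I w -> L2sq (fun x => k *: w x) = k ^+ 2 * L2sq w.
Proof.
move=> hw; have hk := is_L2Z k hw.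
by rewrite /L2sq L2dotZl// L2dotC L2dotZl// mulrA.
Qed.

(** The polynomial |k w - z|^2 in k is nonnegative, so its discriminant is nonpositive. *)
Lemma L2dot_le w z : is_L2 I w -> is_L2 I z ->
  `|L2dot I w z| <= Num.sqrt (L2sq w) * Num.sqrt (L2sq z).
Proof.
move=> hw hz; rewrite -sqrtrM ?L2sq_ge0// -sqrtr_sqr ler_sqrt ?mulr_ge0 ?L2sq_ge0//.
have key k : 0 <= L2sq w * k ^+ 2 - 2 * k * L2dot I w z + L2sq z.
  have := L2sq_ge0 ((fun x => k *: w x) - z).
  have hk := is_L2Z k hw.
  by rewrite L2sqB// L2sqZ// L2dotZl//; lra.
have [w0|w0] := eqVneq (L2sq w) 0.
  have [->|d0] := eqVneq (L2dot I w z) 0; first by rewrite expr0n/= mulr_ge0 ?L2sq_ge0.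
  (* If |w| = 0 the polynomial is affine in k, and this k would give it the value -1. *)
  have := key ((L2sq z + 1) / (2 * L2dot I w z)).
  rewrite w0 mul0r sub0r (_ : 2 * _ * _ = L2sq z + 1); first lra.
  by field.
have wp : 0 < L2sq w by rewrite lt_neqAle eq_sym w0 L2sq_ge0.
have := key (L2dot I w z / L2sq w).
rewrite (_ : _ + _ = (L2sq w * L2sq z - L2dot I w z ^+ 2) / L2sq w); last by field.
by rewrite pmulr_lge0 ?invr_gt0// subr_ge0.
Qed.

Lemma L2dot_le_young w z (k : R) : 0 < k -> is_L2 I w -> is_L2 I z ->
  2 * L2dot I w z <= k * L2sq w + k^-1 * L2sq z.
Proof.
move=> k0 hw hz; have := L2sq_ge0 ((fun x => k *: w x) - z).
have hk := is_L2Z k hw; rewrite L2sqB// L2sqZ// L2dotZl// => h.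
rewrite -(ler_pM2l k0) mulrDr mulVKf ?gt_eqF//; lra.
Qed.

End L2_space.

(** * Smooth functions *)

Section smooth_functions.
Context {R : realType}.
Implicit Types (f g : R -> R).

(** [derive1n] adds derivatives on the outside. Recursing on the derivative of f instead allows sums
    and products to be treated by induction on k. *)
Fixpoint derivable_upto k f : Prop :=
  if k is k'.+1 then (forall x, derivable f x 1) /\ derivable_upto k' (derive1 f)
  else True.

Definition smooth f := forall k, derivable_upto k f.

Lemma smoothP f : (forall x, derivable f x 1) -> smooth (derive1 f) -> smooth f.
Proof. by move=> df sf [|k]//=; split. Qed.

Lemma smooth_derivable f x : smooth f -> derivable f x 1.
Proof. by move=> /(_ 1)[]. Qed.

Lemma smooth_derive1 f : smooth f -> smooth (derive1 f).
Proof. by move=> sf k; have [] := sf k.+1. Qed.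

Lemma smooth_continuous f : smooth f -> continuous f.
Proof.
by move=> sf x; apply/differentiable_continuous/derivable1_diffP/smooth_derivable.
Qed.

Lemma smooth_derive1n f k : smooth f -> smooth (derive1n k f).
Proof.
elim: k => [//|k ih] sf; rewrite derive1nS.
exact/smooth_derive1/ih.
Qed.

Lemma smooth_is_derive f f' : (forall x : R, is_derive x 1 f (f' x)) ->
  smooth f' -> smooth f.
Proof.
move=> df sf'; apply: smoothP; first by move=> x; exact: ex_derive.
suff -> : (derive1 f) = f' by [].
by apply: funext => x; rewrite derive1E derive_val.
Qed.

Lemma is_derive1_derivable f x : derivable f x 1 -> is_derive x 1 f ((derive1 f) x).
Proof. by move=> df; split => //; rewrite derive1E. Qed.

Lemma smooth_cst (c : R) : smooth (cst c).
Proof.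
move=> k; elim: k c => [//|k ih] c /=; split.
  by move=> x; apply: ex_derive.
suff -> : (derive1 (cst c)) = cst 0 by exact: ih.
by apply: funext => x; rewrite derive1E derive_val.
Qed.

Lemma derivable_uptoD k f g : derivable_upto k f -> derivable_upto k g ->
  derivable_upto k (f + g).
Proof.
elim: k f g => [//|k ih] f g /= [df sf] [dg sg].
have h (x : R) : is_derive x 1 (f + g) ((derive1 f) x + (derive1 g) x).
  by apply: is_deriveD; exact: is_derive1_derivable.
split; first by move=> x; exact: ex_derive.
suff -> : (derive1 (f + g)) = (derive1 f) + (derive1 g) by exact: ih.
by apply: funext => x; rewrite derive1E derive_val.
Qed.

Lemma smoothD f g : smooth f -> smooth g -> smooth (f + g).
Proof. by move=> sf sg k; exact: derivable_uptoD. Qed.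

Lemma smoothM f g : smooth f -> smooth g -> smooth (f * g).
Proof.
move=> + + k; elim: k f g => [//|k ih] f g sf sg /=.
have h (x : R) : is_derive x 1 (f * g) (f x * (derive1 g) x + g x * (derive1 f) x).
  by apply: is_deriveM; apply: is_derive1_derivable; exact: smooth_derivable.
split; first by move=> x; exact: ex_derive.
have -> : (derive1 (f * g)) = f * (derive1 g) + g * (derive1 f).
  by apply: funext => x; rewrite derive1E derive_val.
by apply: derivable_uptoD; apply: ih => //; exact: smooth_derive1.
Qed.

Lemma smoothZ c f : smooth f -> smooth (fun x => c * f x).
Proof. by move=> sf; apply: (smoothM (smooth_cst c) sf). Qed.

Lemma smoothB f g : smooth f -> smooth g -> smooth (fun x => f x - g x).
Proof.
move=> sf sg.
have -> : (fun x => f x - g x) = f + (fun x => -1 * g x).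
  by apply: funext => x; change (f x - g x = f x + -1 * g x); ring.
by apply: smoothD => //; exact: smoothZ.
Qed.

Lemma derivable_uptoZ k c g : derivable_upto k g -> derivable_upto k (cst c * g).
Proof.
elim: k g => [//|j ihj] g /= [dg sg].
have hg (x : R) : is_derive x 1 (cst c * g) (c * (derive1 g) x + g x * 0).
  by apply: is_deriveM; exact: is_derive1_derivable.
split; first by move=> x; exact: ex_derive.
have -> : derive1 (cst c * g) = cst c * (derive1 g).
  by apply: funext => x; rewrite derive1E derive_val mulr0 addr0.
exact: ihj.
Qed.

Lemma smooth_affine f (c e : R) : smooth f -> smooth (fun x => f (c * x + e)).
Proof.
move=> + k; elim: k f => [//|k ih] f sf /=.
have h (x : R) : is_derive x 1 (fun x => f (c * x + e)) ((derive1 f) (c * x + e) * c).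
  apply: (@is_derive1_comp _ f (fun x => c * x + e) x).
    by apply: is_derive1_derivable; exact: smooth_derivable.
  have d1 : is_derive x 1 (fun y : R => c * y) c.
    have := @is_deriveM _ _ (cst c) id x 1 _ _ (is_derive_cst c x 1) (is_derive_id x 1).
    by move/is_derive_eq; apply; rewrite /GRing.scale/= mulr1 mulr0 addr0.
  have := @is_deriveD _ _ _ _ _ x 1 _ _ d1 (is_derive_cst e x 1).
  by move/is_derive_eq; apply; rewrite addr0.
split; first by move=> x; exact: ex_derive.
have -> : (derive1 (fun x => f (c * x + e))) = (fun x => (derive1 f) (c * x + e)) * cst c.
  by apply: funext => x; rewrite derive1E derive_val.
by rewrite mulrC; apply: derivable_uptoZ; apply: ih; exact: smooth_derive1.
Qed.

Lemma test_fun_smooth (J K : set R) f : smooth f -> compact K -> K `<=` J ->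
  (forall x, ~ K x -> f x = 0) -> test_fun J f.
Proof.
move=> sf cK KJ f0; split; last by exists K.
by move=> k x; apply: smooth_derivable; exact: smooth_derive1n.
Qed.

Lemma test_fun_is_smooth (J : set R) f : test_fun J f -> smooth f.
Proof.
move=> [df _] k; have : forall j x, derivable (derive1n j f) x 1 by [].
elim: k f {df} => [//|k ih] f df /=; split; first exact: (df 0%N).
apply: ih => j x; have := df j.+1 x.
suff -> : derive1n j.+1 f = derive1n j (derive1 f) by [].
by elim: j => [//|j ihj]; rewrite derive1nS ihj -derive1nS.
Qed.

End smooth_functions.

(** * The flat function exp(-1/x) *)

Section smooth_cutoff.
Context {R : realType}.

(** From y / m <= exp (y / m), raised to the power m. *)
Lemma expR_ge_exp (m : nat) (y : R) : 0 <= y -> y ^+ m <= m%:R ^+ m * expR y.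
Proof.
move=> y0; have [->|m0] := eqVneq m 0%N; first by rewrite !expr0 mul1r (le_trans _ (expR_ge1Dx y))// lerDl.
have mp : 0 < m%:R :> R by rewrite ltr0n lt0n.
have : (y / m%:R) ^+ m <= expR (y / m%:R) ^+ m.
  apply: lerXn2r; rewrite ?nnegrE ?expR_ge0 ?divr_ge0 ?(ltW mp)//.
  by have := expR_ge1Dx (y / m%:R); lra.
rewrite -expRM_natl (mulrC m%:R) divfK ?gt_eqF// expr_div_n ler_pdivrMr ?exprn_gt0//.
by rewrite mulrC.
Qed.

(** The derivative of a member of this family is a linear combination of members, so exp(-1/x), the
    case k = 0, is smooth by an induction that treats all k together. *)
Definition flat_pow (k : nat) (x : R) : R :=
  if 0 < x then x^-1 ^+ k * expR (- x^-1) else 0.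

(** The exponential beats the power k + 2 of 1/x. The two spare powers of x give the derivative 0 at
    the origin. *)
Lemma flat_pow_bound k x : `|flat_pow k x| <= k.+2%:R ^+ k.+2 * x ^+ 2.
Proof.
rewrite /flat_pow; case: ifPn => x0; last first.
  by rewrite normr0 mulr_ge0 ?sqr_ge0// exprn_ge0.
have xi : 0 < x^-1 by rewrite invr_gt0.
rewrite ger0_norm ?mulr_ge0 ?expR_ge0 ?exprn_ge0 ?(ltW xi)//.
have := expR_ge_exp k.+2 (ltW xi).
rewrite expRN ler_pdivrMr ?expR_gt0// => h.
rewrite -(ler_pM2r (exprn_gt0 2 xi)) -exprD addn2 (le_trans h)//.
rewrite le_eqVlt; apply/orP; left; apply/eqP; rewrite !exprVn.
by field; rewrite gt_eqF.
Qed.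

Lemma is_derive_flat0 (f : R -> R) (C : R) :
  (forall x, `|f x| <= C * x ^+ 2) -> is_derive (0 : R) 1 f 0.
Proof.
move=> hf.
have f0 : f 0 = 0.
  by apply/eqP; rewrite -normr_le0 (le_trans (hf 0))// expr0n/= mulr0.
have C0 : 0 <= C by have := hf 1; rewrite expr1n mulr1; exact: le_trans.
have cv : h^-1 *: ((f \o shift 0) (h *: 1) - f 0) @[h --> 0^'] --> (0 : R).
  apply/cvgrPdist_le => e e0; near=> h.
  rewrite sub0r normrN f0 subr0 /= addr0 /GRing.scale/= mulr1 normrM normfV.
  have h0 : 0 < `|h| by rewrite normr_gt0; near: h; exact: nbhs_dnbhs_neq.
  rewrite ler_pdivrMl// (le_trans (hf h))//.
  rewrite -real_normK ?num_real// expr2 mulrCA ler_pM2l//.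
  rewrite -(@ler_pM2l _ (C + 1)^-1) ?invr_gt0 ?ltr_wpDl//.
  apply: (@le_trans _ _ `|h|).
    rewrite mulrA ler_piMl// ler_pdivrMl ?mulr1 ?ltr_wpDl//; lra.
  near: h; apply: dnbhs0_le; rewrite mulr_gt0// invr_gt0 ltr_wpDl//.
split; first exact: (cvgP _ cv).
by apply: cvg_lim => //; exact: cv.
Unshelve. all: by end_near. Qed.

Lemma flat_pow_is_derive k (x : R) :
  is_derive x 1 (flat_pow k) (- k%:R * flat_pow k.+1 x + flat_pow k.+2 x).
Proof.
have [x0|x0|<-] := ltgtP 0 x.
- pose h y : R := y^-1 ^+ k * expR (- y^-1).
  apply: (@near_eq_is_derive _ _ _ h).
    near=> y; rewrite /flat_pow ifT//; near: y; exact: lt_nbhsr.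
  have dinv : is_derive x 1 (fun y : R => y^-1) (- x ^- 2 *: 1).
    by apply: (@is_deriveV _ id) => //; rewrite gt_eqF.
  have dX : is_derive (x^-1) 1 (fun y : R => y ^+ k) (k%:R * x^-1 ^+ k.-1 *: 1).
    by split; [exact: exprn_derivable|rewrite exp_derive].
  have dE : is_derive (x^-1) 1 (fun y : R => expR (- y)) (expR (- x^-1) * -1).
    have dN : is_derive (x^-1) 1 (fun y : R => - y) (-1).
      exact: (is_deriveN (is_derive_id _ _)).
    exact: (is_derive1_comp (is_derive_expR _) dN).
  have dXE := @is_deriveM _ _ _ _ _ _ _ _ dX dE.
  have dh : is_derive x 1 h _ := @is_derive1_comp _ _ (fun y : R => y^-1) x _ _ dXE dinv.
  apply: (is_derive_eq dh).
  rewrite /flat_pow x0 /GRing.scale/= !mulr1.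
  clear dh dXE dX h; case: k => [|k]; rewrite ?expr0 /= ?exprVn ?exprS; field.
    by rewrite gt_eqF.
  by rewrite expf_neq0 ?gt_eqF.
- apply: (@near_eq_is_derive _ _ _ (cst 0)).
    near=> y; rewrite /flat_pow ifF//; apply/negbTE; rewrite -leNgt ltW//.
    near: y; exact: lt_nbhsl.
  by rewrite /flat_pow !ifF ?mulr0 ?addr0; [exact: is_derive_cst|apply/negbTE; rewrite -leNgt ltW..].
- rewrite /flat_pow ltxx mulr0 addr0.
  exact: is_derive_flat0 (flat_pow_bound k).
Unshelve. all: by end_near. Qed.

Lemma smooth_flat_pow k : smooth (flat_pow k).
Proof.
move=> j; elim: j k => [//|j ih] k /=; split.
  by move=> x; have := flat_pow_is_derive k x => ?; exact: ex_derive.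
have -> : derive1 (flat_pow k) = (cst (- k%:R)) * flat_pow k.+1 + flat_pow k.+2.
  by apply: funext => x; rewrite derive1E (@derive_val _ _ _ _ _ _ _ (flat_pow_is_derive k x)).
by apply: derivable_uptoD; [exact: derivable_uptoZ|exact: ih].
Qed.

Definition flat (x : R) : R := flat_pow 0 x.

Lemma smooth_flat : smooth flat. Proof. exact: smooth_flat_pow. Qed.

Lemma flat_le0 x : x <= 0 -> flat x = 0.
Proof. by rewrite /flat /flat_pow ltNge => ->. Qed.

Lemma flat_gt0E x : 0 < x -> flat x = expR (- x^-1).
Proof. by rewrite /flat /flat_pow expr0 mul1r => ->. Qed.

Lemma flat_ge0 x : 0 <= flat x.
Proof. by rewrite /flat /flat_pow expr0 mul1r; case: ifP => // _; exact: expR_ge0. Qed.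

Lemma flat_le1 x : flat x <= 1.
Proof.
have [x0|x0] := leP x 0; first by rewrite flat_le0.
by rewrite flat_gt0E// -expR0 ler_expR oppr_le0 invr_ge0 ltW.
Qed.

Lemma flat_cvg1 x : 0 < x -> flat (k.+1%:R * x) @[k --> \oo] --> (1 : R).
Proof.
move=> x0.
have cv : expR (- x^-1 * k.+1%:R^-1) @[k --> \oo] --> expR (- x^-1 * 0).
  apply: continuous_cvg; first exact: continuous_expR.
  by apply: cvgMr; exact: cvg_harmonic.
rewrite mulr0 expR0 in cv; apply: cvg_trans cv; apply: near_eq_cvg.
by near=> k; rewrite flat_gt0E ?mulr_gt0// invfM mulNr mulrC.
Unshelve. all: by end_near. Qed.

End smooth_cutoff.

(** * Trapezoidal test functions *)

Section primitive.
Context {R : realType}.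
Local Notation mu := (@lebesgue_measure R).
Implicit Types (f : R -> R).

Lemma continuous_itv_integrable f (x y : R) : continuous f ->
  mu.-integrable `[x, y] (EFin \o f).
Proof.
move=> cf; apply: continuous_compact_integrable; first exact: segment_compact.
exact: continuous_subspaceT.
Qed.

(** For f vanishing up to c, the lower limit [c - 1] lies strictly to the left of where f may start,
    so the fundamental theorem is only used at interior points. *)
Definition primitive (c : R) f (x : R) : R := \int[mu]_(t in `[c - 1, x]) f t.

Lemma primitive_le0 c f x : (forall y, y <= c -> f y = 0) -> x <= c ->
  primitive c f x = 0.
Proof.
move=> f0 xc; rewrite /primitive.
have -> : \int[mu]_(t in `[c - 1, x]) f t = \int[mu]_(t in `[c - 1, x]) (cst 0 t).
  apply: eq_Rintegral.
  by move=> y; rewrite inE/= in_itv/= => /andP[_ yx]; rewrite f0// (le_trans yx).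
by rewrite /Rintegral integral0.
Qed.

Lemma primitive_is_derive c f (x : R) : continuous f ->
  (forall y, y <= c -> f y = 0) -> is_derive x 1 (primitive c f) (f x).
Proof.
move=> cf f0; have [cx|xc] := ltP (c - 1) x.
  have xx : x < x + 1 by rewrite ltrDl.
  have [dF F'] := continuous_FTC1_closed xx (continuous_itv_integrable (c - 1) (x + 1) cf) cx (cf x).
  by apply: DeriveDef; [exact: dF|rewrite -derive1E; exact: F'].
have {}xc : x < c by lra.
have -> : f x = 0 by apply: f0; exact: ltW.
apply: (near_eq_is_derive _ (is_derive_cst 0 x 1)).
near=> y; rewrite primitive_le0// ltW//; near: y; exact: lt_nbhsl.
Unshelve. all: by end_near. Qed.

Lemma smooth_primitive c f : smooth f -> (forall y, y <= c -> f y = 0) ->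
  smooth (primitive c f).
Proof.
move=> sf f0; apply: (smooth_is_derive _ sf) => x.
by apply: primitive_is_derive => //; exact: smooth_continuous.
Qed.

End primitive.

Section trapezoid.
Context {R : realType}.
Local Notation mu := (@lebesgue_measure R).
Variable h : R.
Hypothesis h0 : 0 < h.

(** A smooth approximation of the indicator of ]0, h[ which vanishes outside this interval for every
    k. The test functions built from it therefore share one compact support. *)
Definition plateau (k : nat) (y : R) : R :=
  flat (k.+1%:R * y) * flat (k.+1%:R * (h - y)).

Lemma smooth_plateau k : smooth (plateau k).
Proof.
apply: (@smoothM _ (fun y => flat (k.+1%:R * y)) (fun y => flat (k.+1%:R * (h - y)))).
  have := @smooth_affine _ _ k.+1%:R 0 (@smooth_flat R).
  by congr smooth; apply: funext => y; rewrite addr0.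
have := @smooth_affine _ _ (- k.+1%:R) (k.+1%:R * h) (@smooth_flat R).
by congr smooth; apply: funext => y; congr flat; ring.
Qed.

Lemma plateau_ge0 k y : 0 <= plateau k y.
Proof. by rewrite mulr_ge0 ?flat_ge0. Qed.

Lemma plateau_le1 k y : plateau k y <= 1.
Proof. by rewrite -[leRHS]mulr1 ler_pM ?flat_ge0 ?flat_le1. Qed.

Lemma plateau_out k y : ~~ (0 < y < h) -> plateau k y = 0.
Proof.
rewrite negb_and -!leNgt /plateau => /orP[y0|yh].
  by rewrite flat_le0 ?mul0r// mulr_ge0_le0.
by rewrite [X in _ * X]flat_le0 ?mulr0// mulr_ge0_le0// subr_le0.
Qed.

Lemma plateau_cvg y : plateau k y @[k --> \oo] --> (\1_(`]0, h[%classic : set R) y : R).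
Proof.
rewrite indicE; case: (boolP (0 < y < h)) => yh.
  have -> : y \in `]0, h[%classic by rewrite inE/= in_itv/=.
  have /andP[y0 hy] := yh.
  rewrite -[X in _ --> X](mulr1 1); apply: cvgM; apply: flat_cvg1 => //.
  by rewrite subr_gt0.
have -> : y \in `]0, h[%classic = false.
  by apply/negbTE; apply: contra yh; rewrite inE/= in_itv/=.
rewrite (_ : (fun _ => _) = cst 0); first exact: cvg_cst.
by apply: funext => k; rewrite plateau_out.
Qed.

Lemma plateau_continuous k : continuous (plateau k).
Proof. exact/smooth_continuous/smooth_plateau. Qed.

Definition smooth_ramp (k : nat) : R -> R := primitive 0 (plateau k).

Definition ramp (x : R) : R := Num.max 0 (Num.min x h).

Lemma plateau_le0 k y : y <= 0 -> plateau k y = 0.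
Proof. by move=> y0; rewrite plateau_out// ltNge y0. Qed.

Lemma smooth_smooth_ramp k : smooth (smooth_ramp k).
Proof. by apply: smooth_primitive; [exact: smooth_plateau|exact: plateau_le0]. Qed.

Lemma smooth_ramp_is_derive k (x : R) : is_derive x 1 (smooth_ramp k) (plateau k x).
Proof. by apply: primitive_is_derive; [exact: plateau_continuous|exact: plateau_le0]. Qed.

Lemma smooth_ramp_nondecreasing k : {homo smooth_ramp k : x y / x <= y}.
Proof.
move=> x y xy.
have [->|xy'] := eqVneq x y; first exact: lexx.
have {xy'}xy : x < y by rewrite lt_neqAle xy'.
have cr : {within `[x, y], continuous smooth_ramp k}.
  by apply: continuous_subspaceT; exact/smooth_continuous/smooth_smooth_ramp.
have [z _ e] := MVT xy (fun z _ => smooth_ramp_is_derive k z) cr.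
by rewrite -subr_ge0 e mulr_ge0 ?plateau_ge0// subr_ge0 ltW.
Qed.

Lemma smooth_ramp_le0 k x : x <= 0 -> smooth_ramp k x = 0.
Proof. by move=> x0; rewrite /smooth_ramp primitive_le0//; exact: plateau_le0. Qed.

Lemma smooth_ramp_ge0 k x : 0 <= smooth_ramp k x.
Proof.
have [x0|/ltW x0] := leP x 0; first by rewrite smooth_ramp_le0.
by rewrite -(smooth_ramp_le0 k (lexx 0)) smooth_ramp_nondecreasing.
Qed.

Lemma smooth_ramp_geh k x : h <= x -> smooth_ramp k x = smooth_ramp k h.
Proof.
rewrite le_eqVlt => /predU1P[->//|hx].
have cr : {within `[h, x], continuous smooth_ramp k}.
  by apply: continuous_subspaceT; exact/smooth_continuous/smooth_smooth_ramp.
have [z zhx e] := MVT hx (fun z _ => smooth_ramp_is_derive k z) cr.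
apply/eqP; rewrite -subr_eq0 e plateau_out ?mul0r// negb_and -!leNgt.
by move: zhx; rewrite in_itv/= => /andP[/ltW -> _]; rewrite orbT.
Qed.

Lemma smooth_ramp_leh k x : smooth_ramp k x <= h.
Proof.
have key y : 0 <= y -> smooth_ramp k y <= y.
  rewrite le_eqVlt => /predU1P[<-|y0]; first by rewrite smooth_ramp_le0.
  have cr : {within `[0, y], continuous smooth_ramp k}.
    by apply: continuous_subspaceT; exact/smooth_continuous/smooth_smooth_ramp.
  have [z _ e] := MVT y0 (fun z _ => smooth_ramp_is_derive k z) cr.
  rewrite -[smooth_ramp k y]subr0 -(smooth_ramp_le0 k (lexx 0)) e subr0.
  by rewrite ler_piMl ?plateau_le1// ltW.
have [hx|xh] := leP h x; first by rewrite smooth_ramp_geh// key// ltW.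
by rewrite (le_trans (smooth_ramp_nondecreasing k (ltW xh)))// key// ltW.
Qed.

Lemma ramp_ge0 x : 0 <= ramp x.
Proof. by rewrite /ramp le_max lexx. Qed.

Lemma ramp_leh x : ramp x <= h.
Proof. by rewrite /ramp ge_max ltW//= ge_min lexx orbT. Qed.

Lemma ramp_le0 x : x <= 0 -> ramp x = 0.
Proof. by move=> x0; rewrite /ramp; apply/max_idPl; rewrite ge_min x0. Qed.

Lemma ramp_geh x : h <= x -> ramp x = h.
Proof. by move=> hx; rewrite /ramp (min_idPr hx); apply/max_idPr; exact: ltW. Qed.

Lemma ramp_nondecreasing : {homo ramp : x y / x <= y}.
Proof.
move=> x y xy; rewrite /ramp ge_max le_max lexx/= le_max.
by apply/orP; right; rewrite le_min ge_min xy ge_min lexx orbT.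
Qed.

Lemma ramp_integral x : \int[mu]_(t in `[0 - 1, x]) \1_(`]0, h[%classic : set R) t = ramp x.
Proof.
have -> : \int[mu]_(t in `[0 - 1, x]) \1_(`]0, h[%classic : set R) t =
    fine (mu (`]0, h[%classic `&` `[0 - 1, x]%classic)).
  by rewrite /Rintegral integral_indic.
have h0' := h0; have [x0|x0] := leP x 0.
  rewrite ramp_le0// (_ : _ `&` _ = set0) ?measure0//.
  apply/seteqP; split => // y [] /=; rewrite !in_itv/=; lra.
have [hx|xh] := leP h x.
  rewrite ramp_geh// (_ : _ `&` _ = `]0, h[%classic); last first.
    by apply/seteqP; split => y /=; rewrite !in_itv/=; lra.
  by rewrite lebesgue_measure_itv/= lte_fin h0 /= oppr0 addr0.
rewrite (_ : _ `&` _ = `]0, x]%classic); last first.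
  by apply/seteqP; split => y /=; rewrite !in_itv/=; lra.
rewrite lebesgue_measure_itv/= lte_fin x0 /= oppr0 addr0.
by rewrite /ramp (min_idPl (ltW xh)); apply/esym/max_idPr/ltW.
Qed.

Lemma smooth_ramp_cvg x : smooth_ramp k x @[k --> \oo] --> ramp x.
Proof.
rewrite -ramp_integral.
have [] := @Rdominated_cvg _ _ _ mu `[0 - 1, x]%classic plateau (\1_(`]0, h[%classic : set R)) (cst 1).
- exact: measurable_itv.
- by move=> k; apply: measurable_funTS; apply: continuous_measurable_fun; exact: plateau_continuous.
- by move=> y _; exact: plateau_cvg.
- by move=> k y _; rewrite ger0_norm ?plateau_ge0 ?plateau_le1.
- by apply: continuous_itv_integrable => ?; exact: cvg_cst.
by [].
Qed.

Variables c d : R.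
Hypothesis cd : c <= d.

(** Approximates a trapezoid rising over [c, c + h] and falling over [d, d + h], which is a hat
    function when d = c + h. Tested against it, a distributional derivative becomes a difference of
    two means over intervals of length h. *)
Definition smooth_trap (k : nat) (x : R) : R :=
  h^-1 * (smooth_ramp k (x - c) - smooth_ramp k (x - d)).

Definition trap (x : R) : R := h^-1 * (ramp (x - c) - ramp (x - d)).

Lemma smooth_smooth_trap k : smooth (smooth_trap k).
Proof.
apply: smoothZ; apply: smoothB.
  have := @smooth_affine _ _ 1 (- c) (smooth_smooth_ramp k).
  by congr smooth; apply: funext => y; rewrite mul1r.
have := @smooth_affine _ _ 1 (- d) (smooth_smooth_ramp k).
by congr smooth; apply: funext => y; rewrite mul1r.
Qed.

Lemma smooth_trap_out k x : ~ (c <= x <= d + h) -> smooth_trap k x = 0.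
Proof.
move=> /negP; rewrite negb_and -!ltNge /smooth_trap => /orP[xc|dx].
  have xc' : x - c <= 0 by rewrite subr_le0 ltW.
  have xd : x - d <= 0 by rewrite subr_le0 (le_trans (ltW xc)).
  by rewrite !smooth_ramp_le0// subrr mulr0.
have xd : h <= x - d by rewrite lerBrDl ltW.
have xc' : h <= x - c by rewrite (le_trans xd)// lerB.
by rewrite (smooth_ramp_geh k xc') (smooth_ramp_geh k xd) subrr mulr0.
Qed.

Lemma smooth_trap_test (J : set R) k : `[c, d + h]%classic `<=` J ->
  test_fun J (smooth_trap k).
Proof.
move=> KJ; apply: test_fun_smooth (smooth_smooth_trap k) (@segment_compact _ c (d + h)) KJ _.
by move=> x; rewrite /= in_itv/= => xK; exact: smooth_trap_out.
Qed.

Lemma smooth_trap_bound k x : 0 <= smooth_trap k x <= 1.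
Proof.
have e : smooth_ramp k (x - d) <= smooth_ramp k (x - c).
  by apply: smooth_ramp_nondecreasing; rewrite lerB.
rewrite /smooth_trap mulr_ge0 ?invr_ge0 ?(ltW h0) ?subr_ge0//=.
rewrite ler_pdivrMl// mulr1.
by have := smooth_ramp_leh k (x - c); have := smooth_ramp_ge0 k (x - d); lra.
Qed.

Lemma trap_bound x : 0 <= trap x <= 1.
Proof.
have e : ramp (x - d) <= ramp (x - c) by apply: ramp_nondecreasing; rewrite lerB.
rewrite /trap mulr_ge0 ?invr_ge0 ?(ltW h0) ?subr_ge0//=.
rewrite ler_pdivrMl// mulr1.
by have := ramp_leh (x - c); have := ramp_ge0 (x - d); lra.
Qed.

Lemma trap_out x : ~ (c <= x <= d + h) -> trap x = 0.
Proof.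
move=> /negP; rewrite negb_and -!ltNge /trap => /orP[xc|dx].
  have xc' : x - c <= 0 by rewrite subr_le0 ltW.
  have xd : x - d <= 0 by rewrite subr_le0 (le_trans (ltW xc)).
  by rewrite !ramp_le0// subrr mulr0.
have xd : h <= x - d by rewrite lerBrDl ltW.
have xc' : h <= x - c by rewrite (le_trans xd)// lerB.
by rewrite !ramp_geh// subrr mulr0.
Qed.

Lemma smooth_trap_cvg x : smooth_trap k x @[k --> \oo] --> trap x.
Proof. by apply: cvgMr; apply: cvgB; exact: smooth_ramp_cvg. Qed.

Lemma smooth_trap_derive1 k x :
  derive1 (smooth_trap k) x = h^-1 * (plateau k (x - c) - plateau k (x - d)).
Proof.
have dr e : is_derive x 1 (fun y => smooth_ramp k (y - e)) (plateau k (x - e)).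
  have de : is_derive x 1 (fun y : R => y - e) 1.
    by have := @is_deriveB _ _ _ id (cst e) x 1 1 0 (is_derive_id x 1) (is_derive_cst e x 1);
      move/is_derive_eq; apply; rewrite subr0.
  have := @is_derive1_comp _ (smooth_ramp k) (fun y : R => y - e) x _ _ (smooth_ramp_is_derive k (x - e)) de.
  by move/is_derive_eq; apply; rewrite mulr1.
have := is_deriveZ h^-1 (is_deriveB (dr c) (dr d)).
by rewrite derive1E => dh; rewrite (@derive_val _ _ _ _ _ _ _ dh).
Qed.

Lemma smooth_trap_derive1_out k x : ~ (c <= x <= d + h) ->
  derive1 (smooth_trap k) x = 0.
Proof.
have cd' := cd; move=> /negP nx; rewrite smooth_trap_derive1 !plateau_out ?subrr ?mulr0//.
  by apply: contra nx => /andP[*]; apply/andP; split; lra.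
by apply: contra nx => /andP[*]; apply/andP; split; lra.
Qed.

Lemma smooth_trap_derive1_cvg (J : set R) (al : R -> R) :
  `[c, d + h]%classic `<=` J -> mu.-integrable `[c, d + h] (EFin \o al) ->
  \int[mu]_(x in J) (al x * derive1 (smooth_trap k) x) @[k --> \oo] -->
  h^-1 * (\int[mu]_(x in `]c, c + h[) al x - \int[mu]_(x in `]d, d + h[) al x).
Proof.
move=> KJ ial; set K := `[c, d + h]%classic.
have mK : measurable (K : set (measurableTypeR R)) by exact: measurable_itv.
have -> : (fun k => \int[mu]_(x in J) (al x * derive1 (smooth_trap k) x)) =
    (fun k => \int[mu]_(x in K) (al x * derive1 (smooth_trap k) x)).
  apply: funext => k; rewrite Rintegral_mkcond [RHS]Rintegral_mkcond.
  apply: eq_Rintegral => x _; rewrite !patchE.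
  case: (boolP (x \in K)) => xK; first by rewrite mem_set//; apply: KJ; rewrite inE in xK.
  case: ifP => // _; rewrite smooth_trap_derive1_out ?mulr0// => cx.
  by move/negP: xK; apply; rewrite inE /K/= in_itv/=.
pose lim x := al x * (h^-1 * (\1_(`]0, h[%classic : set R) (x - c) - \1_(`]0, h[%classic : set R) (x - d))).
have [] := @Rdominated_cvg _ _ _ mu K (fun k x => al x * derive1 (smooth_trap k) x) lim (fun x => h^-1 * `|al x|).
- exact: mK.
- move=> k; apply: measurable_funM; first exact: integrable_Rmeasurable ial.
  apply: measurable_funTS; apply: continuous_measurable_fun.
  by apply: smooth_continuous; exact/smooth_derive1/smooth_smooth_trap.
- move=> x _; under eq_fun do rewrite smooth_trap_derive1.
  by apply: cvgMr; apply: cvgMr; apply: cvgB; exact: plateau_cvg.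
- move=> k x _; rewrite smooth_trap_derive1 !normrM mulrC -mulrA (mulrC _ `|al x|) mulrA.
  rewrite gtr0_norm ?invr_gt0//.
  have := plateau_ge0 k (x - c); have := plateau_le1 k (x - c).
  have := plateau_ge0 k (x - d); have := plateau_le1 k (x - d) => *.
  by rewrite -[leRHS]mulr1 ler_wpM2l ?mulr_ge0 ?invr_ge0 ?(ltW h0)// ler_norml; lra.
- apply: integrable_RZ => //.
  by have := integrable_abse ial; apply: eq_integrable.
move=> _; suff -> : \int[mu]_(x in K) lim x =
   h^-1 * (\int[mu]_(x in `]c, c + h[) al x - \int[mu]_(x in `]d, d + h[) al x) by [].
have cd' := cd; have h0' := h0; have sub e : c <= e <= d -> `]e, e + h[%classic `<=` K.
  by move=> ced x; rewrite /K /= !in_itv/=; lra.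
have indE e (x : R) : (\1_(`]0, h[%classic : set R) (x - e) : R) = \1_(`]e, e + h[%classic : set R) x.
  by rewrite !indicE; congr (_%:R); congr nat_of_bool; apply/idP/idP; rewrite !inE/= !in_itv/=; lra.
have intE e : c <= e <= d -> \int[mu]_(x in K) (al x * \1_(`]e, e + h[%classic : set R) x) =
    \int[mu]_(x in `]e, e + h[) al x.
  move=> ced; rewrite Rintegral_mkcond [RHS]Rintegral_mkcond.
  apply: eq_Rintegral => x _; rewrite !patchE indicE.
  case: (boolP (x \in `]e, e + h[%classic)) => xe; last by case: ifP; rewrite ?mulr0.
  by rewrite mulr1 mem_set//; apply: (sub e ced); rewrite inE in xe.
have iind e : c <= e <= d -> mu.-integrable K (EFin \o (fun x => al x * \1_(`]e, e + h[%classic : set R) x)).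
  move=> ced; apply: (integrable_Rle mK _ _ (integrable_abse ial)).
    by apply: measurable_funM; [exact: integrable_Rmeasurable ial|exact: measurable_indic].
  move=> x _; rewrite normrM ler_piMr// indicE; case: (_ \in _); rewrite ?normr1 ?normr0//.
rewrite -!intE ?lexx ?cd// -RintegralB//; try (by apply: iind; rewrite lexx cd).
rewrite -RintegralZl//.
  by apply: eq_Rintegral => x _; rewrite /lim !indE; ring.
by apply: integrable_RB => //; apply: iind; rewrite lexx cd.
Qed.

End trapezoid.

(** * Cellwise constant functions *)

Section interval_integrals.
Context {R : realType}.
Local Notation mu := (@lebesgue_measure R).

Lemma Rintegral_itv_oo (x y : R) (b0 b1 : bool) (f : R -> R) :
  measurable_fun `]x, y[ f ->
  \int[mu]_(z in [set` Interval (BSide b0 x) (BSide b1 y)]) f z =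
  \int[mu]_(z in `]x, y[) f z.
Proof.
by move=> mf; rewrite /Rintegral integral_itv_bndoo//; exact/measurable_EFinP.
Qed.

Lemma integrable_itv_cst (x y : R) (b0 b1 : bool) (k : R) :
  mu.-integrable [set` Interval (BSide b0 x) (BSide b1 y)] (EFin \o cst k).
Proof.
apply: (@integrableS _ _ _ mu `[x, y]%classic) => //.
  move=> z /=; move: b0 b1 => [] []; rewrite !in_itv/= => /andP[p q];
    by apply/andP; split => //; exact: ltW.
by apply: continuous_itv_integrable => ?; exact: cvg_cst.
Qed.

Lemma integrable_sub_itv (i j : interval R) (f : R -> R) : [set` i] `<=` [set` j] ->
  mu.-integrable [set` j] (EFin \o f) -> mu.-integrable [set` i] (EFin \o f).
Proof. by move=> ij fi; apply: (@integrableS _ _ _ mu [set` j] [set` i]) => //; exact: measurable_itv. Qed.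

Lemma Rintegral_indicM (D A : set R) (f : R -> R) : A `<=` D ->
  \int[mu]_(x in D) (\1_A x * f x) = \int[mu]_(x in A) f x.
Proof.
move=> AD; rewrite Rintegral_mkcond [RHS]Rintegral_mkcond.
apply: eq_Rintegral => x _; rewrite !patchE indicE.
case: (boolP (x \in A)) => xA; last by case: ifP; rewrite ?mul0r.
by rewrite mul1r mem_set//; apply: AD; rewrite inE in xA.
Qed.

End interval_integrals.

Section step_functions.
Context {R : realType} {n : nat}.
Variables (a b : R) (N : nat).
Hypotheses (ab : a < b) (N0 : (0 < N)%N).
Local Notation mu := (@lebesgue_measure R).
Local Notation I := (`]a, b[%classic : set R).
Implicit Types (P : nat -> 'rV[R]_n) (w : R -> 'rV[R]_n).

Definition mesh : R := (b - a) / N%:R.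

Definition node (i : nat) : R := a + i%:R * mesh.

(** Half-open cells are pairwise disjoint and cover I. The last one also contains b, which lies
    outside I. *)
Definition cell (i : nat) : set R := `]node i, node i.+1]%classic.

Definition step P (x : R) : 'rV[R]_n := \sum_(0 <= i < N) \1_(cell i) x *: P i.

Definition cell_mean w (i : nat) : 'rV[R]_n :=
  \row_c (mesh^-1 * \int[mu]_(x in `]node i, node i.+1[) w x 0 c).

Lemma mesh_gt0 : 0 < mesh.
Proof. by rewrite divr_gt0 ?subr_gt0// ltr0n. Qed.

Lemma node0 : node 0 = a.
Proof. by rewrite /node mul0r addr0. Qed.

Lemma nodeN : node N = b.
Proof. by rewrite /node /mesh mulrC divfK ?pnatr_eq0 -?lt0n// subrKC. Qed.

Lemma nodeS i : node i.+1 = node i + mesh.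
Proof. by rewrite /node -addrA -{3}(mul1r mesh) -mulrDl natr1. Qed.

Lemma node_le i j : (i <= j)%N -> node i <= node j.
Proof. by move=> ij; rewrite lerD2l ler_pM2r ?mesh_gt0// ler_nat. Qed.

Lemma node_lt i j : (i < j)%N -> node i < node j.
Proof. by move=> ij; rewrite ltrD2l ltr_pM2r ?mesh_gt0// ltr_nat. Qed.

Lemma node_in i : (i <= N)%N -> a <= node i <= b.
Proof. by move=> iN; rewrite -{1}node0 -nodeN !node_le. Qed.

Lemma mem_cell i x : cell i x <-> node i < x <= node i.+1.
Proof. by rewrite /cell /= in_itv. Qed.

Lemma cell_uniq i j x : cell i x -> cell j x -> i = j.
Proof.
move=> /mem_cell/andP[ix xi] /mem_cell/andP[jx xj].
case: (ltngtP i j) => // ij.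
  by have := lt_le_trans jx (le_trans xi (node_le ij)); rewrite ltxx.
by have := lt_le_trans ix (le_trans xj (node_le ij)); rewrite ltxx.
Qed.

Lemma step_in P i x : (i < N)%N -> cell i x -> step P x = P i.
Proof.
move=> iN ix; rewrite /step big_mkord (bigD1 (Ordinal iN))//= big1 ?addr0.
  by rewrite indicE mem_set// scale1r.
move=> j ji; rewrite indicE memNset ?scale0r// => jx.
by move/eqP: ji; apply; apply: val_inj; exact: cell_uniq jx ix.
Qed.

Lemma cell_sub i : (i < N)%N -> cell i `<=` `[a, b]%classic.
Proof.
move=> iN x /mem_cell/andP[ix xi]; rewrite /= in_itv/=.
have /andP[ai _] := node_in (ltnW iN); have /andP[_ ib] := node_in iN.
by rewrite (le_trans ai (ltW ix)) (le_trans xi ib).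
Qed.

Lemma open_cell_sub i : (i < N)%N -> `]node i, node i.+1[%classic `<=` I.
Proof.
move=> iN; apply: subset_itvW.
  by have /andP[] := node_in (ltnW iN).
by have /andP[] := node_in iN.
Qed.

Lemma measurable_I : measurable (I : set (measurableTypeR R)).
Proof. exact: measurable_itv. Qed.
Local Hint Resolve measurable_I : core.

Lemma L2_coord_integrable w c : is_L2 I w -> mu.-integrable I (EFin \o (fun x => w x 0 c)).
Proof.
move=> /(is_L2P measurable_I)[mw iw].
apply: (integrable_Rle measurable_I (mw c) _ (integrable_RD measurable_I (integrable_itv_cst a b false true 1) iw)) => x _.
have := coord_le_enorm (w x) c; rewrite -enorm_sqr => h.
rewrite (le_trans h)//=.
have := sqr_ge0 (enorm (w x) - 1); have := sqr_ge0 (enorm (w x)).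
by rewrite !expr2; nra.
Qed.

Lemma step_L2 P : is_L2 I (step P).
Proof.
have hc j : is_L2 I (fun x => \1_(cell j) x *: P j).
  apply/(is_L2P measurable_I); split.
    move=> c; apply: (eq_measurable_fun (fun x => \1_(cell j) x * P j 0 c)).
      by move=> x _; rewrite mxE.
    by apply: measurable_funM => //; apply: measurable_indic; exact: measurable_itv.
  apply: (integrable_Rle _ _ _ (integrable_itv_cst a b false true (dotp (P j) (P j)))) => //.
    apply: (eq_measurable_fun (fun x => (\1_(cell j) x * \1_(cell j) x) * dotp (P j) (P j))).
      by move=> x _; rewrite dotpZl dotpZr mulrA.
    by do 2 (apply: measurable_funM => //); apply: measurable_indic; exact: measurable_itv.
  move=> x _; rewrite dotpZl dotpZr indicE /=.
  by case: (_ \in _); rewrite ?mul0r ?mul1r ?normr0 ?dotp_ge0// ger0_norm ?dotp_ge0.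
have := @is_L2_sum _ _ _ measurable_I _ (index_iota 0 N) (fun=> 1) _ hc.
by congr is_L2; apply: funext => x; apply: eq_bigr => i _; rewrite scale1r.
Qed.

Lemma L2dot_step P w : is_L2 I w ->
  L2dot I (step P) w = mesh * \sum_(0 <= i < N) dotp (P i) (cell_mean w i).
Proof.
move=> hw; have /(is_L2P measurable_I)[mw _] := hw.
have iw c := L2_coord_integrable c hw.
have iPw i : mu.-integrable I (EFin \o (fun x => dotp (P i) (w x))).
  by apply: integrable_Rsum => // c; exact: integrable_RZ.
have iPwi i : mu.-integrable I (EFin \o (fun x => \1_(cell i) x * dotp (P i) (w x))).
  apply: (integrable_Rle _ _ _ (integrable_abse (iPw i))) => //.
    apply: measurable_funM; last exact: integrable_Rmeasurable (iPw i).
    by apply: measurable_indic; exact: measurable_itv.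
  by move=> x _; rewrite normrM ler_piMl// indicE; case: (_ \in _); rewrite ?normr1 ?normr0.
rewrite /L2dot.
transitivity (\int[mu]_(x in I) \sum_(0 <= i < N) (\1_(cell i) x * dotp (P i) (w x))).
  by apply: eq_Rintegral => x _; rewrite dotp_suml; apply: eq_bigr => i _; rewrite dotpZl.
rewrite Rintegral_sum// mulr_sumr big_nat [RHS]big_nat; apply: eq_bigr => i /= iN.
have mPw : measurable_fun `]node i, node i.+1[ (fun x => dotp (P i) (w x)).
  apply: measurable_funS (integrable_Rmeasurable (iPw i)) => //.
  exact: open_cell_sub.
have -> : \int[mu]_(x in I) (\1_(cell i) x * dotp (P i) (w x)) =
    \int[mu]_(x in `]node i, node i.+1[) dotp (P i) (w x).
  rewrite -(Rintegral_itv_oo true false (integrable_Rmeasurable (iPwi i))).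
  rewrite Rintegral_indicM; last exact: cell_sub.
  by rewrite /cell Rintegral_itv_oo.
rewrite Rintegral_sum//; last first.
  move=> c; apply: integrable_RZ => //.
  by apply: integrableS (iw c) => //; exact: open_cell_sub.
rewrite mulr_sumr; apply: eq_bigr => c _; rewrite mxE RintegralZl//.
  by field; rewrite gt_eqF// mesh_gt0.
by apply: integrableS (iw c) => //; exact: open_cell_sub.
Qed.

Lemma cell_mean_step P i : (i < N)%N -> cell_mean (step P) i = P i.
Proof.
move=> iN; apply/rowP => c; rewrite mxE.
rewrite (_ : Rintegral _ _ _ = \int[mu]_(x in `]node i, node i.+1[) P i 0 c).
  rewrite Rintegral_cst//.
  rewrite /= lebesgue_measure_itv/= lte_fin node_lt//= nodeS addrAC subrr add0r.
  by rewrite mulrCA mulVf ?mulr1// gt_eqF// mesh_gt0.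
apply: eq_Rintegral => x; rewrite inE/= in_itv/= => /andP[ix xi].
by rewrite (step_in _ iN)//; apply/mem_cell; rewrite ix ltW.
Qed.

Lemma L2dot_steps P P' :
  L2dot I (step P) (step P') = mesh * \sum_(0 <= i < N) dotp (P i) (P' i).
Proof.
rewrite L2dot_step; last exact: step_L2.
congr (_ * _); rewrite big_nat [RHS]big_nat; apply: eq_bigr => i /= iN.
by rewrite cell_mean_step.
Qed.

Lemma cell_meanB w z i : is_L2 I w -> is_L2 I z -> (i < N)%N ->
  cell_mean (w - z) i = cell_mean w i - cell_mean z i.
Proof.
move=> hw hz iN; apply/rowP => c; rewrite !mxE -mulrBr; congr (_ * _).
rewrite -RintegralB//; last 2 first.
- by apply: integrableS (L2_coord_integrable c hw) => //; exact: open_cell_sub.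
- by apply: integrableS (L2_coord_integrable c hz) => //; exact: open_cell_sub.
by apply: eq_Rintegral => x _; rewrite !mxE.
Qed.

(** Pythagoras: [step (cell_mean w)] is the orthogonal projection of w onto the cellwise constant
    functions. *)
Lemma L2sq_sub_step w P : is_L2 I w ->
  L2sq I (w - step P) = L2sq I (w - step (cell_mean w)) +
    mesh * \sum_(0 <= i < N) enorm (cell_mean w i - P i) ^+ 2.
Proof.
move=> hw; rewrite !L2sqB//; try exact: step_L2.
rewrite !(L2dotC _ w) !L2dot_step// /L2sq !L2dot_steps.
rewrite (_ : \sum_(0 <= i < N) enorm (cell_mean w i - P i) ^+ 2 =
  \sum_(0 <= i < N) dotp (cell_mean w i) (cell_mean w i)
  - 2 * (\sum_(0 <= i < N) dotp (P i) (cell_mean w i))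
  + \sum_(0 <= i < N) dotp (P i) (P i)); last first.
  rewrite mulr_sumr -sumrB -big_split; apply: eq_bigr => i _ /=.
  by rewrite enorm_sqr dotp_sqrB (dotpC (P i)).
ring.
Qed.

Lemma stepB P P' : step P - step P' = step (fun i => P i - P' i).
Proof.
apply: funext => x; rewrite /step [LHS]/GRing.add/= [X in _ + X]/GRing.opp/= -sumrB.
by apply: eq_bigr => i _; rewrite scalerBr.
Qed.

Lemma L2sq_step P : L2sq I (step P) = mesh * \sum_(0 <= i < N) enorm (P i) ^+ 2.
Proof.
by rewrite /L2sq L2dot_steps; congr (_ * _); apply: eq_bigr => i _; rewrite enorm_sqr.
Qed.

Lemma cell_mean_le w : is_L2 I w ->
  mesh * \sum_(0 <= i < N) enorm (cell_mean w i) ^+ 2 <= L2sq I w.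
Proof.
move=> hw; have := L2sq_sub_step (fun=> 0) hw.
rewrite (_ : step (fun=> 0) = 0); last first.
  by apply: funext => x; rewrite /step big1// => i _; rewrite scaler0.
rewrite subr0 => ->; under [in leRHS]eq_bigr do rewrite subr0.
by rewrite lerDr L2sq_ge0.
Qed.

End step_functions.

Lemma cvg_finsum {R : numFieldType} {V : normedModType R} {T : Type}
    (F : set_system T) {FF : Filter F} (J : Type) (s : seq J) (f : J -> T -> V) (l : J -> V) :
  (forall j, f j x @[x --> F] --> l j) ->
  \sum_(j <- s) f j x @[x --> F] --> \sum_(j <- s) l j.
Proof.
move=> fl; elim: s => [|j s ih].
  rewrite big_nil (_ : (fun _ => _) = cst 0); first exact: cvg_cst.
  by apply: funext => x; rewrite big_nil.
rewrite big_cons (_ : (fun _ => _) = f j \+ (fun x => \sum_(j <- s) f j x)).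
  exact: cvgD.
by apply: funext => x; rewrite big_cons.
Qed.

Lemma is_derive_finsum {R : numFieldType} {V W : normedModType R} (J : Type) (s : seq J)
    (f : J -> V -> W) (f' : J -> W) (x v : V) :
  (forall j, is_derive x v (f j) (f' j)) ->
  is_derive x v (fun y => \sum_(j <- s) f j y) (\sum_(j <- s) f' j).
Proof.
move=> df; elim: s => [|j s ih].
  rewrite big_nil (_ : (fun _ => _) = cst 0); first exact: is_derive_cst.
  by apply: funext => y; rewrite big_nil.
rewrite big_cons (_ : (fun _ => _) = f j + (fun y => \sum_(j <- s) f j y)).
  exact: is_deriveD.
by apply: funext => y; rewrite big_cons.
Qed.

Section C1_curves.
Context {R : realType} {n : nat}.
Local Notation mu := (@lebesgue_measure R).

Lemma integrable_indicM (D A : set R) (f : R -> R) :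
  measurable (D : set (measurableTypeR R)) -> measurable (A : set (measurableTypeR R)) ->
  A `<=` D -> mu.-integrable A (EFin \o f) ->
  mu.-integrable D (EFin \o (fun x => \1_A x * f x)).
Proof.
move=> mD mA AD fi.
have : mu.-integrable D ((EFin \o f) \_ A).
  by apply/integrable_restrict => //; rewrite (setIidr AD).
apply: eq_integrable => // x xD; rewrite /= patchE indicE.
by case: (x \in A) => /=; rewrite ?mul1r ?mul0r.
Qed.

Lemma FTC2_integrable (f : R -> R) (y z : R) :
  (forall x, y <= x <= z -> {for x, continuous f}) ->
  mu.-integrable `[y, z] (EFin \o f).
Proof.
move=> cf; apply: continuous_compact_integrable; first exact: segment_compact.
by apply: continuous_in_subspaceT => x; rewrite inE/= in_itv/=; exact: cf.
Qed.

Lemma Rintegral_FTC2 (F f : R -> R) (y z : R) : y < z ->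
  (forall x : R, y <= x <= z -> is_derive x 1 F (f x)) ->
  (forall x, y <= x <= z -> {for x, continuous f}) ->
  \int[mu]_(x in `[y, z]) f x = F z - F y.
Proof.
move=> yz dF cf; rewrite /Rintegral (@continuous_FTC2 _ f F)//.
- by apply: continuous_in_subspaceT => x; rewrite inE/= in_itv/=; exact: cf.
- have cF x : y <= x <= z -> {for x, continuous F}.
    move=> /dF dFx; apply/differentiable_continuous/derivable1_diffP.
    exact: ex_derive.
  split.
  + move=> x; rewrite in_itv/= => /andP[yx xz].
    have dFx : is_derive x 1 F (f x) by apply: dF; rewrite !ltW.
    exact: ex_derive.
  + by apply: cvg_at_right_filter; apply: cF; rewrite lexx ltW.
  + by apply: cvg_at_left_filter; apply: cF; rewrite lexx ltW.
- move=> x; rewrite in_itv/= => /andP[yx xz].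
  have dFx : is_derive x 1 F (f x) by apply: dF; rewrite !ltW.
  by rewrite derive1E; exact: derive_val.
Qed.

Lemma is_derive_dotp (z : 'rV[R]_n) (u : R -> 'rV[R]_n) (x : R) :
  derivable u x 1 ->
  is_derive x 1 (fun y => dotp z (u y)) (dotp z (derive1 u x)).
Proof.
move=> du; have /derivable_mxP duc := du.
rewrite derive1E derive_mx// /dotp.
have -> : (fun y : R => \sum_(i < n) z 0 i * u y 0 i) =
    \sum_(i < n) (fun y : R => z 0 i * u y 0 i).
  by apply: funext => y; rewrite fct_sumE.
apply: is_derive_sum => i.
have := is_deriveZ (z 0 i) (DeriveDef (duc 0 i) erefl).
by rewrite mxE.
Qed.

Lemma continuous_dotp (z : 'rV[R]_n) (u : R -> 'rV[R]_n) (x : R) :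
  {for x, continuous u} -> {for x, continuous (fun y => dotp z (u y))}.
Proof.
move=> cu; rewrite /prop_for /continuous_at /dotp.
apply: cvg_finsum => i; apply: cvgMr.
apply: (@cvg_comp _ _ _ u (fun M : 'rV[R]_n => M 0 i) _ (nbhs (u x)) _ cu).
exact: coord_continuous.
Qed.

End C1_curves.

Section disjoint_sums.
Context {R : realType}.

Lemma sum_disjoint_indic_le (T : Type) (s : seq nat) (A : nat -> set T) (m : nat -> R) (B : R) x :
  uniq s -> (forall j k, A j x -> A k x -> j = k) -> 0 <= B ->
  (forall k, m k <= B) -> \sum_(k <- s) \1_(A k) x * m k <= B.
Proof.
move=> us dis B0 mB.
have [[k ks kx]|nk] := pselect (exists2 k, k \in s & A k x).
  rewrite (bigD1_seq k)//= big1 ?addr0; last first.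
    move=> j jk; rewrite indicE memNset ?mul0r// => jx.
    by move/eqP: jk; apply; exact: dis jx kx.
  by rewrite indicE mem_set// mul1r.
rewrite big_seq big1// => k ks; rewrite indicE memNset ?mul0r// => kx.
by apply: nk; exists k.
Qed.

End disjoint_sums.

(** * The relaxed functional on cell means *)

Section relaxed_lower_bound.
Context {R : realType} {n : nat}.
Variables (a b : R) (N : nat).
Hypotheses (ab : a < b) (N0 : (0 < N)%N).
Local Notation mu := (@lebesgue_measure R).
Local Notation I := (`]a, b[%classic : set R).
Variables (phi : 'rV[R]_n -> R) (zeta : nat -> 'rV[R]_n).
Hypothesis phi_ge0 : forall p, 0 <= phi p.
Hypothesis zeta_le : forall k q, dotp (zeta k) q <= phi q.

(** The k-th increment is the integral of <zeta_k, u'> over the k-th of disjoint intervals, and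
    <zeta_k, u'> <= phi(u') there. A different zeta_k may be used on each interval. *)
Lemma chain_variation_le (u : R -> 'rV[R]_n) (y : nat -> R) (C : R) :
  is_C1 I u -> (forall k, y k < y k.+1) -> (forall k, (k < N)%N -> I (y k)) ->
  (\int[mu]_(x in I) (phi (derive1 u x))%:E <= C%:E)%E ->
  \sum_(1 <= k < N) dotp (zeta k) (u (y k) - u (y k.-1)) <= C.
Proof.
move=> u1 ymon yI leC.
have mI : measurable (I : set (measurableTypeR R)) by exact: measurable_itv.
have yle i j : (i <= j)%N -> y i <= y j.
  by apply: (@homo_leq _ _ (fun p q => p <= q)) => [//|p q r|k]; [exact: le_trans|exact/ltW/ymon].
pose A k := `]y k.-1, y k]%classic.
have mA k : measurable (A k : set (measurableTypeR R)) by exact: measurable_itv.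
have Auniq j k x : A j x -> A k x -> j = k.
  rewrite /A /= !in_itv/= => /andP[jx xj] /andP[kx xk].
  case: (ltngtP j k) => // jk.
    by have := lt_le_trans kx (le_trans xj (yle j k.-1 _)); rewrite -ltnS (ltn_predK jk) jk ltxx => /(_ isT).
  by have := lt_le_trans jx (le_trans xk (yle k j.-1 _)); rewrite -ltnS (ltn_predK jk) jk ltxx => /(_ isT).
have AI k : (k < N)%N -> `[y k.-1, y k]%classic `<=` I.
  move=> kN x; have := yI _ kN; have := yI k.-1 (leq_ltn_trans (leq_pred k) kN).
  rewrite /= !in_itv/= => /andP[ay _] /andP[_ yb] /andP[yx xy].
  by rewrite (lt_le_trans ay yx) (le_lt_trans xy yb).
have ocS k : A k `<=` `[y k.-1, y k]%classic by exact: subset_itv_oc_cc.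
pose f k x := dotp (zeta k) (derive1 u x).
have cf k x : I x -> {for x, continuous (f k)}.
  by move=> /u1[_ cu]; exact: continuous_dotp.
have if_ k : (k < N)%N -> mu.-integrable `[y k.-1, y k] (EFin \o f k).
  move=> kN; apply: FTC2_integrable => x yx; apply: cf; apply: (AI _ kN).
  by rewrite /= in_itv.
have ifA k : (k < N)%N -> mu.-integrable (A k) (EFin \o f k).
  by move=> kN; apply: integrableS (if_ k kN) => //; exact: ocS.
(* Positive parts make the sum nonnegative on all of I, as the comparison with [phi (derive1 u x)]
   by simple functions requires. *)
pose m k x := Num.max 0 (f k x).
have imA k : (k < N)%N -> mu.-integrable (A k) (EFin \o m k).
  move=> kN; apply: (integrable_Rle (mA k) _ _ (integrable_abse (ifA k kN))).
    apply: measurable_maxr; first exact: measurable_cst.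
    exact: integrable_Rmeasurable (ifA k kN).
  move=> x _; rewrite /m /=; case: (leP 0 (f k x)) => [//|_].
  by rewrite normr0.
have -> : \sum_(1 <= k < N) dotp (zeta k) (u (y k) - u (y k.-1)) =
    \sum_(1 <= k < N) \int[mu]_(x in A k) f k x.
  rewrite big_nat [RHS]big_nat; apply: eq_bigr => k /andP[k1 kN].
  have yk : y k.-1 < y k by rewrite -{2}(prednK k1).
  have <- : \int[mu]_(x in `[y k.-1, y k]) f k x = \int[mu]_(x in A k) f k x.
    rewrite /A !Rintegral_itv_oo//;
    by apply: measurable_funS (integrable_Rmeasurable (if_ k kN)) => //; exact: subset_itv_oo_cc.
  rewrite dotpBr; apply/esym/(@Rintegral_FTC2 _ (fun x => dotp (zeta k) (u x))) => //.
  - move=> x yx; apply: is_derive_dotp; apply: (u1 x _).1; apply: (AI _ kN).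
    by rewrite /= in_itv.
  - by move=> x yx; apply: cf; apply: (AI _ kN); rewrite /= in_itv.
have i1m k : (k < N)%N -> mu.-integrable I (EFin \o (fun x => \1_(A k) x * m k x)).
  move=> kN; apply: integrable_indicM => //; last exact: imA.
  exact: subset_trans (ocS k) (AI k kN).
(* The value 0 from N on gives integrability for every k, the form in which sums and integrals are
   exchanged. *)
pose m' k x := if (k < N)%N then \1_(A k) x * m k x else 0.
have im' k : mu.-integrable I (EFin \o m' k).
  rewrite /m'; case: (k < N)%N (@i1m k) => [ik|_]; first exact: ik.
  exact: integrable0.
have m0 k x : 0 <= m k x by rewrite /m le_max lexx.
have psiE x : \sum_(1 <= k < N) m' k x = \sum_(1 <= k < N) \1_(A k) x * m k x.
  by rewrite big_nat [RHS]big_nat; apply: eq_bigr => k /andP[_ kN]; rewrite /m' kN.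
apply: (@le_trans _ _ (\int[mu]_(x in I) (\sum_(1 <= k < N) m' k x))).
  rewrite Rintegral_sum// big_nat [leRHS]big_nat; apply: ler_sum => k /andP[k1 kN].
  rewrite /m' kN Rintegral_indicM; last exact: subset_trans (ocS k) (AI k kN).
  apply: le_Rintegral => //; [exact: ifA|exact: imA|].
  by move=> x _; rewrite /m le_max lexx orbT.
rewrite -lee_fin -Rintegral_EFin//; last exact: integrable_Rsum.
apply: le_trans leC; apply: ge0_le_integralW.
  move=> x _; rewrite lee_fin psiE; apply: sumr_ge0 => k _.
  by rewrite mulr_ge0// indicE ler0n.
move=> x Ix; rewrite lee_fin psiE.
apply: sum_disjoint_indic_le => //; first exact: iota_uniq.
  by move=> j k; exact: Auniq.
by move=> k; rewrite /m ge_max phi_ge0 zeta_le.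
Qed.

Local Notation h := (mesh a b N).
Local Notation node := (node a b N).

Definition inner_cell (d : R) (i : nat) : set R := `]node i + d, node i.+1 - d]%classic.

(** Averages [chain_variation_le] at the points [node k + s] over the offset s in [d, h - d], which
    turns point values into integrals over cells. The margin d stays away from the ends of I, where
    a C^1 curve need not be integrable and where local L^1 convergence says nothing. *)
Lemma inner_chain_variation_le (u : R -> 'rV[R]_n) (d C : R) :
  is_C1 I u -> 0 < d -> 2 * d < h ->
  (\int[mu]_(x in I) (phi (derive1 u x))%:E <= C%:E)%E ->
  \sum_(1 <= k < N) (\int[mu]_(x in inner_cell d k) dotp (zeta k) (u x)
    - \int[mu]_(x in inner_cell d k.-1) dotp (zeta k) (u x)) <= C * (h - 2 * d).
Proof.
move=> u1 d0 dh leC.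
have h0 : 0 < h by exact: mesh_gt0.
pose g k x := dotp (zeta k) (u x).
have cg k x : I x -> {for x, continuous (g k)}.
  move=> /u1[du _]; apply: continuous_dotp.
  by apply/differentiable_continuous/derivable1_diffP.
have inI i x : (i < N)%N -> node i < x < node i.+1 -> I x.
  move=> iN /andP[ix xi]; apply: (open_cell_sub ab N0 iN).
  by rewrite /= in_itv/= ix.
have iv i s : 0 < s < h -> node i < node i + s < node i.+1.
  by rewrite nodeS ltrDl ltrD2l.
(* The lower limit uses d / 2, below the range of s, so that the derivative in s also exists at s =
   d. *)
pose A k i s := \int[mu]_(x in `[node i + d / 2, node i + s]) g k x.
have d2 : 0 < d / 2 by rewrite divr_gt0.
have ig k i s : (i < N)%N -> s < h -> mu.-integrable `[node i + d / 2, node i + s] (EFin \o g k).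
  move=> iN sh; apply: FTC2_integrable => x /andP[xi xs]; apply: cg.
  apply: (inI i) => //; rewrite (lt_le_trans _ xi) ?ltrDl//=.
  by rewrite (le_lt_trans xs)// nodeS ltrD2l.
have dA k i (s : R) : (i < N)%N -> d / 2 < s -> s < h -> is_derive s 1 (A k i) (g k (node i + s)).
  move=> iN ds sh.
  pose s' := (s + h) / 2.
  have ss' : s < s' by rewrite /s'; lra.
  have s'h : s' < h by rewrite /s'; lra.
  have xu : node i + s < node i + s' by rewrite ltrD2l.
  have ax : node i + d / 2 < node i + s by rewrite ltrD2l.
  have cx : {for (node i + s), continuous (g k)}.
    by apply: cg; apply: (inI i) => //; apply: iv; lra.
  have [dF F'] := continuous_FTC1_closed xu (ig k i s' iN s'h) ax cx.
  have dF' : is_derive (node i + s) 1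
      (fun y => \int[mu]_(x in `[node i + d / 2, y]) g k x) (g k (node i + s)).
    by apply: DeriveDef; [exact: dF|rewrite -derive1E; exact: F'].
  have ds' : is_derive s 1 (fun t : R => node i + t) 1.
    have := is_deriveD (is_derive_cst (node i) s 1) (is_derive_id s 1).
    by move/is_derive_eq; apply; rewrite add0r.
  have := @is_derive1_comp _ _ (fun t : R => node i + t) s _ _ dF' ds'.
  by move/is_derive_eq; apply; rewrite mulr1.
pose B k s := if (k < N)%N then A k k s - A k k.-1 s else 0.
pose B' k s := if (k < N)%N then g k (node k + s) - g k (node k.-1 + s) else 0.
pose G s := \sum_(1 <= k < N) B k s - C * s.
pose G' s := \sum_(1 <= k < N) B' k s - C.
have dG (s : R) : d / 2 < s -> s < h -> is_derive s 1 G (G' s).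
  move=> ds sh.
  have dB k : is_derive s 1 (B k) (B' k s).
    rewrite /B /B'; case: (boolP (k < N)%N) => kN; last exact: is_derive_cst.
    by apply: is_deriveB; apply: dA => //; exact: leq_ltn_trans (leq_pred k) kN.
  have dC : is_derive s 1 (fun t : R => C * t) C.
    have := @is_deriveM _ _ (cst C) id s 1 _ _ (is_derive_cst C s 1) (is_derive_id s 1).
    by move/is_derive_eq; apply; rewrite /GRing.scale/= mulr1 mulr0 addr0.
  exact: (is_deriveB (is_derive_finsum (index_iota 1 N) dB) dC).
have dh' : d < h - d by lra.
have cG : {within `[d, h - d], continuous G}.
  apply: continuous_in_subspaceT => s; rewrite inE/= in_itv/= => /andP[ds sh].
  have dGs : is_derive s 1 G (G' s) by apply: dG; lra.
  by apply/differentiable_continuous/derivable1_diffP; exact: ex_derive.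
have dG' s : s \in `]d, h - d[ -> is_derive s 1 G (G' s).
  by rewrite in_itv/= => /andP[ds sh]; apply: dG; lra.
(* At each offset z the derivative of [G] is a chain sum minus C, hence nonpositive. The mean value
   theorem then plays the part of integrating in s. *)
have [z] := MVT dh' dG' cG.
rewrite in_itv/= => /andP[dz zd] Gz.
have G'z : G' z <= 0.
  rewrite /G' subr_le0.
  apply: le_trans (@chain_variation_le u (fun k => node k + z) C u1 _ _ leC).
  - rewrite big_nat [leRHS]big_nat; apply: ler_sum => k /andP[_ kN].
    by rewrite /B' kN dotpBr.
  - by move=> k; rewrite ltrD2r nodeS ltrDl.
  - by move=> k kN; apply: (inI k) => //; apply: iv; lra.
have inner k i : (i < N)%N -> A k i (h - d) - A k i d = \int[mu]_(x in inner_cell d i) dotp (zeta k) (u x).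
  move=> iN; rewrite /A.
  have e : node i.+1 - d = node i + (h - d) by rewrite nodeS addrA.
  have hd : h - d < h by lra.
  rewrite /inner_cell e -(Rintegral_itvB (ig k i (h - d) iN hd))// bnd_simp lerD2l; lra.
have -> : \sum_(1 <= k < N) (\int[mu]_(x in inner_cell d k) dotp (zeta k) (u x)
    - \int[mu]_(x in inner_cell d k.-1) dotp (zeta k) (u x)) =
    \sum_(1 <= k < N) (B k (h - d) - B k d).
  rewrite big_nat [RHS]big_nat; apply: eq_bigr => k /andP[_ kN].
  rewrite /B kN -!inner//; last exact: leq_ltn_trans (leq_pred k) kN.
  ring.
rewrite sumrB.
have := Gz; rewrite /G.
have : G' z * (h - d - d) <= 0 by rewrite mulr_le0_ge0//; lra.
lra.
Qed.

Lemma cvg_inner_cell (f : R -> R) i : (i < N)%N -> mu.-integrable I (EFin \o f) ->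
  \int[mu]_(x in inner_cell (h / 2 / k.+2%:R) i) f x @[k --> \oo] -->
  \int[mu]_(x in `]node i, node i.+1[) f x.
Proof.
move=> iN fi; set D := `]node i, node i.+1[%classic.
have h0 : 0 < h by exact: mesh_gt0.
pose d k : R := h / 2 / k.+2%:R.
have d0 k : 0 < d k by rewrite /d divr_gt0// divr_gt0.
have fD : mu.-integrable D (EFin \o f).
  exact: (integrable_sub_itv (open_cell_sub ab N0 iN) fi).
have KD k : inner_cell (d k) i `<=` D.
  move=> x; rewrite /inner_cell /D /= !in_itv/= => /andP[ix xi].
  by have := d0 k; move: (d k) ix xi => e ix xi e0; apply/andP; split; lra.
have -> : (fun k => \int[mu]_(x in inner_cell (h / 2 / k.+2%:R) i) f x) =
    (fun k => \int[mu]_(x in D) (\1_(inner_cell (d k) i) x * f x)).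
  by apply: funext => k; rewrite Rintegral_indicM.
have [] := @Rdominated_cvg _ _ _ mu D (fun k x => \1_(inner_cell (d k) i) x * f x) f (fun x => `|f x|).
- exact: measurable_itv.
- move=> k; apply: measurable_funM; last exact: integrable_Rmeasurable fD.
  by apply: measurable_indic; exact: measurable_itv.
- move=> x; rewrite /D /= in_itv/= => /andP[ix xi].
  apply: cvg_near_cst; near=> k.
  rewrite indicE mem_set ?mul1r// /inner_cell /= in_itv/=.
  have dk : d k < Num.min (x - node i) (node i.+1 - x).
    near: k; apply: (cvgr_lt (0 : R)); last by rewrite lt_min !subr_gt0 ix.
    have : h / 2 * k.+1%:R^-1 @[k --> \oo] --> h / 2 * 0.
      by apply: cvgMr; exact: cvg_harmonic.
    by rewrite mulr0 -(cvg_shiftS (fun k => h / 2 * k.+1%:R^-1)).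
  move: dk; rewrite lt_min => /andP[dx xd].
  by apply/andP; split; lra.
- move=> k x _; rewrite normrM ler_piMl// indicE; case: (_ \in _); rewrite ?normr1 ?normr0//.
- exact: (integrable_abse fD).
by [].
Unshelve. all: by end_near. Qed.

Lemma cvg_L1loc_pairing (u : nat -> R -> 'rV[R]_n) (w : R -> 'rV[R]_n) (z : 'rV[R]_n) (K A : set R) :
  cvg_L1loc I u w -> compact K -> K `<=` I -> A `<=` K ->
  measurable (A : set (measurableTypeR R)) ->
  (forall l c, mu.-integrable K (EFin \o (fun x => u l x 0 c))) ->
  (forall c, mu.-integrable K (EFin \o (fun x => w x 0 c))) ->
  \int[mu]_(x in A) dotp z (u l x) @[l --> \oo] --> \int[mu]_(x in A) dotp z (w x).
Proof.
move=> cuw cK KI AK mA iu iw.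
have mK : measurable (K : set (measurableTypeR R)) by exact: compact_measurable.
have mD l : measurable_fun K (fun x => enorm (u l x - w x)).
  have ms : measurable_fun setT (@Num.sqrt R).
    by apply: continuous_measurable_fun; exact: sqrt_continuous.
  rewrite /enorm; apply: (measurableT_comp ms).
  apply: measurable_dotp => c;
    apply: (eq_measurable_fun (fun x => u l x 0 c - w x 0 c)) => [x _|]; rewrite ?mxE//;
    by apply: measurable_funB; [exact: integrable_Rmeasurable (iu l c)|exact: integrable_Rmeasurable (iw c)].
have iz (v : R -> 'rV[R]_n) : (forall c, mu.-integrable K (EFin \o (fun x => v x 0 c))) ->
    mu.-integrable A (EFin \o (fun x => dotp z (v x))).
  move=> iv; apply: integrable_Rsum => // c; apply: integrable_RZ => //.
  exact: integrableS (iv c).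
pose e l := ((enorm z)%:E * \int[mu]_(x in K) (enorm (u l x - w x))%:E)%E.
have e0 : e l @[l --> \oo] --> 0%E.
  by rewrite -(mule0 (enorm z)%:E); apply: cvgeZl => //; exact: cuw.
have le_e l : (`|\int[mu]_(x in A) dotp z (u l x) - \int[mu]_(x in A) dotp z (w x)|%:E <= e l)%E.
  rewrite -RintegralB//; [|exact: iz|exact: iz].
  have iB := integrable_RB mA (iz _ (iu l)) (iz _ iw).
  apply: (@le_trans _ _ (\int[mu]_(x in A) `|dotp z (u l x) - dotp z (w x)|)%:E).
    by rewrite lee_fin; exact: le_normr_Rintegral.
  rewrite -Rintegral_EFin//; last exact: (integrable_abse iB).
  apply: (@le_trans _ _ (\int[mu]_(x in A) ((enorm z)%:E * (enorm (u l x - w x))%:E))%E).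
    apply: ge0_le_integralW => x _; rewrite ?lee_fin// -dotpBr.
    by rewrite ler_norml dotp_le andbT lerNl -dotpNr (le_trans (dotp_le _ _))// enormN.
  rewrite ge0_integralZl_EFin ?enorm_ge0//; last 2 first.
  - by move=> x _; rewrite lee_fin enorm_ge0.
  - by apply/measurable_EFinP; apply: (measurable_funS mK AK (mD l)).
  apply: lee_wpmul2l; first by rewrite lee_fin enorm_ge0.
  apply: ge0_subset_integral => //; first by apply/measurable_EFinP; exact: mD.
  by move=> x _; rewrite lee_fin enorm_ge0.
have [efin e0'] := (fine_cvgP e 0).1 e0.
apply/cvgrPdist_le => eps eps0.
have he : \forall l \near \oo, `|fine (e l)| <= eps := @cvgr0_norm_le _ _ _ _ _ (fine \o e) e0' eps eps0.
near=> l; rewrite distrC -lee_fin (le_trans (le_e l))//.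
have el : e l \is a fin_num by near: l.
rewrite -(fineK el) lee_fin.
have : `|fine (e l)| <= eps by near: l; exact: he.
by move=> el_le; exact: (le_trans (ler_norm _) el_le).
Unshelve. all: by end_near. Qed.

(** Together with [frequently_le_cvg] this replaces the extraction of a subsequence: a bound at
    infinitely many indices passes to the limit of a convergent sequence. *)
Lemma limn_einf_lt_frequently (C : nat -> \bar R) (c : R) :
  (limn_einf C < c%:E)%E -> forall m, exists2 l, (m <= l)%N & (C l < c%:E)%E.
Proof.
rewrite limn_einf_lim => Cc m.
have em : (einfs C m <= limn (einfs C))%E.
  apply: lime_ge; first exact: is_cvg_einfs.
  by near=> k; apply: nondecreasing_einfs; near: k; exact: nbhs_infty_ge.
have [_ [l /= ml <-] lc] := ereal_inf_lt (le_lt_trans em Cc).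
by exists l.
Unshelve. all: by end_near. Qed.

Lemma frequently_le_cvg (s : nat -> R) (l c : R) : s k @[k --> \oo] --> l ->
  (forall m, exists2 k, (m <= k)%N & s k <= c) -> l <= c.
Proof.
move=> sl fr; rewrite leNgt; apply/negP => cl.
have [m _ hm] : \forall k \near \oo, c < s k by exact: (cvgr_gt l sl).
by have [k mk] := fr m; rewrite leNgt hm.
Qed.

(** The bound for C^1 curves is linear in integrals over inner cells, so it passes to the limit:
    first along the approximating curves with the margin fixed, then as the margin tends to 0. *)
Lemma relaxed_ge_means (w : R -> 'rV[R]_n) : is_L2 I w ->
  ((\sum_(1 <= k < N) dotp (zeta k) (incr (cell_mean a b N w) k))%:E <= relaxed I phi w)%E.
Proof.
move=> hw; apply: le_ereal_inf_tmp => _ [u [u1 cuw] <-].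
set S := (X in (X%:E <= _)%E); set C := (fun l => _ : \bar R).
have h0 : 0 < h by exact: mesh_gt0.
rewrite leNgt; apply/negP => CS.
(* A real c strictly between the lower limit and [S] bounds the energies at infinitely many indices;
   the two limits then give [S <= c]. *)
have [c [Cc cS]] : exists c : R, (limn_einf C < c%:E)%E /\ c < S.
  move: CS; case: (limn_einf C) => [r|//|].
  - by rewrite lte_fin => rS; exists ((r + S) / 2); rewrite lte_fin; split; lra.
  - by move=> _; exists (S - 1); split; [exact: ltNyr|lra].
have fr := limn_einf_lt_frequently Cc.
have c0 : 0 < c.
  have [l _] := fr 0%N; rewrite -lte_fin; apply: le_lt_trans.
  by apply: integral_ge0 => x _; rewrite lee_fin.
(* The divisor starts at 2, so that twice the margin is already smaller than one cell for k = 0. *)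
pose d k : R := h / 2 / k.+2%:R.
have d0 k : 0 < d k by rewrite /d divr_gt0// divr_gt0.
have dh k : 2 * d k < h.
  rewrite /d (_ : 2 * (h / 2 / k.+2%:R) = h / k.+2%:R); last by field.
  by rewrite ltr_pdivrMr// ltr_pMr// ltr1n.
have iw k : mu.-integrable I (EFin \o (fun x => dotp (zeta k) (w x))).
  apply: integrable_Rsum; first exact: measurable_itv.
  move=> j; apply: integrable_RZ; first exact: measurable_itv.
  exact: L2_coord_integrable.
(* The value 0 for k >= N makes the convergence statements true for every k, as [cvg_finsum]
   asks. *)
pose J v e k i := if (k < N)%N then \int[mu]_(x in inner_cell e i) dotp (zeta k) (v x : 'rV[R]_n) else 0.
pose J0 k i := if (k < N)%N then \int[mu]_(x in `]node i, node i.+1[) dotp (zeta k) (w x) else 0.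
have inner_le e : 0 < e -> 2 * e < h -> \sum_(1 <= k < N) (J w e k k - J w e k k.-1) <= c * h.
  move=> e0 eh.
  apply: (@frequently_le_cvg (fun l => \sum_(1 <= k < N) (J (u l) e k k - J (u l) e k k.-1))).
    have cJ k i : (i <= k)%N -> J (u l) e k i @[l --> \oo] --> J w e k i.
      rewrite /J; case: (boolP (k < N)%N) => kN ik; last exact: cvg_cst.
      have iN : (i < N)%N by exact: leq_ltn_trans kN.
      have KI : `[node i + e, node i.+1 - e]%classic `<=` I.
        apply: subset_trans (open_cell_sub ab N0 iN) => x.
        by rewrite /= !in_itv/= => /andP[ix xi]; apply/andP; split; lra.
      apply: (@cvg_L1loc_pairing _ _ _ `[node i + e, node i.+1 - e]%classic) => //.
      - exact: segment_compact.
      - exact: subset_itv_oc_cc.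
      - exact: measurable_itv.
      - move=> l j; apply: FTC2_integrable => x xe.
        have Ix : I x by apply: KI; rewrite /= in_itv.
        have [du _] := u1 l x Ix.
        have /derivable_mxP duc := du.
        by apply/differentiable_continuous/derivable1_diffP; exact: (duc 0 j).
      - move=> j; exact: (integrable_sub_itv KI (L2_coord_integrable j hw)).
    by apply: cvg_finsum => k; apply: cvgB; apply: cJ => //; exact: leq_pred.
  move=> m; have [l ml Cl] := fr m; exists l => //.
  have := inner_chain_variation_le (u1 l) e0 eh (ltW Cl).
  have -> : \sum_(1 <= k < N) (J (u l) e k k - J (u l) e k k.-1) =
    \sum_(1 <= k < N) (\int[mu]_(x in inner_cell e k) dotp (zeta k) (u l x)
      - \int[mu]_(x in inner_cell e k.-1) dotp (zeta k) (u l x)).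
    by rewrite big_nat [RHS]big_nat; apply: eq_bigr => k /andP[_ kN]; rewrite /J kN.
  by move=> /le_trans; apply; rewrite ler_pM2l// gerBl mulr_ge0// ltW.
have S_le : \sum_(1 <= k < N) (J0 k k - J0 k k.-1) <= c * h.
  apply: (@frequently_le_cvg (fun j => \sum_(1 <= k < N) (J w (d j) k k - J w (d j) k k.-1))).
    have cJ k i : (i <= k)%N -> J w (d j) k i @[j --> \oo] --> J0 k i.
      rewrite /J /J0; case: (boolP (k < N)%N) => kN ik; last exact: cvg_cst.
      by apply: cvg_inner_cell; [exact: leq_ltn_trans kN|exact: iw].
    by apply: cvg_finsum => k; apply: cvgB; apply: cJ => //; exact: leq_pred.
  by move=> m; exists m => //; exact: inner_le.
have Sh : S * h = \sum_(1 <= k < N) (J0 k k - J0 k k.-1).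
  rewrite /S mulr_suml big_nat [RHS]big_nat; apply: eq_bigr => k /andP[k1 kN].
  have mean i : (i < N)%N -> dotp (zeta k) (cell_mean a b N w i) * h =
      \int[mu]_(x in `]node i, node i.+1[) dotp (zeta k) (w x).
    move=> iN; have ij j : mu.-integrable `]node i, node i.+1[ (EFin \o (fun x => w x 0 j)).
      exact: (integrable_sub_itv (open_cell_sub ab N0 iN) (L2_coord_integrable j hw)).
    rewrite /dotp Rintegral_sum//; last by move=> j; exact: integrable_RZ.
    rewrite mulr_suml; apply: eq_bigr => j _; rewrite mxE RintegralZl//.
    by field; rewrite gt_eqF.
  have k1N : (k.-1 < N)%N by exact: leq_ltn_trans (leq_pred k) kN.
  by rewrite /J0 kN /incr dotpBr mulrBl !mean.
by move: S_le; rewrite -Sh leNgt ltr_pM2r// cS.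
Qed.

End relaxed_lower_bound.

(** * A recovery sequence for cellwise constant functions *)

Section relaxed_upper_bound.
Context {R : realType} {n : nat}.
Variables (a b : R) (N : nat).
Hypotheses (ab : a < b) (N0 : (0 < N)%N).
Local Notation mu := (@lebesgue_measure R).
Local Notation I := (`]a, b[%classic : set R).
Local Notation node := (node a b N).
Variables (phi : 'rV[R]_n -> R) (P : nat -> 'rV[R]_n).
Hypothesis phi_ge0 : forall p, 0 <= phi p.
Hypothesis phi_sublinear : sublinear phi.

Lemma sublinear_sum (J : Type) (s : seq J) (c : J -> R) (q : J -> 'rV[R]_n) :
  (forall j, 0 <= c j) ->
  phi (\sum_(j <- s) c j *: q j) <= \sum_(j <- s) c j * phi (q j).
Proof.
move=> c0; elim/big_ind2 : _ => [|x y z t hx hz|j _].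
- by rewrite (sublinear0 phi_sublinear).
- by rewrite (le_trans (phi_sublinear.1 _ _))// lerD.
- by rewrite phi_sublinear.2.
Qed.

(** The profile vanishes up to node k included and tends to 1 beyond it, in agreement with cells
    that are open on the left. It is nondecreasing, which the energy bound exploits. *)
Definition smooth_jump (l k : nat) (x : R) : R := flat (l.+1%:R * (x - node k)).

(** [flat_pow 2] is the derivative of [flat]: the first term in [flat_pow_is_derive] carries the
    factor k = 0. *)
Definition smooth_jump_der (l k : nat) (x : R) : R :=
  l.+1%:R * flat_pow 2 (l.+1%:R * (x - node k)).

Lemma smooth_jump_is_derive l k (x : R) :
  is_derive x 1 (smooth_jump l k) (smooth_jump_der l k x).
Proof.
have dl : is_derive x 1 (fun y : R => l.+1%:R * (y - node k)) l.+1%:R.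
  have d1 : is_derive x 1 (fun y : R => y - node k) 1.
    have := @is_deriveB _ _ _ id (cst (node k)) x 1 _ _ (is_derive_id x 1) (is_derive_cst (node k) x 1).
    by move/is_derive_eq; apply; rewrite subr0.
  have := is_deriveZ l.+1%:R d1.
  by move/is_derive_eq; apply; rewrite /GRing.scale/= mulr1.
have := @is_derive1_comp _ _ (fun y : R => l.+1%:R * (y - node k)) x _ _
  (flat_pow_is_derive 0 (l.+1%:R * (x - node k))) dl.
move/is_derive_eq; apply.
by rewrite mulNr mul0r oppr0 add0r mulrC.
Qed.

Lemma smooth_jump_der_ge0 l k x : 0 <= smooth_jump_der l k x.
Proof.
rewrite mulr_ge0// /flat_pow; case: ifP => // x0.
by rewrite mulr_ge0 ?expR_ge0// exprn_ge0// invr_ge0 ltW.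
Qed.

Lemma smooth_jump_der_continuous l k : continuous (smooth_jump_der l k).
Proof.
have sf : smooth (fun x => flat_pow 2 (l.+1%:R * (x - node k))).
  have := @smooth_affine _ _ l.+1%:R (- (l.+1%:R * node k)) (@smooth_flat_pow R 2).
  by congr smooth; apply: funext => y; rewrite mulrBr.
by move=> x; apply: cvgMr; exact: (@smooth_continuous _ _ sf).
Qed.

Lemma smooth_jump_cvg k x :
  smooth_jump l k x @[l --> \oo] --> (if node k < x then 1 else 0 : R).
Proof.
case: ltP => kx; first by apply: flat_cvg1; rewrite subr_gt0.
rewrite (_ : (fun _ => _) = cst 0); first exact: cvg_cst.
by apply: funext => l; rewrite /smooth_jump flat_le0// mulr_ge0_le0// subr_le0.
Qed.

Definition recovery (l : nat) (x : R) : 'rV[R]_n :=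
  P 0 + \sum_(1 <= k < N) smooth_jump l k x *: incr P k.

Lemma recovery_is_derive l (x : R) : is_derive x 1 (recovery l)
  (\sum_(1 <= k < N) smooth_jump_der l k x *: incr P k).
Proof.
have dZ k : is_derive x 1 (fun y => smooth_jump l k y *: incr P k)
    (smooth_jump_der l k x *: incr P k).
  have dk := smooth_jump_is_derive l k x.
  have dM : derivable (fun y => smooth_jump l k y *: incr P k) x 1.
    apply/derivable_mxP => i j.
    rewrite (_ : (fun _ => _) = smooth_jump l k * cst (incr P k i j)); last first.
      by apply: funext => y; rewrite mxE.
    by apply: ex_derive; apply: is_deriveM.
  apply: DeriveDef => //; rewrite derive_mx//; apply/matrixP => i j; rewrite mxE.
  rewrite (_ : (fun _ => _) = smooth_jump l k * cst (incr P k i j)); last first.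
    by apply: funext => y; rewrite mxE.
  rewrite (@derive_val _ _ _ _ _ _ _ (is_deriveM dk (is_derive_cst (incr P k i j) x 1))).
  by rewrite scaler0 add0r [RHS]mxE /GRing.scale/= mulrC.
have := is_deriveD (is_derive_cst (P 0) x 1) (is_derive_finsum (index_iota 1 N) dZ).
by move/is_derive_eq; apply; rewrite add0r.
Qed.

Lemma derive1_recovery l : derive1 (recovery l) =
  fun x => \sum_(1 <= k < N) smooth_jump_der l k x *: incr P k.
Proof.
apply: funext => x; rewrite derive1E.
exact: (@derive_val _ _ _ _ _ _ _ (recovery_is_derive l x)).
Qed.

Lemma recovery_C1 l : is_C1 I (recovery l).
Proof.
move=> x _; split.
  exact: (@ex_derive _ _ _ _ _ _ _ (recovery_is_derive l x)).
rewrite derive1_recovery /prop_for /continuous_at; apply: cvg_finsum => k.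
by apply: cvgZr_tmp; exact: smooth_jump_der_continuous.
Qed.

(** The jumps enter the derivative with nonnegative coefficients, so sublinearity separates them,
    and each profile gains at most 1 across I. Smoothing thus costs nothing, for every l. *)
Lemma recovery_energy l :
  (\int[mu]_(x in I) (phi (derive1 (recovery l) x))%:E <=
   (\sum_(1 <= k < N) phi (incr P k))%:E)%E.
Proof.
have mI : measurable (I : set (measurableTypeR R)) by exact: measurable_itv.
have ij k : mu.-integrable `[a, b] (EFin \o smooth_jump_der l k).
  by apply: continuous_itv_integrable; exact: smooth_jump_der_continuous.
have ijI k : mu.-integrable I (EFin \o smooth_jump_der l k).
  by apply: integrable_sub_itv (ij k); exact: subset_itv_oo_cc.
have ip k : mu.-integrable I (EFin \o (fun x => smooth_jump_der l k x * phi (incr P k))).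
  have := integrable_RZ (phi (incr P k)) mI (ijI k).
  by apply: eq_integrable => // x _ /=; rewrite mulrC.
apply: (@le_trans _ _ (\int[mu]_(x in I) (\sum_(1 <= k < N) smooth_jump_der l k x * phi (incr P k))%:E)%E).
  apply: ge0_le_integralW => x _; rewrite lee_fin// derive1_recovery.
  by apply: sublinear_sum => k; exact: smooth_jump_der_ge0.
rewrite Rintegral_EFin//; last exact: integrable_Rsum.
rewrite lee_fin Rintegral_sum//; apply: ler_sum => k _.
rewrite RintegralZr// ler_piMl//.
rewrite -(Rintegral_itv_oo true false (integrable_Rmeasurable (ijI k))).
rewrite (_ : Rintegral _ _ _ = smooth_jump l k b - smooth_jump l k a).
  by have := flat_le1 (l.+1%:R * (b - node k)); have := flat_ge0 (l.+1%:R * (a - node k));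
    rewrite /smooth_jump; lra.
apply: (@Rintegral_FTC2 _ (smooth_jump l k)) => //.
  by move=> x _; exact: smooth_jump_is_derive.
by move=> x _; exact: smooth_jump_der_continuous.
Qed.

Lemma step_jumps i x : (i < N)%N -> cell a b N i x ->
  step a b N P x = P 0 + \sum_(1 <= k < N) (if node k < x then 1 else 0) *: incr P k.
Proof.
move=> iN ix; rewrite (step_in ab N0 P iN ix).
have /mem_cell/andP[ni xi] := ix.
rewrite (@big_cat_nat _ _ _ i.+1)//= [X in _ + (_ + X)]big_nat [X in _ + (_ + X)]big1 ?addr0; last first.
  move=> k /andP[ik _]; rewrite ifF ?scale0r//; apply/negbTE; rewrite -leNgt.
  by rewrite (le_trans xi)// node_le.
rewrite (_ : \sum_(1 <= k < i.+1) _ = \sum_(0 <= k < i) (P k.+1 - P k)).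
  by rewrite telescope_sumr// subrKC.
rewrite big_add1/= big_nat [RHS]big_nat; apply: eq_bigr => k /andP[_ ki].
by rewrite ifT ?scale1r// (le_lt_trans _ ni)// node_le.
Qed.

Lemma cells_cover x : I x -> exists2 i, (i < N)%N & cell a b N i x.
Proof.
rewrite /= in_itv/= => /andP[ax xb].
have h0 : 0 < mesh a b N by exact: mesh_gt0.
have : exists m, (m <= N)%N && (x <= node m).
  by exists N; rewrite leqnn (nodeN a b N0) ltW.
move=> ex; have [m /andP[mN xm] mmin] := ex_minnP ex.
case: m mN xm mmin => [|m] mN xm mmin.
  by move: xm; rewrite (node0 a b N) leNgt ax.
exists m => //; apply/mem_cell; rewrite xm andbT ltNge; apply/negP => xm'.
by have := mmin m; rewrite (ltnW mN) xm' ltnn => /(_ isT).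
Qed.

Lemma recovery_cvg : cvg_L1loc I recovery (step a b N P).
Proof.
move=> K cK KI.
have mK : measurable (K : set (measurableTypeR R)) by exact: compact_measurable.
have mI : measurable (I : set (measurableTypeR R)) by exact: measurable_itv.
pose H k x : R := if node k < x then 1 else 0.
pose e l x := \sum_(1 <= k < N) `|smooth_jump l k x - H k x| * enorm (incr P k).
have le_e l x : K x -> enorm (recovery l x - step a b N P x) <= e l x.
  move=> /KI/cells_cover[i iN ix]; rewrite (step_jumps iN ix) /recovery.
  rewrite opprD addrACA subrr add0r -sumrB (le_trans (enorm_sum _ _ _))//.
  by apply: ler_sum => k _; rewrite -scalerBl enormZ.
have mH k : measurable_fun K (H k).
  have -> : H k = \1_(`]node k, +oo[%classic : set R).
    apply: funext => x; rewrite indicE /H.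
    case: ifPn => kx; first by rewrite mem_set// /= in_itv/= kx.
    by rewrite memNset// /= in_itv/= andbT; exact/negP.
  by apply: measurable_indic; exact: measurable_itv.
have msj l k : measurable_fun K (smooth_jump l k).
  apply: measurable_funTS; apply: continuous_measurable_fun => x.
  apply/differentiable_continuous/derivable1_diffP.
  exact: (@ex_derive _ _ _ _ _ _ _ (smooth_jump_is_derive l k x)).
have me l : measurable_fun K (e l).
  apply: measurable_sum => k; apply: measurable_funM => //.
  by apply: measurableT_comp => //; exact: measurable_funB.
have e_cvg x : e l x @[l --> \oo] --> (0 : R).
  rewrite [X in _ --> X](_ : 0 = \sum_(1 <= k < N) 0 * enorm (incr P k)); last first.
    by rewrite big1// => k _; rewrite mul0r.
  apply: cvg_finsum => k; apply: cvgMl.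
  rewrite -(@normr0 _ R) -(subrr (H k x)); apply: cvg_norm; apply: cvgB; last exact: cvg_cst.
  exact: smooth_jump_cvg.
have e_le l x : e l x <= \sum_(1 <= k < N) enorm (incr P k).
  apply: ler_sum => k _; rewrite ler_piMl ?enorm_ge0//.
  have := flat_le1 (l.+1%:R * (x - node k)); have := flat_ge0 (l.+1%:R * (x - node k)).
  by rewrite /H /smooth_jump; case: ifP => _ ? ?; rewrite ler_norml; lra.
have e0 l x : 0 <= e l x by apply: sumr_ge0 => k _; rewrite mulr_ge0 ?enorm_ge0.
have icst c : mu.-integrable K (EFin \o cst c).
  by apply: (@integrableS _ _ _ mu I) => //; exact: integrable_itv_cst.
have [] := @Rdominated_cvg _ _ _ mu K e (cst 0) (cst (\sum_(1 <= k < N) enorm (incr P k))).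
- exact: mK.
- exact: me.
- by move=> x _; exact: e_cvg.
- by move=> l x _; rewrite ger0_norm.
- exact: icst.
move=> _; rewrite [X in _ --> X](_ : _ = 0); last by rewrite Rintegral_cst// mul0r.
move=> ecv.
have ie l : mu.-integrable K (EFin \o e l).
  by apply: (integrable_Rle mK (me l) _ (icst (\sum_(1 <= k < N) enorm (incr P k)))) => x _; rewrite ger0_norm.
apply: (@squeeze_cvge _ _ _ _ (cst 0%E) _ (fun l => (\int[mu]_(x in K) e l x)%:E)).
- near=> l; rewrite integral_ge0/=; last by move=> x _; rewrite lee_fin enorm_ge0.
  rewrite -Rintegral_EFin//; apply: ge0_le_integralW => x Kx; rewrite lee_fin ?enorm_ge0//.
  exact: le_e.
- exact: cvg_cst.
- by apply: cvg_EFin; [exact: nearW|exact: ecv].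
Unshelve. all: by end_near. Qed.

Lemma relaxed_step_le :
  (relaxed I phi (step a b N P) <= (\sum_(1 <= k < N) phi (incr P k))%:E)%E.
Proof.
apply: (@le_trans _ _ (limn_einf (fun l => \int[mu]_(x in I) (phi (derive1 (recovery l) x))%:E)%E)).
  apply: ereal_inf_lbound; exists recovery => //; split; last exact: recovery_cvg.
  exact: recovery_C1.
rewrite limn_einf_lim; apply: lime_le; first exact: is_cvg_einfs.
near=> l; apply: (le_trans _ (recovery_energy l)).
by apply: ereal_inf_lbound; exists l => /=.
Unshelve. all: by end_near. Qed.

End relaxed_upper_bound.

(** * Time regularity of the flow *)

Section ae_tools.
Context {R : realType}.
Local Notation mu := (@lebesgue_measure R).

(** Having the exceptional set measurable allows its indicator to be carried inside integrands. *)
Lemma ae_null_cover (Q : R -> Prop) : {ae mu, forall t, Q t} ->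
  exists A : set R, [/\ measurable (A : set (measurableTypeR R)), mu A = 0%E & forall t, ~ A t -> Q t].
Proof.
move=> [A [mA A0 QA]]; exists A; split => // t nA.
by apply: contrapT => nQ; apply: nA; exact: QA.
Qed.

Lemma ae_mono (P Q : R -> Prop) : {ae mu, forall t, P t} -> (forall t, P t -> Q t) ->
  {ae mu, forall t, Q t}.
Proof. by move=> hP PQ; apply: (@filterS _ _ (ae_filter_ringOfSetsType mu) _ _ _ hP). Qed.

Lemma ae_conj (P Q : R -> Prop) : {ae mu, forall t, P t} -> {ae mu, forall t, Q t} ->
  {ae mu, forall t, P t /\ Q t}.
Proof. by move=> hP hQ; exact: (@filterI _ _ (ae_filter_ringOfSetsType mu) _ _ hP hQ). Qed.

Lemma null_ae (A : set R) : measurable (A : set (measurableTypeR R)) -> mu A = 0%E ->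
  {ae mu, forall t, ~ A t}.
Proof. by move=> mA A0; exists A; split => // t /= /contrapT. Qed.

Lemma ae_eq_Rintegral (D : set R) (f g : R -> R) :
  measurable (D : set (measurableTypeR R)) ->
  measurable_fun D f -> measurable_fun D g ->
  {ae mu, forall x, D x -> f x = g x} ->
  \int[mu]_(x in D) f x = \int[mu]_(x in D) g x.
Proof.
move=> mD mf mg fg; rewrite /Rintegral; congr fine; apply: ae_eq_integral => //.
- exact/measurable_EFinP.
- exact/measurable_EFinP.
- by apply: (ae_mono fg) => x /= fgx Dx; rewrite fgx.
Qed.

End ae_tools.

(** * Pairing Bochner integrals with a fixed element of L^2 *)

Section bochner_pairing.
Context {R : realType} {n : nat}.
Variables (I J : set R).
Hypothesis mI : measurable (I : set (measurableTypeR R)).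
Hypothesis mJ : measurable (J : set (measurableTypeR R)).
Local Notation mu := (@lebesgue_measure R).
Implicit Types (s : @L2_simple R n I J) (w y : R -> 'rV[R]_n).

Lemma simple_fun_L2 s t : is_L2 I (simple_fun s t).
Proof. by apply: is_L2_sum => // i; exact: simple_L2. Qed.

Lemma simple_integral_L2 s : is_L2 I (simple_integral s).
Proof. by apply: is_L2_sum => // i; exact: simple_L2. Qed.

Lemma L2dot_suml (K : Type) (r : seq K) (c : K -> R) (w : K -> R -> 'rV[R]_n) y :
  (forall k, is_L2 I (w k)) -> is_L2 I y ->
  L2dot I (fun x => \sum_(k <- r) c k *: w k x) y = \sum_(k <- r) c k * L2dot I (w k) y.
Proof.
move=> hw hy; rewrite /L2dot.
transitivity (\int[mu]_(x in I) \sum_(k <- r) c k * dotp (w k x) (y x)).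
  by apply: eq_Rintegral => x _; rewrite dotp_suml; apply: eq_bigr => k _; rewrite dotpZl.
rewrite Rintegral_sum//; last by move=> k; apply: integrable_RZ => //; exact: L2dot_integrable.
by apply: eq_bigr => k _; rewrite RintegralZl//; exact: L2dot_integrable.
Qed.

Lemma simple_dotE s t w : is_L2 I w ->
  L2dot I (simple_fun s t) w =
  \sum_i \1_(simple_set (l:=s) i) t * L2dot I (simple_coef (l:=s) i) w.
Proof. by move=> hw; rewrite L2dot_suml// => i; exact: simple_L2. Qed.

Lemma simple_indic_integrable s i (c : R) :
  mu.-integrable J (EFin \o (fun t => \1_(simple_set (l:=s) i) t * c)).
Proof.
have mS := simple_measurable i.
apply: integrable_indicM => //; first exact: simple_sub.
apply/integrableP; split; first exact/measurable_EFinP.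
rewrite /= integral_cst//= lte_mul_pinfty//; exact: simple_finite.
Qed.

Lemma simple_dot_integrable s w : is_L2 I w ->
  mu.-integrable J (EFin \o (fun t => L2dot I (simple_fun s t) w)).
Proof.
move=> hw; have := @integrable_Rsum _ _ _ mu _ (index_enum _)
  (fun i t => \1_(simple_set (l:=s) i) t * L2dot I (simple_coef (l:=s) i) w) J mJ
  (fun i => simple_indic_integrable i _).
by apply: eq_integrable => // t _ /=; rewrite simple_dotE.
Qed.

Lemma simple_dot_integral s w : is_L2 I w ->
  \int[mu]_(t in J) L2dot I (simple_fun s t) w = L2dot I (simple_integral s) w.
Proof.
move=> hw; rewrite [RHS]L2dot_suml//; last by move=> i; exact: simple_L2.
transitivity (\int[mu]_(t in J) \sum_i \1_(simple_set (l:=s) i) t * L2dot I (simple_coef (l:=s) i) w).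
  by apply: eq_Rintegral => t _; rewrite simple_dotE.
rewrite Rintegral_sum//; last by move=> i; exact: simple_indic_integrable.
apply: eq_bigr => i _; have mS := simple_measurable i.
rewrite Rintegral_indicM; last exact: simple_sub.
by rewrite Rintegral_cst// mulrC.
Qed.

Lemma L2norm_cvg0 (u : nat -> R -> 'rV[R]_n) w :
  (forall k, is_L2 I (u k)) -> is_L2 I w ->
  L2norm I (u k - w) @[k --> \oo] --> 0%E ->
  Num.sqrt (L2sq I (u k - w)) @[k --> \oo] --> (0 : R).
Proof.
move=> hu hw cu; have := (fine_cvgP _ 0).1 cu => -[_].
rewrite (_ : _ \o _ = (fun k => Num.sqrt (L2sq I (u k - w))))//.
by apply: funext => k /=; rewrite L2norm_fin//; exact: is_L2B.
Qed.

Lemma L2norm_cvg_dot (u : nat -> R -> 'rV[R]_n) w y :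
  (forall k, is_L2 I (u k)) -> is_L2 I w -> is_L2 I y ->
  L2norm I (u k - w) @[k --> \oo] --> 0%E ->
  L2dot I (u k) y @[k --> \oo] --> L2dot I w y.
Proof.
move=> hu hw hy cu.
have cu' : Num.sqrt (L2sq I (u k - w)) * Num.sqrt (L2sq I y) @[k --> \oo] --> (0 : R).
  by rewrite -(mul0r (Num.sqrt (L2sq I y))); apply: cvgMl; exact: L2norm_cvg0.
apply/cvgrPdist_le => e e0.
have he := @cvgr0_norm_le _ _ _ _ _ _ cu' _ e0.
near=> k; rewrite distrC -L2dotBl//.
rewrite (le_trans (L2dot_le mI (is_L2B mI (hu k) hw) hy))//.
have : `|Num.sqrt (L2sq I (u k - w)) * Num.sqrt (L2sq I y)| <= e by near: k; exact: he.
by rewrite ger0_norm// mulr_ge0// sqrtr_ge0.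
Unshelve. all: by end_near. Qed.

Lemma L2norm_cvg_sq (u : nat -> R -> 'rV[R]_n) w :
  (forall k, is_L2 I (u k)) -> is_L2 I w ->
  L2norm I (u k - w) @[k --> \oo] --> 0%E ->
  L2sq I (u k) @[k --> \oo] --> L2sq I w.
Proof.
move=> hu hw cu.
have c1 := L2norm_cvg_dot hu hw hw cu.
have c3 := L2norm_cvg0 hu hw cu.
rewrite (_ : (fun _ => _) = (fun k => Num.sqrt (L2sq I (u k - w)) * Num.sqrt (L2sq I (u k - w))
    + (2 * L2dot I (u k) w - L2sq I w))); last first.
  apply: funext => k; rewrite -expr2 sqr_sqrtr ?L2sq_ge0// L2sqB//; ring.
rewrite [X in _ --> X](_ : _ = 0 * 0 + (2 * L2sq I w - L2sq I w)); last by ring.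
apply: cvgD; first exact: cvgM.
by apply: cvgB; [exact: cvgMr|exact: cvg_cst].
Qed.

(** The identity holds for simple functions, and both sides pass to the limit by Cauchy-Schwarz
    against w. Since G t belongs to L^2 only for almost every t, the pairing is represented by a
    measurable [al] equal to it almost everywhere. *)
Lemma bochner_pairing (G : R -> R -> 'rV[R]_n) y w (al : R -> R) :
  bochner_integral I J G y -> is_L2 I w -> measurable_fun J al ->
  {ae mu, forall t, J t -> al t = L2dot I (G t) w} ->
  \int[mu]_(t in J) al t = L2dot I y w.
Proof.
move=> [[GL2 _] hy [s [cs csy]]] hw mal alE.
have [A [mA A0 hA]] : exists A : set R, [/\ measurable (A : set (measurableTypeR R)), mu A = 0%E &
    forall t, ~ A t -> (J t -> is_L2 I (G t)) /\ (J t -> al t = L2dot I (G t) w)].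
  by apply: ae_null_cover; exact: ae_conj.
(* The norm of w plus 1, so that dividing by it is possible even if w vanishes. *)
pose M := Num.sqrt (L2sq I w) + 1.
have M0 : 0 < M by rewrite ltr_wpDl ?sqrtr_ge0.
pose a k t := L2dot I (simple_fun (s k) t) w.
have ia k : mu.-integrable J (EFin \o a k) by exact: simple_dot_integrable.
have ma k : measurable_fun J (a k) by exact: integrable_Rmeasurable (ia k).
have mD k : measurable_fun J (fun t => M^-1 * `|al t - a k t|).
  apply: measurable_funM => //; apply: measurableT_comp => //.
  exact: measurable_funB.
have D_le k : (\int[mu]_(t in J) (M^-1 * `|al t - a k t|)%:E <=
    \int[mu]_(t in J) L2norm I (G t - simple_fun (s k) t)%R)%E.
  have -> : (\int[mu]_(t in J) (M^-1 * `|al t - a k t|)%:E =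
      \int[mu]_(t in J) (\1_(~` A) t * (M^-1 * `|al t - a k t|))%:E)%E.
    apply: ae_eq_integral => //.
    - by apply/measurable_EFinP; exact: mD.
    - apply/measurable_EFinP; apply: measurable_funM; last exact: mD.
      by apply: measurable_indic; exact: measurableC.
    - apply: (ae_mono (null_ae mA A0)) => t nA _ /=.
      by rewrite indicE mem_set// mul1r.
  apply: ge0_le_integralW => t Jt.
    by rewrite lee_fin !mulr_ge0// ?invr_ge0 ?ltW// indicE.
  rewrite indicE; case: (boolP (t \in ~` A)) => tA; last by rewrite mul0r Lnorm_ge0.
  rewrite mul1r; have [GL aE] := hA t (set_mem tA).
  have hB := is_L2B mI (GL Jt) (simple_fun_L2 (s k) t).
  rewrite aE// /a -L2dotBl//; [|exact: GL|exact: simple_fun_L2].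
  rewrite L2norm_fin// lee_fin ler_pdivrMl//.
  rewrite (le_trans (L2dot_le mI hB hw))// mulrC ler_wpM2r ?sqrtr_ge0// /M; lra.
have M1 : 0 <= M^-1 by rewrite invr_ge0 ltW.
have Dcv : (\int[mu]_(t in J) (M^-1 * `|al t - a k t|)%:E)%E @[k --> \oo] --> 0%E.
  apply: (@squeeze_cvge _ _ _ _ (cst 0%E) _ (fun k => \int[mu]_(t in J) L2norm I (G t - simple_fun (s k) t)%R)%E).
  - near=> k; rewrite D_le andbT integral_ge0// => t _.
    by rewrite lee_fin mulr_ge0.
  - exact: cvg_cst.
  - exact: cs.
have [Dfin Dcv'] := (fine_cvgP _ 0).1 Dcv.
have iD k : (\int[mu]_(t in J) (M^-1 * `|al t - a k t|)%:E)%E \is a fin_num ->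
    mu.-integrable J (EFin \o (fun t => al t - a k t)).
  move=> fin; have : mu.-integrable J (EFin \o (fun t => M^-1 * `|al t - a k t|)).
    by apply: ge0_integrable => //; [exact: mD|move=> t _; rewrite mulr_ge0|rewrite ltey_eq fin].
  move=> /(integrable_RZ M mJ) iM.
  apply: (integrable_Rle mJ _ _ iM); first exact: (measurable_funB mal (ma k)).
  by move=> t _; rewrite mulrA divff ?gt_eqF// mul1r.
(* One index at which the distance integral is finite gives the integrability of [al], as the
   integrable [a m] plus an integrable error. *)
have [m _ hm] := Dfin.
have ial : mu.-integrable J (EFin \o al).
  have := integrable_RD mJ (iD m (hm m (leqnn m))) (ia m).
  by apply: eq_integrable => // t _ /=; rewrite subrK.
have c1 : \int[mu]_(t in J) a k t @[k --> \oo] --> L2dot I y w.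
  under eq_fun do rewrite simple_dot_integral//.
  by apply: L2norm_cvg_dot => // k; exact: simple_integral_L2.
have c2 : \int[mu]_(t in J) a k t @[k --> \oo] --> \int[mu]_(t in J) al t.
  apply/cvgrPdist_le => e e0.
  have eM : 0 < M^-1 * e by rewrite mulr_gt0// invr_gt0.
  have he := @cvgr0_norm_le _ _ _ _ _ _ Dcv' _ eM.
  near=> k; rewrite -RintegralB//.
  have kfin : (\int[mu]_(t in J) (M^-1 * `|al t - a k t|)%:E)%E \is a fin_num by near: k.
  apply: (le_trans (le_normr_Rintegral mJ (iD k kfin))).
  have : `|fine (\int[mu]_(t in J) (M^-1 * `|al t - a k t|)%:E)%E| <= M^-1 * e by near: k; exact: he.
  have iabs : mu.-integrable J (EFin \o (fun t => `|al t - a k t|)) by exact: (integrable_abse (iD k kfin)).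
  rewrite Rintegral_EFin//; last exact: integrable_RZ.
  rewrite /= RintegralZl// normrM ger0_norm// ler_pM2l ?invr_gt0//.
  by rewrite ger0_norm// Rintegral_ge0.
exact: cvg_unique c2 c1.
Unshelve. all: by end_near. Qed.

End bochner_pairing.

Section right_averages.
Context {R : realType}.
Local Notation mu := (@lebesgue_measure R).

Lemma right_average_cvg (al : R -> R) (c d : R) : c < d ->
  (forall x, c <= x <= d -> {for x, continuous al}) ->
  k.+1%:R * \int[mu]_(x in `]c, c + k.+1%:R^-1[) al x @[k --> \oo] --> al c.
Proof.
move=> cd cal; apply/cvgrPdist_le => e e0.
have cc : {for c, continuous al} by apply: cal; rewrite lexx ltW.
have [r /= r0 hr] := (cvgrPdist_le _ _).1 cc e e0.
have m0 : 0 < Num.min r (d - c) by rewrite lt_min r0 subr_gt0.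
have hk : \forall k \near \oo, `|(k.+1%:R^-1 : R)| < Num.min r (d - c).
  exact: (cvgr0_norm_lt (@harmonic R) (@cvg_harmonic R)).
near=> k.
have kh : `|(k.+1%:R^-1 : R)| < Num.min r (d - c) by near: k; exact: hk.
set h : R := k.+1%:R^-1.
have h0 : 0 < h by rewrite invr_gt0.
have hr' : h < Num.min r (d - c) by move: kh; rewrite gtr0_norm.
have ial : mu.-integrable `]c, c + h[ (EFin \o al).
  apply: (@integrable_sub_itv _ _ `[c, c + h]); first exact: subset_itv_oo_cc.
  apply: FTC2_integrable => x /andP[cx xh]; apply: cal; rewrite cx/=.
  by move: hr'; rewrite lt_min => /andP[_]; lra.
have icst := integrable_itv_cst c (c + h) false true (al c).
have mD : measurable (`]c, c + h[%classic : set (measurableTypeR R)) by exact: measurable_itv.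
have lebD : fine (mu `]c, c + h[%classic) = h.
  by rewrite lebesgue_measure_itv/= lte_fin ltrDl h0/= addrAC subrr add0r.
have -> : al c - k.+1%:R * \int[mu]_(x in `]c, c + h[) al x =
    k.+1%:R * \int[mu]_(x in `]c, c + h[) (al c - al x).
  rewrite RintegralB// Rintegral_cst// lebD mulrBr; congr (_ - _).
  by rewrite mulrCA /h mulfV// mulr1.
rewrite normrM ger0_norm// -ler_pdivlMl//.
have iB := integrable_RB mD icst ial.
apply: (le_trans (le_normr_Rintegral mD iB)).
have icste := integrable_itv_cst c (c + h) false true e.
apply: (@le_trans _ _ (\int[mu]_(x in `]c, c + h[) cst e x)).
  apply: le_Rintegral => //; first exact: (integrable_abse iB).
  move=> x; rewrite /= in_itv/= => /andP[cx xh].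
  apply: hr; rewrite /= ltr0_norm ?subr_lt0// opprB.
  by move: hr'; rewrite lt_min => /andP[+ _]; lra.
by rewrite Rintegral_cst// lebD mulrC.
Unshelve. all: by end_near. Qed.

Lemma trap_cvg_indic (c d x : R) : c <= d ->
  trap (k.+1%:R^-1) c d x @[k --> \oo] --> (\1_(`]c, d]%classic : set R) x : R).
Proof.
move=> cd.
have ramp1 (s : R) : 0 < s -> \forall k \near \oo, k.+1%:R * ramp (k.+1%:R^-1) s = 1 :> R.
  move=> s0.
  have hk : \forall k \near \oo, `|(k.+1%:R^-1 : R)| < s.
    exact: (cvgr0_norm_lt (@harmonic R) (@cvg_harmonic R)).
  near=> k; have kh : `|(k.+1%:R^-1 : R)| < s by near: k; exact: hk.
  have h0 : 0 < k.+1%:R^-1 :> R by rewrite invr_gt0.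
  by rewrite ramp_geh ?mulfV// ltW//; move: kh; rewrite gtr0_norm.
have ramp0 (s : R) k : s <= 0 -> ramp (k.+1%:R^-1) s = 0 by exact: ramp_le0.
apply: cvg_near_cst; rewrite indicE.
have [xc|cx] := leP x c.
  rewrite memNset; last by rewrite /= in_itv/= => /andP[]; rewrite ltNge xc.
  near=> k; rewrite /trap !ramp0 ?subrr ?mulr0// subr_le0// (le_trans xc)//.
have [xd|dx] := leP x d.
  rewrite mem_set; last by rewrite /= in_itv/= cx.
  near=> k; rewrite /trap (ramp0 (x - d)) ?subr_le0// subr0 invrK.
  by near: k; apply: ramp1; rewrite subr_gt0.
rewrite memNset; last by rewrite /= in_itv/= => /andP[_]; rewrite leNgt dx.
near=> k; rewrite /trap invrK mulrBr.
have -> : k.+1%:R * ramp k.+1%:R^-1 (x - c) = 1 by near: k; apply: ramp1; rewrite subr_gt0.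
have -> : k.+1%:R * ramp k.+1%:R^-1 (x - d) = 1 by near: k; apply: ramp1; rewrite subr_gt0.
by rewrite subrr.
Unshelve. all: by end_near. Qed.

End right_averages.

(** * Fundamental theorem for a continuous function with a weak derivative *)

Section distributional_ftc.
Context {R : realType}.
Local Notation mu := (@lebesgue_measure R).
Variables (J : set R) (al ga : R -> R).
Hypothesis mJ : measurable (J : set (measurableTypeR R)).
Hypothesis cal : forall x, J x -> {for x, continuous al}.
Hypothesis mga : measurable_fun J ga.
Hypothesis weak : forall psi, test_fun J psi ->
  \int[mu]_(t in J) (derive1 psi t * al t) = - \int[mu]_(t in J) (psi t * ga t).

(** The weak identity is tested with trapezoids: the smoothing is removed at fixed slope width h,
    and then h tends to 0. The averages of [al] over ]c, c + h[ and ]d, d + h[ tend to its values by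
    continuity, and d' leaves room for the slope to the right of d. *)
Lemma weak_ftc (c d d' : R) : c <= d -> d < d' -> `[c, d']%classic `<=` J ->
  mu.-integrable `[c, d'] (EFin \o ga) ->
  al d - al c = \int[mu]_(t in `]c, d]) ga t.
Proof.
move=> cd dd' KJ iga; set K := `[c, d']%classic.
have mK : measurable (K : set (measurableTypeR R)) by exact: measurable_itv.
have cK x : c <= x <= d' -> {for x, continuous al}.
  by move=> xK; apply: cal; apply: KJ; rewrite /= in_itv.
have trapE (h : R) : 0 < h -> d + h <= d' ->
    h^-1 * (\int[mu]_(x in `]c, c + h[) al x - \int[mu]_(x in `]d, d + h[) al x) =
    - \int[mu]_(t in K) (trap h c d t * ga t).
  move=> h0 hd'.
  have K'K : `[c, d + h]%classic `<=` K.
    by move=> x; rewrite /K /= !in_itv/= => /andP[-> xh]; exact: le_trans hd'.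
  have K'J := subset_trans K'K KJ.
  have ial : mu.-integrable `[c, d + h] (EFin \o al).
    by apply: FTC2_integrable => x /andP[cx xh]; apply: cK; rewrite cx (le_trans xh).
  have c1 := smooth_trap_derive1_cvg h0 cd K'J ial.
  have c2 : \int[mu]_(x in J) (al x * derive1 (smooth_trap h c d k) x) @[k --> \oo] -->
      - \int[mu]_(t in K) (trap h c d t * ga t).
    rewrite (_ : (fun _ => _) = (fun k => - \int[mu]_(t in K) (smooth_trap h c d k t * ga t))).
      apply: cvgN.
      have [] := @Rdominated_cvg _ _ _ mu K (fun k t => smooth_trap h c d k t * ga t)
        (fun t => trap h c d t * ga t) (fun t => `|ga t|).
      - exact: mK.
      - move=> k; apply: measurable_funM; last exact: integrable_Rmeasurable iga.
        by apply: measurable_funTS; apply: continuous_measurable_fun;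
          exact/smooth_continuous/smooth_smooth_trap.
      - by move=> x _; apply: cvgMl; exact: smooth_trap_cvg.
      - move=> k x _; rewrite normrM ler_piMl//.
        by have /andP[t0 t1] := smooth_trap_bound h0 cd k x; rewrite ger0_norm.
      - exact: (integrable_abse iga).
      by [].
    apply: funext => k.
    have := weak (smooth_trap_test cd k K'J).
    under eq_Rintegral do rewrite mulrC.
    move=> ->; congr (- _); rewrite Rintegral_mkcond [RHS]Rintegral_mkcond.
    apply: eq_Rintegral => x _; rewrite !patchE.
    case: (boolP (x \in K)) => xK; first by rewrite mem_set//; apply: KJ; rewrite inE in xK.
    case: ifP => // _; rewrite smooth_trap_out ?mul0r// => cx.
    move/negP: xK; apply; rewrite inE /K/= in_itv/=.
    by case/andP: cx => -> xdh; rewrite (le_trans xdh).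
  exact: cvg_unique c1 c2.
have c1 : k.+1%:R * (\int[mu]_(x in `]c, c + k.+1%:R^-1[) al x
    - \int[mu]_(x in `]d, d + k.+1%:R^-1[) al x) @[k --> \oo] --> al c - al d.
  rewrite (_ : (fun _ => _) = (fun k => k.+1%:R * \int[mu]_(x in `]c, c + k.+1%:R^-1[) al x
    - k.+1%:R * \int[mu]_(x in `]d, d + k.+1%:R^-1[) al x)); last first.
    by apply: funext => k; rewrite mulrBr.
  have r1 := right_average_cvg (le_lt_trans cd dd') cK.
  have cK2 x : d <= x <= d' -> {for x, continuous al}.
    by move=> /andP[dx xd']; apply: cK; rewrite (le_trans cd dx).
  have r2 := right_average_cvg dd' cK2.
  by apply: cvgB; [exact: r1|exact: r2].
have c2 : k.+1%:R * (\int[mu]_(x in `]c, c + k.+1%:R^-1[) al x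
    - \int[mu]_(x in `]d, d + k.+1%:R^-1[) al x) @[k --> \oo] -->
    - \int[mu]_(t in K) (\1_(`]c, d]%classic : set R) t * ga t).
  have hk : \forall k \near \oo, `|(k.+1%:R^-1 : R)| < d' - d.
    by apply: (cvgr0_norm_lt (@harmonic R) (@cvg_harmonic R)); rewrite subr_gt0.
  have c3 : (- \int[mu]_(t in K) (trap k.+1%:R^-1 c d t * ga t)) @[k --> \oo] -->
      - \int[mu]_(t in K) (\1_(`]c, d]%classic : set R) t * ga t).
    apply: cvgN.
    have [] := @Rdominated_cvg _ _ _ mu K (fun k t => trap k.+1%:R^-1 c d t * ga t)
        (fun t => \1_(`]c, d]%classic : set R) t * ga t) (fun t => `|ga t|).
    - exact: mK.
    - move=> k; apply: measurable_funM; last exact: integrable_Rmeasurable iga.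
      apply: (@measurable_fun_cvg _ _ _ _ (fun j => smooth_trap k.+1%:R^-1 c d j)).
        move=> j; apply: measurable_funTS; apply: continuous_measurable_fun.
        exact/smooth_continuous/smooth_smooth_trap.
      by move=> x _; exact: smooth_trap_cvg.
    - by move=> x _; apply: cvgMl; exact: trap_cvg_indic.
    - move=> k x _; rewrite normrM ler_piMl//.
      have h0 : 0 < k.+1%:R^-1 :> R by rewrite invr_gt0.
      by have /andP[t0 t1] := trap_bound h0 cd x; rewrite ger0_norm.
    - exact: (integrable_abse iga).
    by [].
  apply: cvg_trans c3; apply: near_eq_cvg; near=> k.
  have kh : `|(k.+1%:R^-1 : R)| < d' - d by near: k; exact: hk.
  have h0 : 0 < k.+1%:R^-1 :> R by rewrite invr_gt0.
  rewrite -trapE ?invrK// -lerBrDl ltW//.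
  by move: kh; rewrite gtr0_norm.
have := cvg_unique (@Rhausdorff R) c1 c2.
rewrite Rintegral_indicM; first by move=> e; apply: oppr_inj; rewrite -e opprB.
by move=> x; rewrite /K /= !in_itv/= => /andP[/ltW -> xd]; rewrite (le_trans xd (ltW dd')).
Unshelve. all: by end_near. Qed.

End distributional_ftc.

(** * The evolution equation in integrated form *)

Section flow.
Context {R : realType} {n : nat}.
Variables (a b : R).
Hypothesis ab : a < b.
Local Notation mu := (@lebesgue_measure R).
Local Notation I := (`]a, b[%classic : set R).
Local Notation J := (`]0, +oo[%classic : set R).
Variables (v g : R -> R -> 'rV[R]_n).
Hypothesis vL2 : forall t, 0 <= t -> is_L2 I (v t).
Hypothesis vcont : forall t0, 0 <= t0 ->
  L2norm I (v t - v t0) @[t --> within [set t | 0 <= t] (nbhs t0)] --> 0%E.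
Hypothesis vg : W12loc_deriv I J v g.

Let mI : measurable (I : set (measurableTypeR R)). Proof. exact: measurable_itv. Qed.
Let mJ : measurable (J : set (measurableTypeR R)). Proof. exact: measurable_itv. Qed.

Lemma L2normBC (w z : R -> 'rV[R]_n) : L2norm I (w - z) = L2norm I (z - w).
Proof.
rewrite !L2normE; congr (_ `^ _)%E; apply: eq_integral => x _.
have -> : (w - z) x = - ((z - w) x) by change (w x - z x = - (z x - w x)); rewrite opprB.
by rewrite dotpNl dotpNr opprK.
Qed.

Lemma within_ge0_nbhs (t : R) : 0 < t -> within [set t | 0 <= t] (nbhs t) = nbhs t.
Proof.
move=> t0; apply/seteqP; split => A.
  move=> wA; have tp : \forall x \near t, 0 < x by exact: lt_nbhsr.
  near=> x; have x0 : 0 < x by near: x.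
  have : 0 <= x -> A x by near: x; exact: wA.
  by apply; exact: ltW.
by move=> nA; rewrite /within/=; near=> x => _; near: x.
Unshelve. all: by end_near. Qed.

Lemma flow_sqrt_cvg (t0 : R) : 0 <= t0 ->
  Num.sqrt (L2sq I (v t - v t0)) @[t --> within [set t | 0 <= t] (nbhs t0)] --> (0 : R).
Proof.
move=> t00; have := (fine_cvgP _ 0).1 (vcont t00) => -[_].
apply: cvg_trans; apply: near_eq_cvg; near=> t.
have t1 : 0 <= t by near: t; exact: withinT.
by rewrite /= L2norm_fin//; apply: is_L2B => //; exact: vL2.
Unshelve. all: by end_near. Qed.

Lemma flow_dot_continuous w (t : R) : is_L2 I w -> 0 < t ->
  {for t, continuous (fun r => L2dot I (v r) w)}.
Proof.
move=> hw t0; have cv := flow_sqrt_cvg (ltW t0); rewrite within_ge0_nbhs// in cv.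
have cv' : Num.sqrt (L2sq I (v r - v t)) * Num.sqrt (L2sq I w) @[r --> t] --> (0 : R).
  by rewrite -(mul0r (Num.sqrt (L2sq I w))); apply: cvgMl.
apply/cvgrPdist_le => e e0.
have he := @cvgr0_norm_le _ _ _ _ _ _ cv' _ e0.
have tp : \forall x \near t, 0 < x by exact: lt_nbhsr.
near=> r; have r0 : 0 < r by near: r.
have hr := vL2 (ltW r0); have ht := vL2 (ltW t0).
rewrite distrC -L2dotBl// (le_trans (L2dot_le mI (is_L2B mI hr ht) hw))//.
have : `|Num.sqrt (L2sq I (v r - v t)) * Num.sqrt (L2sq I w)| <= e by near: r; exact: he.
by rewrite ger0_norm// mulr_ge0// sqrtr_ge0.
Unshelve. all: by end_near. Qed.

(** Pairing with a fixed w reduces the claim to the scalar [weak_ftc]. One null set A serves for all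
    s, t and w, and also absorbs the almost-everywhere property Q, later the subdifferential
    inclusion. Multiplying by the indicator of its complement makes the pairings measurable on all
    positive times. *)
Lemma flow_ftc (Q : R -> Prop) : {ae mu, forall t, Q t} ->
  exists A : set R, [/\ measurable (A : set (measurableTypeR R)), mu A = 0%E,
    forall t, ~ A t -> Q t,
    forall t, ~ A t -> 0 < t -> is_L2 I (g t) &
    forall s t, 0 < s -> s < t ->
      mu.-integrable `]s, t] (EFin \o (fun r => \1_(~` A) r * L2sq I (g r))) /\
      forall w, is_L2 I w ->
        mu.-integrable `]s, t] (EFin \o (fun r => \1_(~` A) r * L2dot I (g r) w)) /\
        L2dot I (v t - v s) w = \int[mu]_(r in `]s, t]) (\1_(~` A) r * L2dot I (g r) w)].
Proof.
move=> hQ; have [_ [[gL2 [sg sgcv]] gloc] hweak] := vg.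
have [A [mA A0 hA]] : exists A : set R, [/\ measurable (A : set (measurableTypeR R)), mu A = 0%E &
    forall t, ~ A t -> Q t /\ ((J t -> is_L2 I (g t)) /\
      (J t -> L2norm I (g t - simple_fun (sg k) t) @[k --> \oo] --> 0%E))].
  by apply: ae_null_cover; apply: ae_conj => //; exact: ae_conj.
have Jt t : 0 < t -> J t by move=> t0; rewrite /= in_itv/= t0.
have m1 : measurable_fun J (\1_(~` A) : R -> R) by apply: measurable_indic; exact: measurableC.
have scv t : ~ A t -> J t -> L2norm I (simple_fun (sg k) t - g t) @[k --> \oo] --> 0%E.
  move=> nA Jt'; have [_ [gt scv]] := hA t nA.
  rewrite (_ : (fun _ => _) = (fun k => L2norm I (g t - simple_fun (sg k) t))); first exact: scv.
  by apply: funext => k; rewrite L2normBC.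
exists A; split => //.
- by move=> t /hA[].
- by move=> t nA t0; have [_ [+ _]] := hA t nA; apply; exact: Jt.
move=> s t s0 st.
have st_sub : `[s, t + 1]%classic `<=` J.
  by move=> x; rewrite /= !in_itv/= => /andP[sx _]; rewrite (lt_le_trans s0).
(* Measurability is inherited from the simple functions approximating g, which converge in L^2 at
   every positive time outside A. *)
have mGa : measurable_fun J (fun r => \1_(~` A) r * L2sq I (g r)).
  apply: (@measurable_fun_cvg _ _ _ _ (fun k r => \1_(~` A) r * L2sq I (simple_fun (sg k) r))).
    move=> k; apply: measurable_funM => //.
    apply: (eq_measurable_fun (fun r => \sum_i \1_(simple_set (l:=sg k) i) r *
       (\sum_j \1_(simple_set (l:=sg k) j) r * L2dot I (simple_coef (l:=sg k) j) (simple_coef (l:=sg k) i)))).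
      move=> r _; rewrite /L2sq simple_dotE//; last exact: simple_fun_L2.
      apply: eq_bigr => i _; rewrite L2dotC simple_dotE//; exact: simple_L2.
    apply: measurable_sum => i; apply: measurable_funM.
      by apply: measurable_indic; exact: simple_measurable.
    apply: measurable_sum => j; apply: measurable_funM => //.
    by apply: measurable_indic; exact: simple_measurable.
  move=> r Jr; rewrite indicE; case: (boolP (r \in ~` A)) => rA; last first.
    by rewrite mul0r; under eq_fun do rewrite mul0r; exact: cvg_cst.
  apply: cvgMr; have nA : ~ A r by rewrite inE in rA.
  apply: L2norm_cvg_sq => //; first by move=> k; exact: simple_fun_L2.
    by have [_ [h _]] := hA r nA; exact: h.
  exact: scv.
have mga w : is_L2 I w -> measurable_fun J (fun r => \1_(~` A) r * L2dot I (g r) w).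
  move=> hw.
  apply: (@measurable_fun_cvg _ _ _ _ (fun k r => \1_(~` A) r * L2dot I (simple_fun (sg k) r) w)).
    move=> k; apply: measurable_funM => //.
    exact: integrable_Rmeasurable (simple_dot_integrable mI mJ (sg k) hw).
  move=> r Jr; rewrite indicE; case: (boolP (r \in ~` A)) => rA; last first.
    by rewrite mul0r; under eq_fun do rewrite mul0r; exact: cvg_cst.
  apply: cvgMr; have nA : ~ A r by rewrite inE in rA.
  apply: L2norm_cvg_dot => //; first by move=> k; exact: simple_fun_L2.
    by have [_ [h _]] := hA r nA; exact: h.
  exact: scv.
(* The extra unit beyond t is the room to the right that [weak_ftc] requires. *)
set K := `[s, t + 1]%classic.
have mK : measurable (K : set (measurableTypeR R)) by exact: measurable_itv.
have iGa : mu.-integrable K (EFin \o (fun r => \1_(~` A) r * L2sq I (g r))).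
  apply: ge0_integrable => //.
  - exact: (measurable_funS mJ st_sub mGa).
  - by move=> r _; rewrite mulr_ge0 ?L2sq_ge0// indicE.
  apply: le_lt_trans (gloc K (@segment_compact _ _ _) st_sub).
  apply: ge0_le_integralW => r Kr.
    by rewrite lee_fin mulr_ge0 ?L2sq_ge0// indicE.
  rewrite indicE; case: (boolP (r \in ~` A)) => rA; last first.
    by rewrite mul0r expe2 mule_ge0// Lnorm_ge0.
  have [_ [h _]] := hA r (set_mem rA).
  rewrite mul1r L2norm_fin//; last by apply: h; exact: st_sub.
  by rewrite -EFin_expe lee_fin sqr_sqrtr// L2sq_ge0.
have subK : `]s, t]%classic `<=` K.
  by move=> x; rewrite /K /= !in_itv/= => /andP[sx xt]; rewrite (ltW sx) (le_trans xt)// lerDl.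
split; first exact: (integrable_sub_itv subK iGa).
move=> w hw.
have iga : mu.-integrable K (EFin \o (fun r => \1_(~` A) r * L2dot I (g r) w)).
  have icst : mu.-integrable K (EFin \o cst (L2sq I w)) by exact: integrable_itv_cst.
  apply: (integrable_Rle mK _ _ (integrable_RD mK iGa icst)).
    exact: (measurable_funS mJ st_sub (mga w hw)).
  move=> r Kr; rewrite indicE; case: (boolP (r \in ~` A)) => rA; last first.
    by rewrite !mul0r normr0 add0r L2sq_ge0.
  have [_ [h _]] := hA r (set_mem rA).
  have hr := h (st_sub r Kr).
  rewrite !mul1r /= ler_norml.
  have := L2sq_ge0 I (g r - w); have := L2sq_ge0 I (g r + w).
  have := L2sq_ge0 I (g r); have := L2sq_ge0 I w.
  by rewrite L2sqB// L2sqD//; lra.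
split; first exact: (integrable_sub_itv subK iga).
rewrite L2dotBl//; [|exact: vL2 _ (ltW (lt_trans s0 st))|exact: vL2 _ (ltW s0)].
have tt1 : t < t + 1 by rewrite ltrDl.
apply: (@weak_ftc _ J (fun r => L2dot I (v r) w) _ _ _ _ _ _ (ltW st) tt1 st_sub iga).
  by move=> r; rewrite /= in_itv/= andbT => r0; exact: flow_dot_continuous.
move=> psi tpsi; have [y [by1 by2]] := hweak psi tpsi.
have spsi := test_fun_is_smooth tpsi.
have cpsi := smooth_continuous spsi.
have cpsi' := smooth_continuous (smooth_derive1 spsi).
have hy : is_L2 I y by case: by1.
rewrite (bochner_pairing mI mJ by1 hw); last 2 first.
- apply: measurable_funM.
    by apply: measurable_funTS; exact: continuous_measurable_fun.
  apply: open_continuous_measurable_fun; first exact: interval_open.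
  move=> r; rewrite inE/= in_itv/= andbT => r0; exact: flow_dot_continuous.
- apply: aeW => r; rewrite /= in_itv/= andbT => r0.
  by rewrite L2dotZl//; apply: vL2; exact: ltW.
rewrite (bochner_pairing mI mJ by2 hw).
- by rewrite L2dotNl// opprK.
- apply: measurable_funM; last exact: mga.
  by apply: measurable_funTS; exact: continuous_measurable_fun.
- apply: (ae_mono (null_ae mA A0)) => r nA Jr.
  have [_ [h _]] := hA r nA.
  by rewrite indicE mem_set// mul1r L2dotZl//; exact: h.
Qed.

End flow.

(** * Decay of the penalised distance *)

Section telescoping.
Context {R : realType}.

(* Summed over a subdivision of mesh d, the bound becomes C d (F t - F s). *)
Lemma nonincreasing_of_quadratic_increments (H F : R -> R) (C s t : R) :
  s < t ->
  (forall x y, s <= x -> x < y -> y <= t -> H y - H x <= C * (y - x) * (F y - F x)) ->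
  H t <= H s.
Proof.
move=> st hH.
have key M : (0 < M)%N -> H t - H s <= C * ((t - s) / M%:R) * (F t - F s).
  move=> M0; have Mp : 0 < M%:R :> R by rewrite ltr0n.
  pose x j := s + j%:R * ((t - s) / M%:R).
  have x0 : x 0%N = s by rewrite /x mul0r addr0.
  have xM : x M = t by rewrite /x mulrC divfK ?gt_eqF// subrKC.
  have dx j : x j.+1 - x j = (t - s) / M%:R by rewrite /x -natr1; ring.
  have d0 : 0 < (t - s) / M%:R by rewrite divr_gt0// subr_gt0.
  have -> : H t - H s = \sum_(0 <= j < M) (H (x j.+1) - H (x j)).
    by rewrite (telescope_sumr (fun j => H (x j)))// xM x0.
  have -> : F t - F s = \sum_(0 <= j < M) (F (x j.+1) - F (x j)).
    by rewrite (telescope_sumr (fun j => F (x j)))// xM x0.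
  rewrite mulr_sumr big_nat [leRHS]big_nat; apply: ler_sum => j /andP[_ jM].
  have mono i k : (i <= k)%N -> x i <= x k by move=> ik; rewrite lerD2l ler_pM2r// ler_nat.
  rewrite -(dx j); apply: hH.
  - by rewrite -x0 mono.
  - by rewrite -subr_gt0 dx.
  - by rewrite -xM mono.
rewrite leNgt; apply/negP => Hst.
set D := C * (t - s) * (F t - F s).
have HD M : (0 < M)%N -> (H t - H s) * M%:R <= D.
  move=> M0; have Mp : 0 < M%:R :> R by rewrite ltr0n.
  rewrite -ler_pdivlMr// /D; have := key M M0.
  by rewrite (_ : C * _ * _ = C * (t - s) * (F t - F s) / M%:R); last by field; rewrite gt_eqF.
have Hp : 0 < H t - H s by rewrite subr_gt0.
have := truncnS_gt (D / (H t - H s)).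
by rewrite ltr_pdivrMr// mulrC ltNge HD.
Qed.

Lemma halve_young (k k' X Y Z : R) :
  2 * X <= k * Y + k' * Z -> X <= 2^-1 * k * Y + 2^-1 * k' * Z.
Proof. by move=> h; lra. Qed.

Lemma absorb_half (k X W B : R) : k * X <= B -> W <= 2^-1 * k * X + 2^-1 * W -> W <= B.
Proof. by move=> h1 h2; lra. Qed.

Lemma double_chain (X Y B : R) : X <= Y -> Y <= B -> 2 * X + 2 * Y <= 4 * B.
Proof. by move=> h1 h2; lra. Qed.

Lemma cross_bound (X X' k Y Z G : R) : X' <= 0 -> Z <= 4 * G ->
  2 * (X - X') <= k * Y + Z -> X <= 2^-1 * k * Y + 2 * G.
Proof. by move=> h1 h2 h3; lra. Qed.

Lemma step_bound (A B X Y k G : R) : X <= k * G * (5 / 2) -> Y <= k * G ->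
  A <= B + 2 * X + Y -> A - B <= 6 * k * G.
Proof. by move=> h1 h2 h3; lra. Qed.

End telescoping.

Section energy_decay.
Context {R : realType} {n : nat}.
Variables (a b : R) (N : nat).
Hypotheses (ab : a < b) (N0 : (0 < N)%N).
Local Notation mu := (@lebesgue_measure R).
Local Notation I := (`]a, b[%classic : set R).
Local Notation mesh := (mesh a b N).
Local Notation step := (step a b N).
Local Notation cell_mean := (cell_mean a b N).
Variable be : nat -> R.
Hypothesis be_ge0 : forall k, 0 <= be k.
Variable phi : 'rV[R]_n -> R.
Hypothesis aphi : anisotropy phi.

Let mI : measurable (I : set (measurableTypeR R)). Proof. exact: measurable_itv. Qed.
Let h0 : 0 < mesh. Proof. exact: mesh_gt0. Qed.

(** [step P] has no more energy than w, so the subgradient inequality for [- g] at w, tested with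
    [step P], leaves only the sign of the pairing. *)
Lemma subdiff_resolvent (w g : R -> 'rV[R]_n) (P : nat -> 'rV[R]_n) :
  subdiff I phi w (- g) -> is_L2 I g -> resolves N be P (cell_mean w) ->
  L2dot I g (w - step P) <= 0.
Proof.
move=> [wL2 _ wfin sub] gL2 res.
have phi0 : forall p, 0 <= phi p by case: aphi.
have sl := anisotropy_sublinear aphi.
(* One subgradient per edge, taken at the jump of P. The same family is used against the cell means
   of w in the lower bound [h3], so that the two bounds chain up. *)
have [zeta hz] : exists zeta : nat -> 'rV[R]_n, forall k,
    dotp (zeta k) (incr P k) = phi (incr P k) /\ forall q, dotp (zeta k) q <= phi q.
  have ex k := cid (sublinear_subgradient (incr P k) sl).
  by exists (fun k => projT1 (ex k)) => k; exact: (projT2 (ex k)).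
have hP := @step_L2 _ _ a b N P.
have h1 := relaxed_step_le ab N0 P phi0 sl.
have h2 := resolves_energy be_ge0 N0 res phi0 sl (fun k => (hz k).1) (fun k => (hz k).2).
have h3 := relaxed_ge_means ab N0 phi0 (fun k => (hz k).2) wL2.
have := sub (step P) hP.
have wge0 : (0%:E <= relaxed I phi w)%E.
  apply: le_trans h3; rewrite lee_fin; apply: le_trans h2.
  by apply: sumr_ge0 => k _.
have wf : relaxed I phi w \is a fin_num by rewrite ge0_fin_numE.
have le1 : (relaxed I phi (step P) <= relaxed I phi w)%E.
  by apply: (le_trans h1); apply: le_trans h3; rewrite lee_fin.
move=> /le_trans /(_ le1); rewrite -{1}(fineK wf) -EFinD -(fineK wf) lee_fin.
rewrite L2dotNl//; last exact: is_L2B.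
rewrite !L2dotBr//; lra.
Qed.

(** The factor [mesh] on the penalty is the weight of a cell in the L^2 distance. It is common to
    both terms of the discrete problem, so the minimiser solves [resolves] with the same [be]. *)
Definition penalized (w : R -> 'rV[R]_n) (P : nat -> 'rV[R]_n) : R :=
  L2sq I (w - step P) + mesh * \sum_(1 <= k < N) be k * enorm (incr P k) ^+ 2.

(** By Pythagoras the part of w orthogonal to the cellwise constants does not depend on P; what
    remains is the discrete minimisation. *)
Lemma penalized_min w P P' : is_L2 I w -> resolves N be P (cell_mean w) ->
  penalized w P <= penalized w P'.
Proof.
move=> hw res; rewrite /penalized (L2sq_sub_step ab N0 P hw) (L2sq_sub_step ab N0 P' hw) -!addrA lerD2l -!mulrDr.
by rewrite ler_pM2l//; exact: resolves_min.
Qed.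

Lemma resolves_step_contraction (w w' : R -> 'rV[R]_n) (P P' : nat -> 'rV[R]_n) : is_L2 I w -> is_L2 I w' ->
  resolves N be P (cell_mean w) -> resolves N be P' (cell_mean w') ->
  L2sq I (step P - step P') <= L2sq I (w - w').
Proof.
move=> hw hw' res res'; rewrite stepB (L2sq_step ab N0).
have hB := is_L2B mI hw hw'.
apply: le_trans (cell_mean_le ab N0 hB); rewrite ler_pM2l//.
have := resolves_contraction be_ge0 N0 res res'; move=> /le_trans; apply.
rewrite big_nat [leRHS]big_nat; apply: ler_sum => i /andP[_ iN].
by rewrite (cell_meanB ab N0).
Qed.

Variables (v0 : R -> 'rV[R]_n) (v : R -> R -> 'rV[R]_n).
Hypothesis v0L2 : is_L2 I v0.
Hypothesis flow : gradient_flow I phi v0 v.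

Let vL2 t : 0 <= t -> is_L2 I (v t). Proof. by case: flow => h _ _ _; exact: h. Qed.

(** With q = v - step P, taking P s as competitor at time t bounds the increment by 2 <v t - v s, q
    s> + |v t - v s|^2. In <g r, q s> = <g r, q r> + <g r, q s - q r> the first term is nonpositive,
    and the second is small because q is Lipschitz in v. The increment is thus at most (t - s) times
    an integral of |g|^2, which sums to 0 over fine subdivisions. *)
Lemma penalized_decay (P : R -> nat -> 'rV[R]_n) :
  (forall t, 0 <= t -> resolves N be (P t) (cell_mean (v t))) ->
  forall s t, 0 < s -> s < t -> penalized (v t) (P t) <= penalized (v s) (P s).
Proof.
move=> res; have [_ vcont [g [vg hsub]] _] := flow.
have [A [mA A0 hQ hg hftc]] := flow_ftc vL2 vcont vg hsub.
pose ga r := \1_(~` A) r * L2sq I (g r).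
have key s t : 0 < s -> s < t -> penalized (v t) (P t) - penalized (v s) (P s) <=
    6 * (t - s) * \int[mu]_(r in `]s, t]) ga r.
  move=> s0 st; have t0 := lt_trans s0 st.
  have st0 : 0 < t - s by rewrite subr_gt0.
  have mst (x y : R) : measurable (`]x, y]%classic : set (measurableTypeR R)) by exact: measurable_itv.
  have leb (x y : R) : x < y -> fine (mu `]x, y]%classic) = y - x.
    by move=> xy; rewrite lebesgue_measure_itv/= lte_fin xy.
  set G := \int[mu]_(r in `]s, t]) ga r.
  have [iga hst] := hftc s t s0 st.
  have ga0 r : 0 <= ga r by rewrite /ga mulr_ge0 ?L2sq_ge0// indicE.
  have hvs := vL2 (ltW s0); have hvt := vL2 (ltW t0).
  have icst c (x y : R) := integrable_itv_cst x y false false c.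
  (* v r - v s is paired with itself in the integrated equation; Young's inequality with weight r -
     s leaves half of the left side to be absorbed. *)
  have dist r : s < r -> r <= t -> L2sq I (v r - v s) <= (t - s) * G.
    move=> sr rt; have r0 := lt_trans s0 sr.
    have [igr hsr] := hftc s r s0 sr.
    have hw : is_L2 I (v r - v s) by apply: is_L2B => //; exact: vL2 (ltW r0).
    have [iw ew] := hsr _ hw.
    have {ew} : L2sq I (v r - v s) = _ := ew.
    move: (v r - v s) hw iw => w hw iw ew.
    have GG : \int[mu]_(x in `]s, r]) ga x <= G.
      rewrite /G -[leRHS]addr0 -(subrr (\int[mu]_(x in `]s, r]) ga x)) addrCA lerDl.
      rewrite (Rintegral_itvB iga) ?bnd_simp//; last exact: ltW.
      by apply: Rintegral_ge0 => x _; exact: ga0.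
    have G0 : 0 <= \int[mu]_(x in `]s, r]) ga x by apply: Rintegral_ge0 => x _; exact: ga0.
    have kst : r - s <= t - s by rewrite lerB.
    have k0 : 0 < r - s by rewrite subr_gt0.
    have lk := leb s r sr.
    move: (r - s) k0 kst lk => k k0 kst lk.
    have kk : 0 <= 2^-1 * k^-1 by rewrite mulr_ge0// invr_ge0 ltW.
    have ig2 := integrable_RZ (2^-1 * k) (mst s r) igr.
    have ic2 := icst (2^-1 * k^-1 * L2sq I w) s r.
    have : L2sq I w <= \int[mu]_(x in `]s, r]) (2^-1 * k * ga x + 2^-1 * k^-1 * L2sq I w).
      rewrite [leLHS]ew; apply: le_Rintegral => //; first exact: (integrable_RD (mst s r) ig2 ic2).
      move=> x; rewrite /= in_itv/= => /andP[sx _]; rewrite /ga indicE.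
      case: (boolP (x \in ~` A)) => xA; last first.
        by rewrite !mul0r mulr0 add0r mulr_ge0 ?L2sq_ge0.
      have hgx := hg x (set_mem xA) (lt_trans s0 sx).
      by rewrite !mul1r; apply: halve_young; exact: L2dot_le_young.
    rewrite (RintegralD (mst s r) ig2 ic2) (RintegralZl _ (mst s r) igr).
    rewrite (Rintegral_cst _ (mst s r)) lk.
    rewrite (_ : 2^-1 * k^-1 * L2sq I w * k = 2^-1 * L2sq I w); last first.
      by field; rewrite gt_eqF.
    by apply: absorb_half; rewrite ler_pM// ltW.
  pose q r := v r - step (P r).
  have hP r : is_L2 I (step (P r)) by exact: step_L2.
  have hq r : 0 <= r -> is_L2 I (q r) by move=> r0; apply: is_L2B => //; exact: vL2.
  (* The constant is 2 + 2: q differs by a change of v and a change of [step P], and the latter is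
     no larger than the former. *)
  have qdist r : s < r -> r <= t -> L2sq I (q s - q r) <= 4 * ((t - s) * G).
    move=> sr rt; have r0 := ltW (lt_trans s0 sr); have hvr := vL2 r0.
    have d1 := dist r sr rt.
    have d2 := resolves_step_contraction hvr hvs (res r r0) (res s (ltW s0)).
    have -> : q s - q r = (step (P r) - step (P s)) - (v r - v s).
      by rewrite /q; apply: funext => x; apply/rowP => j;
        rewrite ![in LHS]mxE ![in RHS]mxE; ring.
    have hx := is_L2B mI (hP r) (hP s); have hy := is_L2B mI hvr hvs.
    apply: (le_trans (L2sq_sub_le mI hx hy)).
    by apply: double_chain; [exact: d2|exact: d1].
  have [iq eq] := hst (q s) (hq s (ltW s0)).
  (* 5/2 is 1/2 + 2, the contributions of the two terms of the integrand below over an interval of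
     length t - s. *)
  have cross : L2dot I (v t - v s) (q s) <= (t - s) * G * (5 / 2).
    rewrite eq.
    apply: (@le_trans _ _ (\int[mu]_(r in `]s, t]) (2^-1 * (t - s) * ga r + 2 * G))).
      apply: le_Rintegral => //.
        apply: integrable_RD => //; first exact: integrable_RZ.
        exact: icst.
      have G0 : 0 <= G by apply: Rintegral_ge0 => x _; exact: ga0.
      move=> r; rewrite /= in_itv/= => /andP[sr rt]; rewrite /ga indicE.
      case: (boolP (r \in ~` A)) => rA; last first.
        by rewrite !mul0r mulr0 add0r mulr_ge0.
      rewrite !mul1r; have r0 := lt_trans s0 sr.
      have hgr := hg r (set_mem rA) r0.
      have n1 : L2dot I (g r) (q r) <= 0.
        exact: (subdiff_resolvent (hQ r (set_mem rA) r0) hgr (res r (ltW r0))).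
      have hqq := is_L2B mI (hq s (ltW s0)) (hq r (ltW r0)).
      have := L2dot_le_young mI st0 hgr hqq.
      rewrite L2dotBr//; [|exact: hq (ltW s0)|exact: hq (ltW r0)].
      have n2 : (t - s)^-1 * L2sq I (q s - q r) <= 4 * G.
        by rewrite ler_pdivrMl// mulrCA; exact: qdist.
      exact: cross_bound n1 n2.
    rewrite RintegralD//; [|exact: integrable_RZ|exact: icst].
    rewrite RintegralZl// Rintegral_cst// leb// -/G.
    by rewrite (_ : _ + _ = (t - s) * G * (5 / 2))//; field.
  have := penalized_min (P s) hvt (res t (ltW t0)).
  have -> : penalized (v t) (P s) = penalized (v s) (P s) + 2 * L2dot I (v t - v s) (q s) + L2sq I (v t - v s).
    rewrite /penalized (_ : v t - step (P s) = (v t - v s) + q s).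
      by rewrite L2sqD//; [rewrite -/(q s); ring|exact: is_L2B|exact: hq (ltW s0)].
    by rewrite /q addrA subrK.
  (* The constant 6 is twice 5/2, from the cross term, plus 1, from the squared distance. *)
  by apply: step_bound; [exact: cross|exact: dist].
move=> s t s0 st.
apply: (@nonincreasing_of_quadratic_increments _ (fun r => penalized (v r) (P r))
  (fun r => \int[mu]_(x in `]s, r]) ga x) 6) => // x y sx xy yt.
have x0 := lt_le_trans s0 sx.
have [iga _] := hftc s y s0 (le_lt_trans sx xy).
rewrite (Rintegral_itvB iga) ?bnd_simp//; last exact: ltW.
exact: key.
Qed.

(** The decay is available from positive times only. Continuity of v at 0 lets the starting time
    tend to 0, with the cell means of v0 as a fixed competitor. *)
Lemma key_estimate t : 0 < t -> exists P,
  penalized (v t) P <= penalized v0 (cell_mean v0).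
Proof.
move=> t0; have [_ vcont _ v0E] := flow.
pose P r := projT1 (cid (@resolves_exists _ n N be be_ge0 (cell_mean (v r)))).
have res r : resolves N be (P r) (cell_mean (v r)).
  exact: (projT2 (cid (@resolves_exists _ n N be be_ge0 (cell_mean (v r))))).
exists (P t); set P0 := cell_mean v0.
have hP0 : is_L2 I (step P0) by exact: step_L2.
have hv0 := vL2 (lexx 0).
(* v 0 and v0 agree only almost everywhere on I, which is all that the integral sees. *)
have -> : penalized v0 P0 = penalized (v 0) P0.
  rewrite /penalized; congr (_ + _).
  have [m _] := (is_L2P mI _).1 (is_L2B mI hv0 hP0).
  have [m' _] := (is_L2P mI _).1 (is_L2B mI v0L2 hP0).
  apply: ae_eq_Rintegral => //.
  - exact: measurable_dotp.
  - exact: measurable_dotp.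
  - apply: (ae_mono v0E) => x h Ix.
    suff -> : (v0 - step P0) x = (v 0 - step P0) x by [].
    by rewrite [LHS]/GRing.add/= [RHS]/GRing.add/= h.
apply/ler_addgt0Pr => e e0.
set q := v 0 - step P0; have hq : is_L2 I q by exact: is_L2B.
have cv := flow_sqrt_cvg vL2 vcont (lexx 0).
(* If |v s - v 0| <= d <= 1, then 2 |v s - v 0| |q| + |v s - v 0|^2 <= d M <= e. *)
pose M := 2 * Num.sqrt (L2sq I q) + 1.
have M0 : 0 < M by rewrite /M; have := sqrtr_ge0 (L2sq I q); lra.
pose d := Num.min 1 (e / M).
have d0 : 0 < d by rewrite lt_min ltr01 divr_gt0.
have [r /= r0 hr] := @cvgr0_norm_le _ _ _ _ _ _ cv _ d0.
pose s := Num.min r t / 2.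
have s0 : 0 < s by rewrite /s divr_gt0// lt_min r0.
have sr : s < r.
  by rewrite /s ltr_pdivrMr// gt_min; apply/orP; left; rewrite ltr_pMr// ltr1n.
have st : s < t.
  by rewrite /s ltr_pdivrMr// gt_min; apply/orP; right; rewrite ltr_pMr// ltr1n.
have hs : Num.sqrt (L2sq I (v s - v 0)) <= d.
  have := hr s; rewrite /ball_/= sub0r normrN gtr0_norm// => /(_ sr (ltW s0)).
  by rewrite ger0_norm// sqrtr_ge0.
have hvs := vL2 (ltW s0).
apply: (le_trans (penalized_decay (fun r _ => res r) s0 st)).
apply: (le_trans (penalized_min P0 hvs (res s))).
rewrite /penalized addrAC lerD2r (_ : v s - step P0 = (v s - v 0) + q); last first.
  by rewrite /q addrA subrK.
have hd := is_L2B mI hvs hv0.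
rewrite L2sqD// -[leRHS]addrC lerD2r.
have := L2dot_le mI hd hq; rewrite ler_norml => /andP[_ h1].
have d1 : d <= 1 by rewrite ge_min lexx.
have dM : d * M <= e.
  by rewrite -ler_pdivlMr// ge_min lexx orbT.
have h2 : L2sq I (v s - v 0) <= d.
  rewrite -[leLHS]sqr_sqrtr ?L2sq_ge0// expr2.
  have := sqrtr_ge0 (L2sq I (v s - v 0)); move: (Num.sqrt _) hs => x xd x0.
  by apply: (le_trans _ xd); rewrite ler_piMr// (le_trans xd).
have h3 : Num.sqrt (L2sq I (v s - v 0)) * Num.sqrt (L2sq I q) <= d * Num.sqrt (L2sq I q).
  by rewrite ler_wpM2r ?sqrtr_ge0.
have : d * M = 2 * (d * Num.sqrt (L2sq I q)) + d by rewrite /M; ring.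
have h4 := le_trans h1 h3; clear -h2 dM h4.
move=> h; rewrite h in dM; lra.
Qed.

End energy_decay.

(** * Total variation of vector measures *)

Section charge_integral_measures.
Context {R : realType}.
Local Notation mT := (measurableTypeR R).

(** Hides the chosen Hahn decomposition: all later use of a charge integral goes through two finite
    measures. *)
Lemma charge_integral_difference (nu : {charge set mT -> \bar R}) :
  exists jp jn : {finite_measure set mT -> \bar R},
    (forall A, measurable A -> nu A = (jp A - jn A)%E) /\
    forall D f, charge_integral nu D f =
      \int[jp]_(x in D) f x - \int[jn]_(x in D) f x.
Proof.
exists (jordan_pos (projT2 (cid (projT2 (cid (Hahn_decomposition nu)))))).
exists (jordan_neg (projT2 (cid (projT2 (cid (Hahn_decomposition nu)))))).
split=> // A mA.
rewrite [LHS](jordan_decomp (projT2 (cid (projT2 (cid (Hahn_decomposition nu)))))  mA).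
by rewrite /cadd/= cscaleN1.
Qed.

End charge_integral_measures.

Section total_variation.
Context {R : realType} {n : nat}.
Local Notation mT := (measurableTypeR R).
Variable nu : 'I_n -> {charge set mT -> \bar R}.
Local Notation nuV := (vec_measure nu).
Local Notation W := (vec_variation nu).

Lemma vec_measure_sum_cvg (F : nat -> set mT) i : (forall k, measurable (F k)) ->
  trivIset setT F ->
  (\sum_(0 <= k < N) nuV (F k)) 0 i @[N --> \oo] --> nuV (\bigcup_k F k) 0 i.
Proof.
move=> mF tF; rewrite mxE.
have mU : measurable (\bigcup_k F k) by exact: bigcupT_measurable.
have h := @charge_semi_sigma_additive _ _ _ (nu i) F mF tF mU.
have fU : nu i (\bigcup_k F k) \is a fin_num by exact: fin_num_measure.
rewrite -(fineK fU) in h; have {}h := @fine_cvg _ _ \oo eventually_filter _ _ h.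
apply: cvg_trans h; apply: near_eq_cvg; near=> N.
rewrite /comp/= summxE -sum_fine; first by apply: eq_bigr => k _; rewrite mxE.
by move=> k _; exact: fin_num_measure.
Unshelve. all: by end_near. Qed.

(** Countable additivity is known coordinate by coordinate, so partial sums are tested against a
    fixed vector e and the norm is recovered by duality. *)
Lemma enorm_vec_measure_bigcup (F : nat -> set mT) : (forall k, measurable (F k)) ->
  trivIset setT F ->
  ((enorm (nuV (\bigcup_k F k)))%:E <= \sum_(0 <= k <oo) (enorm (nuV (F k)))%:E)%E.
Proof.
move=> mF tF; set S := (\sum_(0 <= k <oo) _)%E.
have S0 : (0 <= S)%E by apply: nneseries_ge0 => k _ _; rewrite lee_fin enorm_ge0.
case: (eqVneq S +oo%E) => [->|Soo]; first by rewrite leey.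
have Sf : S \is a fin_num by rewrite ge0_fin_numE// ltey.
rewrite -(fineK Sf) lee_fin; apply: enorm_le_dual; first exact: fine_ge0.
move=> e.
have cv : dotp e (\sum_(0 <= k < N) nuV (F k)) @[N --> \oo] --> dotp e (nuV (\bigcup_k F k)).
  by apply: cvg_finsum => i; apply: cvgMr; exact: vec_measure_sum_cvg.
apply: (ler_cvg_to cv (cvg_cst _)).
near=> N; rewrite dotp_sumr.
apply: (@le_trans _ _ (\sum_(0 <= k < N) enorm e * enorm (nuV (F k)))).
  by apply: ler_sum => k _; exact: dotp_le.
rewrite -mulr_sumr mulrC ler_wpM2r ?enorm_ge0// -lee_fin fineK// -sumEFin.
by apply: nneseries_lim_ge => k _ _; rewrite lee_fin enorm_ge0.
Unshelve. all: by end_near. Qed.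

Lemma enorm_vec_measure_le E : measurable (E : set mT) -> ((enorm (nuV E))%:E <= W E)%E.
Proof.
move=> mE; pose A k : set R := if k == 0%N then E else set0.
apply: (@le_trans _ _ (\sum_(0 <= k <oo) (enorm (nuV (A k)))%:E)%E).
  apply: le_trans (@nneseries_lim_ge _ _ xpredT _ 1%N _).
    by rewrite big_nat1.
  by move=> k _ _; rewrite lee_fin enorm_ge0.
apply: ereal_sup_ubound; exists A => //; split.
- by move=> [|k]//; exact: measurable0.
- by move=> [|i] [|j] _ _ //= [x []].
- apply/seteqP; split=> [x [[|k] _]//|x Ex]; by exists 0%N.
Qed.

Lemma vec_variation_ge0 E : measurable (E : set mT) -> (0 <= W E)%E.
Proof. by move=> mE; apply: le_trans (enorm_vec_measure_le mE); rewrite lee_fin enorm_ge0. Qed.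

(** Every partition sum is at most the total mass on E of the positive and negative parts of all
    coordinates. *)
Lemma vec_variation_fin E : measurable (E : set mT) -> W E \is a fin_num.
Proof.
move=> mE; rewrite ge0_fin_numE ?vec_variation_ge0//.
have /choice[jp /choice[jn h]] i := charge_integral_difference (nu i).
apply: (@le_lt_trans _ _ (\sum_(i < n) (jp i E + jn i E))%E); last first.
  by apply: lte_sum_pinfty => i _; apply: lte_add_pinfty; rewrite ltey_eq fin_num_measure//.
apply: ge_ereal_sup => _ [A [mA tA AE] <-].
apply: (@le_trans _ _ (\sum_(0 <= k <oo) \sum_(i < n) (jp i (A k) + jn i (A k)))%E).
  apply: lee_nneseries => [k _ _|k _]; first by rewrite lee_fin enorm_ge0.
  have fp i : jp i (A k) \is a fin_num by apply: fin_num_measure; exact: mA.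
  have fn i : jn i (A k) \is a fin_num by apply: fin_num_measure; exact: mA.
  apply: (@le_trans _ _ (\sum_(i < n) `|nuV (A k) 0 i|)%:E).
    by rewrite lee_fin enorm_le_sum.
  rewrite -sumEFin; apply: lee_sum => i _; rewrite mxE ((h i).1 _ (mA k)).
  rewrite -(fineK (fp i)) -(fineK (fn i)) -EFinB -EFinD lee_fin /=.
  apply: (le_trans (ler_normB _ _)); rewrite !ger0_norm// fine_ge0//.
rewrite nneseries_sum; last by move=> i k _; rewrite adde_ge0.
apply: lee_sum => i _; have e (rho : {finite_measure set mT -> \bar R}) :
    rho E = (\sum_(0 <= k <oo) rho (A k))%E.
  rewrite -AE; apply/esym/cvg_lim => //; apply: measure_semi_sigma_additive => //.
  exact: bigcupT_measurable.
by rewrite nneseriesD// -!e.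
Qed.

(** A partition of A and one of B are interleaved, at even and odd indices, into a partition of the
    union. *)
Lemma vec_variation_superadditive A B : measurable (A : set mT) -> measurable (B : set mT) ->
  A `&` B = set0 -> (W A + W B <= W (A `|` B))%E.
Proof.
move=> mA mB AB.
have main (P Q : nat -> set R) : (forall k, measurable (P k : set mT)) -> trivIset setT P ->
    \bigcup_k P k = A -> (forall k, measurable (Q k : set mT)) -> trivIset setT Q ->
    \bigcup_k Q k = B ->
    (\sum_(0 <= k <oo) (enorm (nuV (P k)))%:E + \sum_(0 <= k <oo) (enorm (nuV (Q k)))%:E
       <= W (A `|` B))%E.
  move=> mP tP PA mQ tQ QB; have e0 E : (0 <= (enorm (nuV E))%:E)%E by rewrite lee_fin enorm_ge0.
  rewrite -nneseriesD//.
  pose C k := if odd k then Q k./2 else P k./2.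
  apply: (@le_trans _ _ (\sum_(0 <= k <oo) (enorm (nuV (C k)))%:E)%E); last first.
    apply: ereal_sup_ubound; exists C => //; split.
    - by move=> k; rewrite /C; case: ifP => _; [exact: mQ|exact: mP].
    - move=> i j _ _ [x []]; rewrite /C; case: ifP => oi; case: ifP => oj Cix Cjx.
      + have e : i./2 = j./2 by apply: tQ => //; exists x.
        by rewrite -(odd_double_half i) -(odd_double_half j) e oi oj.
      + have : (A `&` B) x by split; [rewrite -PA; exists j./2|rewrite -QB; exists i./2].
        by rewrite AB.
      + have : (A `&` B) x by split; [rewrite -PA; exists i./2|rewrite -QB; exists j./2].
        by rewrite AB.
      + have e : i./2 = j./2 by apply: tP => //; exists x.
        by rewrite -(odd_double_half i) -(odd_double_half j) e oi oj.
    - apply/seteqP; split=> x.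
        by move=> [k _]; rewrite /C; case: ifP => _ ?; [right; rewrite -QB|left; rewrite -PA];
          exists k./2.
      move=> [|]; [rewrite -PA|rewrite -QB] => -[k _ h].
        by exists k.*2 => //; rewrite /C odd_double doubleK.
      by exists k.*2.+1 => //; rewrite /C /= odd_double /= uphalf_double.
  apply: lime_le; first by apply: is_cvg_nneseries => k _ _; exact: adde_ge0.
  near=> N.
  have -> : (\sum_(0 <= k < N) ((enorm (nuV (P k)))%:E + (enorm (nuV (Q k)))%:E) =
      \sum_(0 <= k < N.*2) (enorm (nuV (C k)))%:E)%E.
    elim: (N) => [|K ih]; first by rewrite !big_geq.
    rewrite doubleS !big_nat_recr//= ih -addeA /C/= odd_double/= doubleK.
    by rewrite uphalf_double.
  exact: nneseries_lim_ge.
(* Finiteness allows terms to be moved across the inequality, so that the two suprema are taken one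
   after the other. *)
have fA := vec_variation_fin mA; have fB := vec_variation_fin mB.
have fAB : W (A `|` B) \is a fin_num by apply: vec_variation_fin; exact: measurableU.
rewrite -leeBrDr//; apply: ge_ereal_sup => _ [P [mP tP PA] <-].
rewrite leeBrDr// addeC.
have sf : (\sum_(0 <= k <oo) (enorm (nuV (P k)))%:E)%E \is a fin_num.
  rewrite ge0_fin_numE; last by apply: nneseries_ge0 => k _ _; rewrite lee_fin enorm_ge0.
  apply: (@le_lt_trans _ _ (W A)); last by rewrite ltey_eq fA.
  by apply: ereal_sup_ubound; exists P.
rewrite -leeBrDr//; apply: ge_ereal_sup => _ [Q [mQ tQ QB] <-].
by rewrite leeBrDr// addeC; exact: main.
Unshelve. all: by end_near. Qed.

Lemma vec_variation_le A B : measurable (A : set mT) -> measurable (B : set mT) ->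
  A `<=` B -> (W A <= W B)%E.
Proof.
move=> mA mB AB; have mD : measurable (B `\` A : set mT) by exact: measurableD.
rewrite -[in leRHS](setDUK AB); apply: le_trans (vec_variation_superadditive mA mD _).
  by rewrite leeDl// vec_variation_ge0.
by rewrite setDIK.
Qed.

(** For one inequality each piece of a partition is cut along the F_j and the double sum exchanged;
    for the other, superadditivity handles finite unions and monotonicity the limit. *)
Lemma vec_variation_bigcup (F : nat -> set mT) : (forall k, measurable (F k)) ->
  trivIset setT F -> W (\bigcup_k F k) = (\sum_(0 <= k <oo) W (F k))%E.
Proof.
move=> mF tF; apply/eqP; rewrite eq_le; apply/andP; split.
  apply: ge_ereal_sup => _ [A [mA tA AF] <-].
  apply: (@le_trans _ _ (\sum_(0 <= k <oo) \sum_(0 <= j <oo)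
      (enorm (nuV (A k `&` F j)))%:E)%E).
    apply: lee_nneseries => [k _ _|k _]; first by rewrite lee_fin enorm_ge0.
    have -> : A k = \bigcup_j (A k `&` F j).
      by rewrite -setI_bigcupr -AF; apply/esym/setIidl => x Ax; exists k.
    apply: (le_trans (enorm_vec_measure_bigcup _ _)).
    - by move=> j; apply: measurableI; [exact: mA|exact: mF].
    - by apply: trivIset_setIl.
    - by rewrite -setI_bigcupr -AF setIidl//; move=> x Ax; exists k.
  rewrite nneseries_interchange; last by move=> *; rewrite lee_fin enorm_ge0.
  apply: lee_nneseries => [j _ _|j _].
    by apply: nneseries_ge0 => k _ _; rewrite lee_fin enorm_ge0.
  apply: ereal_sup_ubound; exists (fun k => A k `&` F j) => //; split.
  - by move=> k; apply: measurableI; [exact: mA|exact: mF].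
  - exact: trivIset_setIr.
  - by rewrite -setI_bigcupl AF setIidr//; move=> x Fx; exists j.
apply: lime_le; first by apply: is_cvg_nneseries => k _ _; exact: vec_variation_ge0.
near=> N; apply: (@le_trans _ _ (W (\big[setU/set0]_(0 <= k < N) F k))); last first.
  apply: vec_variation_le; first exact: bigsetU_measurable.
    exact: bigcupT_measurable.
  by rewrite big_mkord; exact: bigsetU_bigcup.
elim: (N) => [|K ih]; first by rewrite !big_geq// vec_variation_ge0.
rewrite !big_nat_recr//=.
have mU : measurable (\big[setU/set0]_(0 <= k < K) F k) by exact: bigsetU_measurable.
apply: le_trans (vec_variation_superadditive mU (mF K) _); first exact: leeD2r.
rewrite big_mkord -subset0 => x [].
rewrite -bigcup_mkord => -[k /= kK Fk] FK.
have e : k = K by apply: tF => //; exists x.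
by rewrite e ltnn in kK.
Unshelve. all: by end_near. Qed.

(* Total on all sets, as the measure structure requires; the supremum defining
   the variation is over the empty set when E is not Borel. *)
Definition variation_measure (E : set mT) : \bar R :=
  if `[< measurable E >] then W E else 0%E.

Lemma variation_measureE E : measurable E -> variation_measure E = W E.
Proof. by move=> mE; rewrite /variation_measure asboolT. Qed.

Let variation0 : variation_measure set0 = 0%E.
Proof.
rewrite variation_measureE//; have := @vec_variation_bigcup (fun=> set0) (fun=> measurable0).
rewrite bigcup0// => /(_ (@trivIset_set0 _ _ _)) h; apply/eqP; rewrite eq_le vec_variation_ge0// andbT.
(* Superadditivity bounds twice the variation of the empty set by itself, and this variation is
   finite. *)
have := vec_variation_superadditive (@measurable0 _ mT) (@measurable0 _ mT) (set0I set0).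
rewrite setU0; have := vec_variation_fin (@measurable0 _ mT).
by move: (W set0) => [w| |]//= _; rewrite -EFinD !lee_fin gerDl.
Qed.

Let variation_ge0 E : (0 <= variation_measure E)%E.
Proof. by rewrite /variation_measure; case: asboolP => // mE; exact: vec_variation_ge0. Qed.

Let variation_semi_sigma_additive : semi_sigma_additive variation_measure.
Proof.
move=> F mF tF mU; rewrite variation_measureE// vec_variation_bigcup//.
have -> : (fun N => (\sum_(0 <= k < N) variation_measure (F k))%E) =
    (fun N => (\sum_(0 <= k < N) W (F k))%E).
  by apply: funext => N; apply: eq_bigr => k _; rewrite variation_measureE.
by apply: is_cvg_nneseries => k _ _; exact: vec_variation_ge0.
Qed.

HB.instance Definition _ := isMeasure.Build _ _ _ variation_measure
  variation0 variation_ge0 variation_semi_sigma_additive.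

Let variation_fin : fin_num_fun variation_measure.
Proof. by move=> E mE; rewrite variation_measureE// vec_variation_fin. Qed.

HB.instance Definition _ := @Measure_isFinite.Build _ _ _ variation_measure variation_fin.

End total_variation.

(** * Simple approximation and integrals against charges *)

Section finite_measure_integrals.
Context {R : realType}.
Local Notation mT := (measurableTypeR R).
Implicit Type rho : {finite_measure set mT -> \bar R}.

Lemma bounded_integrable rho (U : set mT) (f : R -> R) M : measurable U ->
  measurable_fun U f -> (forall x, U x -> `|f x| <= M) ->
  rho.-integrable U (EFin \o f).
Proof.
move=> mU mf fM; apply: (integrable_Rle mU mf fM).
exact: finite_measure_integrable_cst.
Qed.

Lemma Rintegral_simple rho (U : set mT) K (c : nat -> R) (E : nat -> set mT) :
  measurable U -> (forall j, measurable (E j)) -> (forall j, E j `<=` U) ->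
  \int[rho]_(x in U) (\sum_(0 <= j < K) c j * \1_(E j) x) =
  \sum_(0 <= j < K) c j * fine (rho (E j)).
Proof.
move=> mU mE EU.
have i1 j : rho.-integrable U (EFin \o (\1_(E j) : R -> R)).
  apply: (@bounded_integrable _ _ _ 1) => // x _; rewrite indicE ger0_norm ?ler0n//.
  by case: (_ \in _).
rewrite Rintegral_sum//; last by move=> j; exact: integrable_RZ.
apply: eq_bigr => j _; rewrite RintegralZl//; congr (_ * _).
by rewrite /Rintegral integral_indic// setIidl.
Qed.

(** The range of f is cut into bands of width e. The last clause controls the absolute values of the
    coefficients, as the comparison with an integral of |f| requires. *)
Lemma level_approx (U : set mT) (f : R -> R) M e : measurable U ->
  measurable_fun U f -> (forall x, U x -> `|f x| <= M) -> 0 < e ->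
  exists K (c : nat -> R) (E : nat -> set mT),
    [/\ forall j, measurable (E j), forall j, E j `<=` U,
      forall x, U x -> `|f x - \sum_(0 <= j < K) c j * \1_(E j) x| <= e &
      forall x, U x -> \sum_(0 <= j < K) `|c j| * \1_(E j) x <= `|f x| + e].
Proof.
move=> mU mf fM e0.
(* K exceeds |M| / e, so g takes its values in [0, 2 K) and its integer part is the index of the
   band. *)
pose K := (Num.truncn (`|M| / e)).+1; pose g x := f x / e + K%:R.
have MK : `|M| < K%:R * e by rewrite -ltr_pdivrMr//; exact: truncnS_gt.
have mg : measurable_fun U g.
  by apply: measurable_funD => //; apply: measurable_funM.
pose E j : set mT := U `&` g @^-1` `[j%:R, j.+1%:R[.
exists (K + K)%N, (fun j => (j%:R - K%:R) * e), E.
have gK x : U x -> 0 <= g x < (K + K)%:R.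
  move=> Ux; have := fM x Ux; have := ler_norm M; rewrite ler_norml /g => h1 /andP[h2 h3].
  have h4 : - K%:R <= f x / e by rewrite lerNl -mulNr ler_pdivrMr//; lra.
  have h5 : f x / e < K%:R by rewrite ltr_pdivrMr//; lra.
  by rewrite natrD; apply/andP; split; lra.
have sumE (c : nat -> R) x : U x -> exists2 i, i%:R <= g x < i.+1%:R &
    \sum_(0 <= j < K + K) c j * \1_(E j) x = c i.
  move=> Ux; have /andP[g0 g2] := gK x Ux.
  have /andP[h1 h2] := truncn_itv g0; exists (Num.truncn (g x)); first by rewrite h1.
  have tK : (Num.truncn (g x) < K + K)%N by rewrite -(ltr_nat R) (le_lt_trans h1).
  rewrite (bigD1_seq (Num.truncn (g x))) ?mem_index_iota ?iota_uniq//= indicE mem_set ?mulr1; last first.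
    by split => //; rewrite /= in_itv/= h1.
  rewrite big1 ?addr0// => j jt; rewrite indicE memNset ?mulr0// => -[_] /=.
  rewrite in_itv/= => /andP[h3 h4]; move/eqP: jt; apply; apply/eqP.
  rewrite eqn_leq; apply/andP; split; rewrite -ltnS -(ltr_nat R).
    exact: le_lt_trans h3 h2.
  exact: le_lt_trans h1 h4.
have near x i : i%:R <= g x < i.+1%:R -> `|f x - (i%:R - K%:R) * e| <= e.
  move=> /andP[h1 h2]; have -> : f x = (g x - K%:R) * e by rewrite /g addrK divfK// gt_eqF.
  rewrite -mulrBl normrM (gtr0_norm e0) ger_pMl// ler_norml.
  by rewrite -natr1 in h2; apply/andP; split; lra.
split.
- by move=> j; apply: mg => //; exact: measurable_itv.
- by move=> j x [].
- by move=> x Ux; have [i ig ->] := sumE (fun j => (j%:R - K%:R) * e) x Ux; exact: near.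
- move=> x Ux; have [i ig ->] := sumE (fun j => `|(j%:R - K%:R) * e|) x Ux.
  have := near x i ig; rewrite -lerBlDl => h; apply: le_trans h.
  by rewrite distrC; exact: lerB_dist.
Qed.

(** C is the mass of U under the two measures whose difference is nu. It is fixed before f, e and
    the approximant, so that e may tend to 0. *)
Lemma charge_integral_simple (nu : {charge set mT -> \bar R}) (U : set mT) : measurable U ->
  exists2 C : R, 0 <= C & forall (f : R -> R) M e K c (E : nat -> set mT),
    measurable_fun U f -> (forall x, U x -> `|f x| <= M) ->
    (forall j, measurable (E j)) -> (forall j, E j `<=` U) ->
    (forall x, U x -> `|f x - \sum_(0 <= j < K) c j * \1_(E j) x| <= e) ->
    `|charge_integral nu U f - \sum_(0 <= j < K) c j * fine (nu (E j))| <= e * C.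
Proof.
move=> mU; have [jp [jn [nuE intE]]] := charge_integral_difference nu.
exists (fine (jp U) + fine (jn U)); first by rewrite addr_ge0// fine_ge0.
move=> f M e K c E mf fM mE EU fe.
pose s x := \sum_(0 <= j < K) c j * \1_(E j) x.
have ms : measurable_fun U s.
  by apply: measurable_sum => j; apply: measurable_funM => //; exact: measurable_indic.
have bs x : U x -> `|s x| <= M + e.
  move=> Ux; have := fe x Ux; have := fM x Ux; rewrite -/(s x) !ler_norml.
  by move=> /andP[? ?] /andP[? ?]; apply/andP; split; lra.
have est (rho : {finite_measure set mT -> \bar R}) :
    `|\int[rho]_(x in U) f x - \sum_(0 <= j < K) c j * fine (rho (E j))| <= e * fine (rho U).
  have intf := @bounded_integrable rho U f M mU mf fM.
  have ints := @bounded_integrable rho U s (M + e) mU ms bs.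
  rewrite -(@Rintegral_simple _ U)// -RintegralB//.
  apply: (le_trans (le_normr_Rintegral mU (integrable_RB mU intf ints))).
  rewrite -Rintegral_cst//; apply: le_Rintegral => //.
  - have := integrable_norm (integrable_RB mU intf ints).
    by [].
  - exact: finite_measure_integrable_cst.
rewrite intE.
have -> : \sum_(0 <= j < K) c j * fine (nu (E j)) =
    \sum_(0 <= j < K) c j * fine (jp (E j)) - \sum_(0 <= j < K) c j * fine (jn (E j)).
  rewrite -sumrB; apply: eq_bigr => j _; rewrite -mulrBr nuE// fineB//; exact: fin_num_measure.
rewrite mulrDr; have := lerD (est jp) (est jn); apply: le_trans.
apply: le_trans (ler_normB _ _); rewrite le_eqVlt; apply/predU1P; left; congr (`|_|).
by ring.
Qed.

End finite_measure_integrals.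

Section charge_integral_bound.
Context {R : realType} {n : nat}.
Local Notation mT := (measurableTypeR R).
Variable nu : 'I_n -> {charge set mT -> \bar R}.

(** For a simple function this is the triangle inequality with |nu(E)| <= |nu|(E); level sets reduce
    the general case to it. *)
Lemma enorm_charge_integral (U : set mT) (f : R -> R) M : measurable U ->
  measurable_fun U f -> (forall x, U x -> `|f x| <= M) ->
  enorm (\row_i charge_integral (nu i) U f) <= \int[variation_measure nu]_(x in U) `|f x|.
Proof.
move=> mU mf fM.
have /choice[C hC] i : exists C : R, 0 <= C /\ forall (f : R -> R) M e K c (E : nat -> set mT),
    measurable_fun U f -> (forall x, U x -> `|f x| <= M) ->
    (forall j, measurable (E j)) -> (forall j, E j `<=` U) ->
    (forall x, U x -> `|f x - \sum_(0 <= j < K) c j * \1_(E j) x| <= e) ->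
    `|charge_integral (nu i) U f - \sum_(0 <= j < K) c j * fine (nu i (E j))| <= e * C.
  by have [C C0 hC] := charge_integral_simple (nu i) mU; exists C.
(* [D] gathers the errors per unit of e: the constants C i for the charge integrals, the mass of U
   for the integral of |f|. *)
pose D := fine (variation_measure nu U) + \sum_i C i.
have D0 : 0 <= D by rewrite addr_ge0 ?fine_ge0// sumr_ge0// => i _; exact: (hC i).1.
apply/ler_addgt0Pr => e' e'0.
pose e := e' / (D + 1).
have e0 : 0 < e by rewrite divr_gt0//; lra.
have eD : e * D <= e'.
  by rewrite /e mulrAC ler_pdivrMr ?ler_pM2l//; lra.
have [K [c [E [mE EU h1 h2]]]] := level_approx mU mf fM e0.
set z := \row_i _; pose y := \sum_(0 <= j < K) c j *: vec_measure nu (E j).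
have zy : enorm (z - y) <= e * \sum_i C i.
  apply: (le_trans (enorm_le_sum _)); rewrite mulr_sumr; apply: ler_sum => i _.
  have := (hC i).2 f M e K c E mf fM mE EU h1; rewrite !mxE summxE.
  by congr (`|_ - _| <= _); apply: eq_bigr => j _; rewrite !mxE.
have hy : enorm y <= \int[variation_measure nu]_(x in U) `|f x| + e * fine (variation_measure nu U).
  apply: (@le_trans _ _ (\sum_(0 <= j < K) `|c j| * fine (variation_measure nu (E j)))).
    apply: (le_trans (enorm_sum _ _ _)); apply: ler_sum => j _; rewrite enormZ ler_wpM2l//.
    rewrite -lee_fin fineK ?fin_num_measure// variation_measureE//; exact: enorm_vec_measure_le.
  rewrite -(@Rintegral_simple _ (variation_measure nu) U)// -Rintegral_cst//.
  have intf : (variation_measure nu).-integrable U (EFin \o (fun x => `|f x|)).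
    apply: (@bounded_integrable _ _ _ _ M) => //.
      by apply: measurableT_comp => //.
    by move=> x Ux; rewrite normr_id fM.
  have ic : (variation_measure nu).-integrable U (EFin \o cst e) by exact: finite_measure_integrable_cst.
  rewrite -RintegralD//; apply: le_Rintegral => //.
  - apply: integrable_Rsum => // j; apply: integrable_RZ => //.
    apply: (@bounded_integrable _ _ _ _ 1) => // x _; rewrite indicE ger0_norm ?ler0n//.
    by case: (_ \in _).
  - exact: integrable_RD.
have -> : z = (z - y) + y by rewrite subrK.
apply: (le_trans (enormD _ _)).
apply: (le_trans (lerD zy hy)).
by rewrite addrCA lerD2l -mulrDr [_ + fine _]addrC.
Qed.

End charge_integral_bound.

(** * Convergence of cell means *)

Section clip.
Context {R : realType}.

Definition clip (M y : R) : R := Num.max (- M) (Num.min M y).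

Lemma clip_bound M y : 0 <= M -> `|clip M y| <= M.
Proof.
move=> M0; rewrite /clip ler_norml; have [h1|h1] := leP M y;
  rewrite ?le_max ?ge_max ?lexx/= ?(ltW h1) ?andbT; lra.
Qed.

Lemma clip_id M y : `|y| <= M -> clip M y = y.
Proof. by rewrite ler_norml => /andP[h1 h2]; rewrite /clip min_r ?max_r. Qed.

Lemma clip_lipschitz M y z : `|clip M y - clip M z| <= `|y - z|.
Proof.
wlog yz : y z / y <= z.
  by move=> h; have [yz|zy] := leP y z; [exact: h|rewrite distrC (distrC y) h// ltW].
rewrite distrC (distrC y) (ger0_norm (_ : 0 <= z - y)) ?subr_ge0// /clip ler_norml.
have [y1|y1] := leP M y; have [z1|z1] := leP M z; 
  (try have [a1|a1] := leP (- M) y); (try have [b1|b1] := leP (- M) z);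
  (try have [c1|c1] := leP (- M) M); apply/andP; split; lra.
Qed.

Lemma clip_sub_le M y : 0 <= M -> `|y - clip M y| <= `|y|.
Proof.
move=> M0; have c0 : clip M 0 = 0 by rewrite clip_id// normr0.
have [h|h] := leP `|y| M; first by rewrite clip_id// subrr normr0.
rewrite /clip ler_norml; have [y0|y0] := leP 0 y.
  rewrite ger0_norm// in h *; rewrite min_l ?max_r; lra.
rewrite ltr0_norm// in h *; rewrite min_r ?max_l; lra.
Qed.

Lemma continuous_clip M (g : R -> R) : continuous g -> continuous (clip M \o g).
Proof.
move=> cg x; apply: (@continuous_max _ _ (cst (- M)) (cst M \min g)); first exact: cvg_cst.
by apply: continuous_min; [exact: cvg_cst|exact: cg].
Qed.

Lemma measurable_clip M D (g : R -> R) : measurable D -> measurable_fun D g ->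
  measurable_fun D (clip M \o g).
Proof.
by move=> mD mg; apply: measurable_maxr => //; apply: measurable_minr.
Qed.

End clip.

Section L2_approximation.
Context {R : realType}.
Variables (a b : R).
Hypothesis ab : a < b.
Local Notation mu := (@lebesgue_measure R).
Local Notation I := (`]a, b[%classic : set R).
Local Hint Resolve measurable_I : core.

(** f is truncated at a level k, then approximated in L^1 by a continuous function that is clipped
    at the same level. Both clipped functions being bounded, the L^1 error controls the L^2
    error. *)
Lemma L2_continuous_approx (f : R -> R) e : mu.-integrable I (EFin \o f) ->
  mu.-integrable I (EFin \o (fun x => f x ^+ 2)) -> 0 < e ->
  exists g M, [/\ continuous g, forall x, `|g x| <= M &
    \int[mu]_(x in I) (f x - g x) ^+ 2 <= e].
Proof.
move=> fi f2i e0; have mI := measurable_I a b; have mf := integrable_Rmeasurable fi.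
have mD (h k : R -> R) : measurable_fun I h -> measurable_fun I k ->
    measurable_fun I (fun x => (h x - k x) ^+ 2).
  by move=> mh mk; apply: measurable_funX; exact: measurable_funB.
have mc k : measurable_fun I (clip k \o f) by exact: measurable_clip.
have dom k x : `|(f x - clip k%:R (f x)) ^+ 2| <= f x ^+ 2.
  rewrite ger0_norm ?sqr_ge0// -[leLHS]real_normK ?num_real// -[leRHS]real_normK ?num_real//.
  by rewrite lerXn2r ?nnegrE// clip_sub_le.
have [||||_ cv] := @Rdominated_cvg _ _ _ mu I
    (fun k x => (f x - clip k%:R (f x)) ^+ 2) (cst 0) (fun x => f x ^+ 2) mI.
- by move=> k; apply: mD => //; exact: mc.
- move=> x _; apply: cvg_near_cst; near=> k; rewrite clip_id ?subrr ?expr0n//.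
  by near: k; exact: nbhs_infty_ger.
- by move=> k x _; exact: dom.
- exact: f2i.
have {cv} : \int[mu]_(x in I) (f x - clip k%:R (f x)) ^+ 2 @[k --> \oo] --> (0 : R).
  by rewrite -[X in _ --> X](mul0r (fine (mu I))) -Rintegral_cst.
have e4 : 0 < e / 4 by rewrite divr_gt0.
move=> /(@cvgr0_norm_le _ _ _ _ _ _) /(_ _ e4)[k _ /(_ k (leqnn k)) hk].
have [g_ [cg ig cvg_]] : exists g_ : (R -> R)^nat, [/\ forall n, continuous (g_ n),
    forall n, mu.-integrable I (EFin \o g_ n) &
    (\int[mu]_(z in I) `|(f z - g_ n z)%:E| @[n --> \oo] --> 0)%E].
  apply: approximation_continuous_integrable => //.
  by have := lebesgue_measure_itv (Interval (BRight a) (BLeft b)); rewrite /= lte_fin ab => ->; rewrite -EFinB ltry.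
(* The L^1 error is multiplied by 4 (k + 1) below and so contributes e / 2; the truncation
   contributes twice e / 4. *)
pose d := e / (8 * (k%:R + 1)).
have kp : 0 < k%:R + 1 :> R by rewrite ltr_wpDl.
have d0 : 0 < d by rewrite divr_gt0// mulr_gt0.
have [j hj] : exists j, \int[mu]_(z in I) `|f z - g_ j z| <= d.
  have := @fine_cvg _ _ \oo eventually_filter _ _ cvg_; move=> /(@cvgr0_norm_le _ _ _ _ _ _) /(_ _ d0)[j _ /(_ j (leqnn j)) h].
  by exists j; apply: le_trans h; exact: ler_norm.
exists (clip k%:R \o g_ j), k%:R; split.
- exact: continuous_clip.
- by move=> x; exact: clip_bound.
have i1 : mu.-integrable I (EFin \o (fun x => (f x - clip k%:R (f x)) ^+ 2)).
  by apply: (integrable_Rle mI _ _ f2i) => [|x _]; [apply: mD => //; exact: mc|exact: dom].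
have i2 : mu.-integrable I (EFin \o (fun x => `|f x - g_ j x|)).
  exact: (integrable_norm (integrable_RB mI fi (ig j))).
have le x : (f x - clip k%:R (g_ j x)) ^+ 2 <=
    2 * (f x - clip k%:R (f x)) ^+ 2 + (4 * (k%:R + 1)) * `|f x - g_ j x|.
  set y := clip _ (f x); set z := clip _ (g_ j x).
  have h1 : `|y - z| <= `|f x - g_ j x| by exact: clip_lipschitz.
  have h2 : `|y - z| <= 2 * (k%:R + 1).
    apply: (le_trans (ler_normB _ _)).
    by have := clip_bound (f x) (ler0n R k); have := clip_bound (g_ j x) (ler0n R k);
      rewrite -/y -/z; lra.
  have h3 : (y - z) ^+ 2 <= 2 * (k%:R + 1) * `|f x - g_ j x|.
    by rewrite -[leLHS]real_normK ?num_real// expr2 ler_pM.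
  have h4 : (f x - z) ^+ 2 <= 2 * (f x - y) ^+ 2 + 2 * (y - z) ^+ 2.
    have := sqr_ge0 ((f x - y) - (y - z)); move: (f x) => u.
    by rewrite !expr2; lra.
  by apply: (le_trans h4); rewrite lerD2l; lra.
apply: (@le_trans _ _ (\int[mu]_(x in I)
    (2 * (f x - clip k%:R (f x)) ^+ 2 + (4 * (k%:R + 1)) * `|f x - g_ j x|))).
  apply: le_Rintegral => //; last by apply: integrable_RD => //; exact: integrable_RZ.
  apply: (integrable_Rle mI _ _ (integrable_RD mI (integrable_RZ 2 mI i1) (integrable_RZ (4 * (k%:R + 1)) mI i2))).
    apply: mD => //; apply: measurable_clip => //; exact: integrable_Rmeasurable (ig j).
  by move=> x _; rewrite ger0_norm ?sqr_ge0.
rewrite RintegralD//; [|exact: integrable_RZ|exact: integrable_RZ].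
rewrite !RintegralZl//.
have h1 : \int[mu]_(x in I) (f x - clip k%:R (f x)) ^+ 2 <= e / 4.
  by apply: le_trans hk; exact: ler_norm.
have h2 : 4 * (k%:R + 1) * \int[mu]_(x in I) `|f x - g_ j x| <= e / 2.
  apply: (@le_trans _ _ (4 * (k%:R + 1) * d)).
    by rewrite ler_pM2l// mulr_gt0.
  by rewrite /d le_eqVlt; apply/predU1P; left; field; rewrite gt_eqF.
by rewrite (_ : e = 2 * (e / 4) + e / 2); [rewrite lerD// ler_pM2l|field].
Unshelve. all: by end_near. Qed.

Lemma mesh_cvg0 : mesh a b N.+1 @[N --> \oo] --> (0 : R).
Proof.
rewrite /mesh -[X in _ --> X](mulr0 (b - a)); apply: cvgMr.
exact: cvg_harmonic.
Qed.

Lemma step_node_cvg n (G : R -> 'rV[R]_n) x c : I x -> continuous (fun y => G y 0 c) ->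
  step a b N.+1 (fun i => G (node a b N.+1 i)) x 0 c @[N --> \oo] --> G x 0 c.
Proof.
move=> Ix cG; apply/cvgrPdist_le => e e0.
have [d /= d0 hd] := (@cvgrPdist_le _ _ _ _ _ _ _).1 (cG x) _ e0.
near=> N.
have hm : mesh a b N.+1 < d.
  near: N; have [N0 _ h] := @cvgr0_norm_lt _ _ _ _ _ _ mesh_cvg0 _ d0.
  by exists N0 => // N /h; apply: le_lt_trans; exact: ler_norm.
have [i iN ci] := cells_cover ab (ltn0Sn N) Ix.
rewrite (step_in ab (ltn0Sn N) _ iN ci); apply: hd => /=.
move/mem_cell: ci => /andP[h1]; rewrite nodeS => h2.
by rewrite ger0_norm ?subr_ge0 ?ltW//; lra.
Unshelve. all: by end_near. Qed.

(** Cell means give the best cellwise constant approximation, so it is enough to compare with the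
    node values of a continuous function close to w. *)
Lemma L2sq_cell_mean_cvg n (w : R -> 'rV[R]_n) : is_L2 I w ->
  L2sq I (w - step a b N.+1 (cell_mean a b N.+1 w)) @[N --> \oo] --> (0 : R).
Proof.
move=> hw; have mI := measurable_I a b; apply/cvgr0Pnorm_le => e e0.
have [mw iw] := (is_L2P mI _).1 hw.
have iw2 c : mu.-integrable I (EFin \o (fun x => w x 0 c ^+ 2)).
  apply: (integrable_Rle mI _ _ iw) => [|x _]; first by apply: measurable_funX; exact: mw.
  rewrite ger0_norm ?sqr_ge0// /dotp (bigD1 c)//= expr2 lerDl.
  by apply: sumr_ge0 => i _; rewrite -expr2 sqr_ge0.
(* The n coordinates together then cost at most e / 4. *)
pose d := e / (4 * (n%:R + 1)).
have np : 0 < n%:R + 1 :> R by rewrite ltr_wpDl.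
have d0 : 0 < d by rewrite divr_gt0// mulr_gt0.
have /choice[g /choice[M hg]] c : exists g M, [/\ continuous g, forall x, `|g x| <= M &
    \int[mu]_(x in I) (w x 0 c - g x) ^+ 2 <= d].
  exact: (L2_continuous_approx (L2_coord_integrable c hw) (iw2 c) d0).
pose G x : 'rV[R]_n := \row_c g c x.
have cg c : continuous (fun y => G y 0 c).
  have [cgc _ _] := hg c; rewrite (_ : (fun y => _) = g c)//.
  by apply: funext => y; rewrite mxE.
have bg c x : `|G x 0 c| <= M c by rewrite mxE; have [_ + _] := hg c; exact.
have mG c : measurable_fun I (fun x => G x 0 c).
  by apply: (measurable_funS measurableT) => //; exact: continuous_measurable_fun.
have hG : is_L2 I G.
  apply/(is_L2P mI); split => //.
  apply: (integrable_Rle mI _ _ (integrable_itv_cst a b false true (\sum_c M c ^+ 2))).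
    exact: measurable_dotp.
  move=> x _; rewrite ger0_norm ?dotp_ge0//; apply: ler_sum => c _; rewrite -expr2.
  by rewrite -[leLHS]real_normK ?num_real// lerXn2r ?nnegrE// (le_trans _ (bg c x)).
have wG : L2sq I (w - G) <= e / 4.
  rewrite /L2sq /L2dot /dotp.
  have -> : \int[mu]_(x in I) (\sum_(c < n) ((w - G) x) 0 c * ((w - G) x) 0 c) =
      \int[mu]_(x in I) (\sum_(c < n) (w x 0 c - g c x) ^+ 2).
    by apply: eq_Rintegral => x _; apply: eq_bigr => c _; rewrite expr2 !mxE.
  have ic c : mu.-integrable I (EFin \o (fun x => (w x 0 c - g c x) ^+ 2)).
    have [_ i2] := (is_L2P mI _).1 (is_L2B mI hw hG).
    apply: (integrable_Rle mI _ _ i2) => [|x _].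
      apply: measurable_funX; apply: measurable_funB; first exact: mw.
      rewrite (_ : g c = (fun x => G x 0 c)); first exact: mG.
      by apply: funext => x; rewrite mxE.
    rewrite ger0_norm ?sqr_ge0// /dotp (bigD1 c)//= !mxE expr2 lerDl.
    by apply: sumr_ge0 => i _; rewrite -expr2 sqr_ge0.
  rewrite Rintegral_sum//; apply: (@le_trans _ _ (\sum_(c < n) d)).
    by apply: ler_sum => c _; have [] := hg c.
  rewrite sumr_const card_ord -[leLHS]mulr_natl /d.
  rewrite mulrA ler_pdivrMr ?mulr_gt0// (_ : e / 4 * _ = (n%:R + 1) * e); last by field.
  by rewrite ler_pM2r// lerDl.
pose s N := step a b N.+1 (fun i => G (node a b N.+1 i)).
have hs N : is_L2 I (s N) by exact: step_L2.
have GsE N x c : ((G - s N) x) 0 c = G x 0 c - s N x 0 c.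
  by rewrite [in LHS]/GRing.add/= !mxE.
have cs : L2sq I (G - s N) @[N --> \oo] --> (0 : R).
  have bs N c x : I x -> `|s N x 0 c| <= M c.
    by move=> Ix; have [i iN ci] := cells_cover ab (ltn0Sn N) Ix; rewrite /s (step_in ab (ltn0Sn N) _ iN ci).
  have [||||_] := @Rdominated_cvg _ _ _ mu I
    (fun N x => dotp ((G - s N) x) ((G - s N) x)) (cst 0) (cst (\sum_c (2 * M c) ^+ 2)) mI.
  - by move=> N; apply: measurable_dotp; have [] := (is_L2P mI _).1 (is_L2B mI hG (hs N)).
  - move=> x Ix; rewrite /dotp (_ : cst 0 x = \sum_(c < n) (G x 0 c - G x 0 c) * (G x 0 c - G x 0 c)); last first.
      by rewrite /= big1// => c _; rewrite subrr mul0r.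
    apply: cvg_finsum => c.
    have h : ((G - s N) x) 0 c @[N --> \oo] --> G x 0 c - G x 0 c.
      rewrite (_ : (fun N => _) = (fun N => G x 0 c - s N x 0 c)); last first.
        by apply: funext => N; rewrite GsE.
      by apply: cvgB; [exact: cvg_cst|exact: step_node_cvg].
    exact: (cvgM h h).
  - move=> N x Ix; rewrite ger0_norm ?dotp_ge0//; apply: ler_sum => c _; rewrite -expr2.
    rewrite -[leLHS]real_normK ?num_real//.
    have h : `|((G - s N) x) 0 c| <= 2 * M c.
      rewrite GsE (le_trans (ler_normB _ _))//.
      by rewrite mulr_natl mulr2n lerD// bs.
    by rewrite lerXn2r ?nnegrE// (le_trans _ h).
  - exact: integrable_itv_cst.
  by rewrite Rintegral_cst// mul0r.
have e4 : 0 < e / 4 by rewrite divr_gt0.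
near=> N.
have hN : L2sq I (G - s N) <= e / 4.
  near: N; have [N0 _ h] := @cvgr0_norm_le _ _ _ _ _ _ cs _ e4.
  by exists N0 => // N /h; apply: le_trans; exact: ler_norm.
rewrite ger0_norm ?L2sq_ge0//.
have := L2sq_sub_step ab (ltn0Sn N) (fun i => G (node a b N.+1 i)) hw.
have nn : 0 <= mesh a b N.+1 * \sum_(0 <= i < N.+1)
    enorm (cell_mean a b N.+1 w i - G (node a b N.+1 i)) ^+ 2.
  by rewrite mulr_ge0 ?sumr_ge0// ?(ltW (mesh_gt0 ab _))// => i _; exact: sqr_ge0.
have : L2sq I (w - s N) <= 2 * L2sq I (w - G) + 2 * L2sq I (s N - G).
  rewrite (_ : w - s N = (w - G) - (s N - G)); last by rewrite opprB addrA subrK.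
  by apply: L2sq_sub_le => //; exact: is_L2B.
have -> : L2sq I (s N - G) = L2sq I (G - s N).
  rewrite -opprB /L2sq /L2dot; apply: eq_Rintegral => x _.
  by rewrite [X in dotp X X](_ : _ = - ((G - s N) x))// dotpNl dotpNr opprK.
move=> h1 h2; have h3 : L2sq I (w - step a b N.+1 (cell_mean a b N.+1 w)) <= L2sq I (w - s N).
  by rewrite h2 lerDl.
apply: (le_trans h3); apply: (le_trans h1).
by rewrite (_ : e = 2 * (e / 4) + 2 * (e / 4)); [rewrite lerD// ler_pM2l|field].
Unshelve. all: by end_near. Qed.

End L2_approximation.

(** * The bound on test functions *)

Section test_functions.
Context {R : realType}.
Variable U : set R.
Implicit Type f : R -> R.

Lemma test_fun_out f x : test_fun U f -> ~ U x -> f x = 0.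
Proof. by move=> [_ [K [_ KU f0]]] nUx; apply: f0 => /KU. Qed.

Lemma test_fun_continuous f : test_fun U f -> continuous f.
Proof. by move=> /test_fun_is_smooth; exact: smooth_continuous. Qed.

Lemma test_fun_measurable f D : test_fun U f -> measurable_fun (D : set (measurableTypeR R)) f.
Proof.
move=> tf; apply: (measurable_funS measurableT) => //.
exact: continuous_measurable_fun (test_fun_continuous tf).
Qed.

Lemma test_fun_derive1 f : test_fun U f -> test_fun U (derive1 f).
Proof.
move=> tf; have sf := test_fun_is_smooth tf; have [_ [K [cK KU f0]]] := tf.
apply: (test_fun_smooth (smooth_derive1 sf) cK KU) => x nKx.
have oK : open (~` K) by apply: closed_openC; exact: compact_closed.
have nf : \forall y \near x, cst 0 y = f y.
  by have := open_nbhs_nbhs (conj oK nKx); apply: filterS => y /= /f0 ->.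
have h : is_derive x 1 f 0 := near_eq_is_derive nf (is_derive_cst 0 x 1).
by rewrite derive1E; apply: derive_val.
Qed.

Lemma test_fun_bounded f : test_fun U f -> exists M, forall x, `|f x| <= M.
Proof.
move=> tf; have [_ [K [cK _ f0]]] := tf.
have cfK : {within K, continuous f} by apply: continuous_subspaceT; exact: test_fun_continuous.
have [M [_ hM]] := compact_bounded (continuous_compact cfK cK).
exists (Num.max 0 (M + 1)) => x; rewrite le_max; have [Kx|nKx] := pselect (K x).
  apply/orP; right; apply: (hM (M + 1)); first by rewrite ltrDl.
  by exists x.
by rewrite f0// normr0 lexx.
Qed.

End test_functions.

Lemma compact_thickening {R : realType} (K U : set R) : compact K -> open U -> K `<=` U ->
  exists2 d : R, 0 < d & forall x y, K x -> `|y - x| < d -> U y.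
Proof.
move=> cK oU KU.
have /compact_near_coveringP /(_ R (0^'+) (fun r x => forall y, `|y - x| < r -> U y) _) := cK.
case.
  move=> x Kx; have := open_nbhs_nbhs (conj oU (KU _ Kx)) => -[e /= e0 he].
  exists (ball x (e / 2), [set r | r < e / 2]).
    split; first by apply: nbhsx_ballx; rewrite divr_gt0.
    by apply: nbhs_right_lt; rewrite divr_gt0.
  move=> [x' r]/= [xx' re] y yx'; apply: he => /=.
  rewrite /ball/= in xx'.
  rewrite (_ : x - y = (x - x') - (y - x')); last by rewrite opprB addrA subrK.
  rewrite (le_lt_trans (ler_normB _ _))// [ltRHS]splitr ltrD//.
  exact: lt_trans re.
move=> e /= e0 he; exists (e / 2); first by rewrite divr_gt0.
move=> x y Kx; apply: (he (e / 2)) => //=.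
  by rewrite sub0r normrN gtr0_norm ?divr_gt0// ltr_pdivrMr// ltr_pMr// ltr1n.
by rewrite divr_gt0.
Qed.

Section total_variation_bound.
Context {R : realType} {n : nat}.
Variables (a b : R).
Hypothesis ab : a < b.
Local Notation mu := (@lebesgue_measure R).
Local Notation I := (`]a, b[%classic : set R).
Variable U : set R.
Hypothesis oU : open U.
Variable nu0 : 'I_n -> {charge set (measurableTypeR R) -> \bar R}.
Variable v0 : R -> 'rV[R]_n.
Hypothesis hBV : BV_deriv nu0 U v0.
Local Notation m := (variation_measure nu0).

Let mU : measurable (U : set (measurableTypeR R)). Proof. exact: open_measurable. Qed.

Lemma trap_measurable h c d D : measurable_fun (D : set (measurableTypeR R)) (trap h c d).
Proof.
apply: (measurable_funS measurableT) => //; rewrite /trap /ramp.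
apply: measurable_funM => //; apply: measurable_funB; apply: measurable_maxr => //;
  apply: measurable_minr => //; exact: measurable_funB.
Qed.

Lemma trap_integrable h c d : 0 < h -> c <= d -> m.-integrable U (EFin \o trap h c d).
Proof.
move=> h0 cd; apply: (@bounded_integrable _ _ _ _ 1) => //; first exact: trap_measurable.
by move=> x _; have /andP[t0 t1] := trap_bound h0 cd x; rewrite ger0_norm.
Qed.

(** The jump of the means across node j + 1 is the derivative of v0 tested against the hat function
    at that node, and the hat is a limit of test functions bounded by 1. *)
Lemma cell_mean_incr_le N j : (0 < N)%N -> (j.+1 < N)%N ->
  `[node a b N j, node a b N j.+2]%classic `<=` U ->
  enorm (incr (cell_mean a b N v0) j.+1) <=
    \int[m]_(x in U) trap (mesh a b N) (node a b N j) (node a b N j.+1) x.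
Proof.
move=> N0 jN sub; set h := mesh a b N; set c := node a b N j; set d := node a b N j.+1.
have h0 : 0 < h by exact: mesh_gt0.
have cd : c <= d by exact: node_le.
have dh : d + h = node a b N j.+2 by rewrite (nodeS a b N j.+1).
have ch : c + h = d by rewrite /d nodeS.
have sub' : `[c, d + h]%classic `<=` U by rewrite dh.
have sb k x := smooth_trap_bound h0 cd k x.
have tb x := trap_bound h0 cd x.
have tst k : test_fun U (smooth_trap h c d k) by exact: smooth_trap_test.
have cvc i : charge_integral (nu0 i) U (smooth_trap h c d k) @[k --> \oo] -->
    incr (cell_mean a b N v0) j.+1 0 i.
  have iv : mu.-integrable `[c, d + h] (EFin \o (fun x => v0 x 0 i)).
    by apply: integrableS (hBV.1 i) => //; exact: measurable_itv.
  have := @cvgN _ _ _ \oo eventually_filter _ _ (smooth_trap_derive1_cvg h0 cd sub' iv).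
  rewrite (_ : - (h^-1 * _) = incr (cell_mean a b N v0) j.+1 0 i); last first.
    by rewrite ch dh /incr/= !mxE -mulrN opprB mulrBr.
  move=> cv; apply: cvg_trans cv; apply: near_eq_cvg; near=> k.
  by rewrite /= [LHS]/GRing.opp/= (hBV.2 i _ (tst k)) opprK.
have [||||_ cvm] := @Rdominated_cvg _ _ _ m U
    (fun k x => smooth_trap h c d k x) (trap h c d) (cst 1) mU.
- by move=> k; exact: test_fun_measurable (tst k).
- by move=> x _; exact: smooth_trap_cvg.
- by move=> k x _; have /andP[t0 t1] := sb k x; rewrite ger0_norm.
- exact: finite_measure_integrable_cst.
apply: enorm_le_dual; first by apply: Rintegral_ge0 => x _; have /andP[] := tb x.
move=> e.
have cv1 : dotp e (\row_i charge_integral (nu0 i) U (smooth_trap h c d k)) @[k --> \oo] -->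
    dotp e (incr (cell_mean a b N v0) j.+1).
  apply: cvg_finsum => i; apply: cvgMr.
  by under eq_fun do rewrite mxE; exact: cvc.
have cv2 : \int[m]_(x in U) smooth_trap h c d k x * enorm e @[k --> \oo] -->
    \int[m]_(x in U) trap h c d x * enorm e by apply: cvgMl.
apply: (ler_cvg_to cv1 cv2); near=> k.
apply: (le_trans (dotp_le _ _)); rewrite mulrC ler_wpM2r ?enorm_ge0//.
have := @enorm_charge_integral _ _ nu0 U _ 1 mU (test_fun_measurable (tst k)).
have -> : \int[m]_(x in U) `|smooth_trap h c d k x| = \int[m]_(x in U) smooth_trap h c d k x.
  by apply: eq_Rintegral => x _; have /andP[t0 t1] := sb k x; rewrite ger0_norm.
by apply => x _; have /andP[t0 t1] := sb k x; rewrite ger0_norm.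
Unshelve. all: by end_near. Qed.

(** The hats are differences of consecutive ramps, so their sum telescopes. *)
Lemma trap_sum_le1 N x : (0 < N)%N ->
  \sum_(1 <= k < N) trap (mesh a b N) (node a b N k.-1) (node a b N k) x <= 1.
Proof.
move=> N0; have h0 : 0 < mesh a b N by exact: mesh_gt0.
rewrite /trap -mulr_sumr mulrC ler_pdivrMr// mul1r.
case: N N0 h0 => [//|N] _ h0; rewrite big_add1/=.
rewrite (eq_bigr (fun k => - ramp (mesh a b N.+1) (x - node a b N.+1 k.+1)
    - - ramp (mesh a b N.+1) (x - node a b N.+1 k))); last first.
  by move=> k _; rewrite opprK addrC.
rewrite (telescope_sumr (fun k => - ramp (mesh a b N.+1) (x - node a b N.+1 k)))//.
rewrite opprK addrC lerBlDr (le_trans (ramp_leh h0 _))//.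
by rewrite lerDl ramp_ge0.
Qed.

Section one_test_function.
Variable f : R -> R.
Hypothesis tf : test_fun U f.

(** Each jump is bounded by the integral of its hat. Replacing f at the node by f x under the
    integral costs a Lipschitz error of one mesh, and the hats sum to at most 1. *)
Lemma weighted_incr_le : exists L M, [/\ 0 <= L, 0 <= M, forall x, `|f x| <= M &
  \forall N \near \oo,
   \sum_(1 <= k < N.+1) `|f (node a b N.+1 k)| * enorm (incr (cell_mean a b N.+1 v0) k) <=
     \int[m]_(x in U) `|f x| + L * mesh a b N.+1].
Proof.
have [_ [K [cK KU f0]]] := tf; have [d d0 hd] := compact_thickening cK oU KU.
have [M fM] := test_fun_bounded tf.
have [L fL] := test_fun_bounded (test_fun_derive1 tf).
have M0 : 0 <= M by exact: le_trans (fM 0).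
have L0 : 0 <= L by exact: le_trans (fL 0).
have lip x y : `|f x - f y| <= L * `|x - y|.
  have main u v : u < v -> `|f v - f u| <= L * (v - u).
    move=> uv.
    have [|| z _ ->] := @MVT _ f (derive1 f) _ _ uv.
    - move=> z _; apply: is_derive1_derivable.
      exact: smooth_derivable (test_fun_is_smooth tf).
    - by apply: continuous_subspaceT; exact: test_fun_continuous tf.
    by rewrite normrM (gtr0_norm (_ : 0 < v - u)) ?subr_gt0// ler_wpM2r// subr_ge0 ltW.
  have [xy|yx|->] := ltgtP x y; last by rewrite !subrr !normr0 mulr0.
    by rewrite distrC (distrC x) [X in _ * X]gtr0_norm ?subr_gt0//; exact: main.
  by rewrite [X in _ * X]gtr0_norm ?subr_gt0//; exact: main.
(* The pointwise error L h is integrated over U, which brings in the mass of U. *)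
exists (L * fine (m U)), M; split => //; first by rewrite mulr_ge0// fine_ge0.
near=> N.
(* Once the mesh is below the thickening radius, every hat centred at a node where f is nonzero has
   its support inside U. *)
have hm : mesh a b N.+1 < d.
  near: N; have [N0 _ h] := @cvgr0_norm_lt _ _ _ _ _ _ (@mesh_cvg0 _ a b) _ d0.
  by exists N0 => // N /h; apply: le_lt_trans; exact: ler_norm.
set h := mesh a b N.+1; have h0 : 0 < h by exact: mesh_gt0.
pose t k := trap h (node a b N.+1 k.-1) (node a b N.+1 k).
have nl k : node a b N.+1 k.-1 <= node a b N.+1 k by apply: node_le => //; exact: leq_pred.
have it k : m.-integrable U (EFin \o (fun x => `|f (node a b N.+1 k)| * t k x)).
  by apply: integrable_RZ => //; exact: trap_integrable.
have ifn : m.-integrable U (EFin \o (fun x => `|f x|)).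
  apply: (@bounded_integrable _ _ _ _ M) => //; last by move=> x _; rewrite normr_id.
  by apply: measurableT_comp (test_fun_measurable tf) => //.
have icst k : m.-integrable U (EFin \o cst k) by exact: finite_measure_integrable_cst.
apply: (@le_trans _ _ (\int[m]_(x in U) (\sum_(1 <= k < N.+1) `|f (node a b N.+1 k)| * t k x))).
  rewrite Rintegral_sum//.
  rewrite big_nat_cond [leRHS]big_nat_cond; apply: ler_sum => k /andP[/andP[k1 kN] _].
  rewrite RintegralZl//; last exact: trap_integrable.
  have [->|fk] := eqVneq (f (node a b N.+1 k)) 0; first by rewrite normr0 !mul0r.
  rewrite ler_wpM2l//; case: k k1 kN fk => [//|j] _ jN fj; apply: cell_mean_incr_le => //.
  have Kj : K (node a b N.+1 j.+1) by apply: contrapT => /f0 fj0; rewrite fj0 eqxx in fj.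
  move=> y /=; rewrite in_itv/= => /andP[y1 y2]; apply: hd Kj _.
  have e1 := nodeS a b N.+1 j; have e2 := nodeS a b N.+1 j.+1.
  by rewrite ltr_norml; rewrite e2 in y2; apply/andP; split; lra.
rewrite [X in _ + X](_ : _ = (L * h) * fine (m U)); last by rewrite /h; ring.
rewrite -Rintegral_cst// -RintegralD//; last exact: icst.
apply: le_Rintegral => //.
- exact: integrable_Rsum.
- by apply: integrable_RD => //; exact: icst.
move=> x Ux; have Lh0 : 0 <= L * h by rewrite mulr_ge0// ltW.
apply: (@le_trans _ _ (\sum_(1 <= k < N.+1) (`|f x| + L * h) * t k x)); last first.
  by rewrite -mulr_sumr ler_piMr ?addr_ge0// trap_sum_le1.
apply: ler_sum => k _.
have /andP[t0 _] := trap_bound h0 (nl k) x.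
(* Where the hat does not vanish, x is within one mesh of node k. *)
have [xk|xk] := pselect (node a b N.+1 k.-1 <= x <= node a b N.+1 k + h); last first.
  by rewrite /t trap_out// !mulr0.
rewrite ler_wpM2r// -lerBlDl.
apply: (le_trans (lerB_dist _ _)); apply: (le_trans (lip _ _)); rewrite ler_wpM2l// ler_norml.
have e1 : node a b N.+1 k <= node a b N.+1 k.-1 + h.
  by case: (k) => [|j] /=; [rewrite lerDl ltW|rewrite nodeS].
by move/andP: xk => [x1 x2]; apply/andP; split; lra.
Unshelve. all: by end_near. Qed.

End one_test_function.
End total_variation_bound.

Section weak_derivative.
Context {R : realType} {n : nat}.
Local Notation mu := (@lebesgue_measure R).
Variables (U : set R) (w : R -> 'rV[R]_n).

Definition weak_deriv (f : R -> R) : 'rV[R]_n :=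
  \row_i - \int[mu]_(x in U) (w x 0 i * derive1 f x).

Lemma weak_derivE f i : weak_deriv f 0 i = - \int[mu]_(x in U) (w x 0 i * derive1 f x).
Proof. by rewrite mxE. Qed.

Lemma weak_deriv_lin c f g : measurable (U : set (measurableTypeR R)) ->
  (forall i, mu.-integrable U (EFin \o (fun x => w x 0 i * derive1 f x))) ->
  (forall i, mu.-integrable U (EFin \o (fun x => w x 0 i * derive1 g x))) ->
  test_fun U f -> test_fun U g ->
  weak_deriv (fun x => c * f x + g x) = c *: weak_deriv f + weak_deriv g.
Proof.
move=> mU if_ ig tf tg.
have dE (x : R) : derive1 (fun y => c * f y + g y) x = c * derive1 f x + derive1 g x.
  have df := is_derive1_derivable (@smooth_derivable _ f x (test_fun_is_smooth tf)).
  have dg := is_derive1_derivable (@smooth_derivable _ g x (test_fun_is_smooth tg)).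
  have h : is_derive x 1 (fun y => c * f y + g y) (c * derive1 f x + derive1 g x).
    exact: (is_deriveD (is_deriveZ c df) dg).
  by rewrite derive1E (@derive_val _ _ _ _ _ _ _ h).
have intE i : \int[mu]_(x in U) (w x 0 i * derive1 (fun y => c * f y + g y) x) =
    c * \int[mu]_(x in U) (w x 0 i * derive1 f x) + \int[mu]_(x in U) (w x 0 i * derive1 g x).
  rewrite -(RintegralZl c mU (if_ i)) -(RintegralD mU (integrable_RZ c mU (if_ i)) (ig i)).
  by apply: eq_Rintegral => x _; rewrite dE; ring.
apply/rowP => i; rewrite weak_derivE intE.
have rowE (p q : 'rV[R]_n) : (c *: p + q) 0 i = c * p 0 i + q 0 i by rewrite !mxE.
apply: (etrans _ (esym (rowE _ _))).
apply: (etrans _ (esym (congr2 (fun x y => c * x + y) (weak_derivE f i) (weak_derivE g i)))).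
by move: (Rintegral _ _ _) (Rintegral _ _ _) => x y /=; ring.
Qed.

End weak_derivative.

Section weak_derivative_bound.
Context {R : realType} {n : nat}.
Variables (a b : R).
Hypothesis ab : a < b.
Local Notation mu := (@lebesgue_measure R).
Local Notation I := (`]a, b[%classic : set R).
Variable U : set R.
Hypotheses (oU : open U) (UI : U `<=` I).
Variable nu0 : 'I_n -> {charge set (measurableTypeR R) -> \bar R}.
Variables v0 w : R -> 'rV[R]_n.
Hypotheses (hv0 : is_L2 I v0) (hw : is_L2 I w) (hBV : BV_deriv nu0 U v0).
Local Notation m := (variation_measure nu0).
Hypothesis penalized_le : forall N be, (0 < N)%N -> (forall k, 0 <= be k) ->
  exists P, penalized a b N be w P <= penalized a b N be v0 (cell_mean a b N v0).
Variable f : R -> R.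
Hypothesis tf : test_fun U f.

Let mI : measurable (I : set (measurableTypeR R)). Proof. exact: measurable_itv. Qed.
Let mU : measurable (U : set (measurableTypeR R)). Proof. exact: open_measurable. Qed.

Local Notation weak_deriv := (weak_deriv U w f).

Let df_bounded : exists L, forall x, `|derive1 f x| <= L.
Proof. exact: test_fun_bounded (test_fun_derive1 tf). Qed.

Let mdf : measurable_fun (I : set (measurableTypeR R)) (derive1 f).
Proof. exact: test_fun_measurable (test_fun_derive1 tf). Qed.

Let df2_integrable : mu.-integrable I (EFin \o (fun x => derive1 f x ^+ 2)).
Proof.
have [L hL] := df_bounded.
apply: (integrable_Rle mI _ _ (integrable_itv_cst a b false true (L ^+ 2))).
  exact: measurable_funX.
move=> x _; rewrite ger0_norm ?sqr_ge0//= -[leLHS]real_normK ?num_real//.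
by rewrite lerXn2r ?nnegrE// (le_trans _ (hL x)).
Qed.

Let z e : R -> 'rV[R]_n := fun x => derive1 f x *: e.

Let z_L2 e : is_L2 I (z e).
Proof.
apply/(is_L2P mI); split.
  move=> i; rewrite (_ : (fun x => _) = (fun x => derive1 f x * e 0 i)).
    exact: measurable_funM.
  by apply: funext => x; rewrite mxE.
rewrite (_ : _ \o _ = EFin \o (fun x => dotp e e * derive1 f x ^+ 2)).
  exact: integrable_RZ.
by apply: funext => x /=; rewrite /z dotpZl dotpZr; congr EFin; ring.
Qed.

Let z_sq e : Num.sqrt (L2sq I (z e)) = enorm e * Num.sqrt (\int[mu]_(x in I) derive1 f x ^+ 2).
Proof.
rewrite /L2sq /L2dot (_ : \int[mu]_(x in I) _ = dotp e e * \int[mu]_(x in I) derive1 f x ^+ 2).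
  by rewrite sqrtrM// dotp_ge0.
rewrite -RintegralZl//; apply: eq_Rintegral => x _.
by rewrite /z dotpZl dotpZr; ring.
Qed.

Let weak_deriv_L2dot e : dotp e weak_deriv = - L2dot I w (z e).
Proof.
rewrite /L2dot /dotp Rintegral_sum//; last first.
  move=> i; have h : is_L2 I (fun x => derive1 f x *: (delta_mx 0 i : 'rV[R]_n)) by exact: z_L2.
  rewrite (_ : _ \o _ = EFin \o (fun x => e 0 i * dotp (w x) (derive1 f x *: delta_mx 0 i))).
    by apply: integrable_RZ => //; exact: L2dot_integrable.
  apply: funext => x /=; congr EFin; rewrite /dotp (bigD1 i)//= big1 => [|j ji].
    by rewrite /z !mxE !eqxx/= ?mulr1n; ring.
  by rewrite !mxE eqxx (negbTE ji) !mulr0.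
rewrite -sumrN; apply: eq_bigr => i _; rewrite mxE mulrN; congr (- _).
have iw : mu.-integrable I (EFin \o (fun x => w x 0 i * derive1 f x)).
  have h : is_L2 I (fun x => derive1 f x *: (delta_mx 0 i : 'rV[R]_n)) by exact: z_L2.
  rewrite (_ : _ \o _ = EFin \o (fun x => dotp (w x) (derive1 f x *: delta_mx 0 i))).
    exact: L2dot_integrable.
  apply: funext => x /=; congr EFin; rewrite /dotp (bigD1 i)//= big1 => [|j ji].
    by rewrite /z !mxE !eqxx/= ?mulr1n; ring.
  by rewrite !mxE eqxx (negbTE ji) !mulr0.
rewrite -(Rintegral_indicM _ UI).
rewrite [RHS](_ : _ = e 0 i * \int[mu]_(x in I) (w x 0 i * derive1 f x)); last first.
  by rewrite -RintegralZl//; apply: eq_Rintegral => x _; rewrite /z mxE; ring.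
congr (_ * _); apply: eq_Rintegral => x _; rewrite indicE.
have [Ux|nUx] := boolP (x \in U); first by rewrite mul1r.
rewrite (test_fun_out (test_fun_derive1 tf)) ?mulr0//.
by move=> Ux; rewrite mem_set in nUx.
Qed.

(** w is split into w - step P, treated by Cauchy-Schwarz against f', and [step P], whose pairing
    with f' is summed by parts into f at the nodes times the jumps of P. The boundary terms vanish
    with f at a and b. *)
Lemma weak_deriv_step_le N P e : (0 < N)%N ->
  dotp e weak_deriv <= enorm e *
    (Num.sqrt (L2sq I (w - step a b N P)) * Num.sqrt (\int[mu]_(x in I) derive1 f x ^+ 2) +
     \sum_(1 <= k < N) `|f (node a b N k)| * enorm (incr P k)).
Proof.
move=> N0; have h0 : 0 < mesh a b N by exact: mesh_gt0.
have hs : is_L2 I (step a b N P) by exact: step_L2.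
have hd := is_L2B mI hw hs; have hz := z_L2 e.
rewrite weak_deriv_L2dot -[w in L2dot _ w](subrK (step a b N P)) L2dotDl// opprD mulrDr.
apply: lerD.
  apply: (le_trans (ler_norm _)); rewrite normrN; apply: (le_trans (L2dot_le mI hd hz)).
  by rewrite z_sq mulrCA.
rewrite L2dot_step// mulr_sumr -sumrN.
pose y k := f (node a b N k) *: e.
have fa (x : R) : ~ I x -> f x = 0 by move=> nIx; apply: (test_fun_out tf) => /UI.
have y0 : y 0%N = 0 by rewrite /y node0 fa ?scale0r//= in_itv/= ltxx.
have yN : y N = 0 by rewrite /y nodeN// fa ?scale0r//= in_itv/= ltxx andbF.
(* The mean of f' over a cell is the difference quotient of f between its end points. *)
have mean i : (i < N)%N -> cell_mean a b N (z e) i = (mesh a b N)^-1 *: (y i.+1 - y i).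
  move=> iN; apply/rowP => c; rewrite !mxE -mulrBl; congr (_ * _).
  have df (x : R) : is_derive x 1 f (derive1 f x).
    by apply: is_derive1_derivable; exact: smooth_derivable (test_fun_is_smooth tf).
  have cdf : continuous (derive1 f) by exact: test_fun_continuous (test_fun_derive1 tf).
  have := @Rintegral_FTC2 _ f (derive1 f) (node a b N i) (node a b N i.+1) (node_lt ab N0 (ltnSn i))
    (fun x _ => df x) (fun x _ => cdf x).
  rewrite Rintegral_itv_oo => [|]; last first.
    by apply: measurable_funTS; exact: continuous_measurable_fun.
  move=> <-; rewrite mulrC -RintegralZl//.
    by apply: eq_Rintegral => x _; rewrite /z mxE mulrC.
  apply: (@integrable_sub_itv _ _ `[node a b N i, node a b N i.+1]).
    by apply: subset_itvW; rewrite ?bnd_simp.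
  by apply: FTC2_integrable => x _; exact: cdf.
rewrite (@eq_big_nat _ _ _ 0 N _ (fun i => dotp (y i - y i.+1) (P i))); last first.
  move=> i /andP[_ iN]; rewrite mean// dotpZr mulrA divff ?gt_eqF// mul1r dotpC -dotpNl opprB.
  by [].
rewrite sum_by_parts// [leRHS]mulr_sumr; apply: ler_sum => k _; rewrite /y dotpZl mulrCA.
apply: (le_trans (ler_norm _)); rewrite normrM ler_wpM2l//.
rewrite ler_norml; apply/andP; split; last exact: dotp_le.
by rewrite lerNl -dotpNl -(enormN e) dotp_le.
Qed.

(* The weights of the penalisation are chosen so that the arithmetic-geometric
   inequality turns the quadratic estimate on the increments into the linear one. *)
Lemma weak_deriv_mesh_le N M eps e : (0 < N)%N -> 0 < eps -> (forall x, `|f x| <= M) ->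
  let d0 := L2sq I (v0 - step a b N (cell_mean a b N v0)) in
  let S0 := \sum_(1 <= k < N) `|f (node a b N k)| * enorm (incr (cell_mean a b N v0) k) in
  dotp e weak_deriv <= enorm e *
    (Num.sqrt (d0 + eps * S0) * Num.sqrt (\int[mu]_(x in I) derive1 f x ^+ 2) +
     (S0 + d0 / eps + eps * M)).
Proof.
move=> N0 eps0 fM; set d := L2sq _ _; set S := \sum_(_ <= _ < _) _ => /=.
have h0 : 0 < mesh a b N by exact: mesh_gt0.
have Np : 0 < N%:R :> R by rewrite ltr0n.
pose fk k := `|f (node a b N k)|; pose D k := enorm (incr (cell_mean a b N v0) k).
(* [eta] keeps the denominators positive when a jump of v0 vanishes; summed over at most N edges it
   costs eps M. *)
pose eta : R := eps / N%:R; have eta0 : 0 < eta by rewrite divr_gt0.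
have D0 k : 0 <= D k by exact: enorm_ge0.
have f0 k : 0 <= fk k by exact: normr_ge0.
have De k : 0 < D k + eta by rewrite ltr_wpDl.
pose be k := eps * fk k / (mesh a b N * (D k + eta)).
have be0 k : 0 <= be k by rewrite divr_ge0// mulr_ge0// ltW.
have [P] := penalized_le N0 be0; rewrite /penalized -/d => hP.
have hbe k : mesh a b N * be k = eps * (fk k / (D k + eta)).
  by rewrite /be; field; rewrite !gt_eqF.
have h1 : mesh a b N * \sum_(1 <= k < N) be k * enorm (incr (cell_mean a b N v0) k) ^+ 2 <= eps * S.
  rewrite !mulr_sumr; apply: ler_sum => k _; rewrite mulrA hbe -mulrA ler_wpM2l ?(ltW eps0)//.
  rewrite -mulrA ler_wpM2l ?f0// -/(D k) expr2 mulrA ler_piMl// mulrC ler_pdivrMr// mul1r.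
  by rewrite lerDl ltW.
have Q0 : 0 <= \sum_(1 <= k < N) be k * enorm (incr P k) ^+ 2.
  by apply: sumr_ge0 => k _; rewrite mulr_ge0// sqr_ge0.
set A := L2sq I (w - step a b N P) in hP; set Q := mesh a b N * _ in hP.
have {}Q0 : 0 <= Q by rewrite mulr_ge0// ltW.
have A0 : 0 <= A by exact: L2sq_ge0.
have AQ : A + Q <= d + eps * S by apply: (le_trans hP); rewrite lerD2l.
have sumle : \sum_(1 <= k < N) fk k * enorm (incr P k) <= S + d / eps + eps * M.
  (* This is q <= (q^2 / r + r) / 2 with q the jump of P and r = D k + eta. The quadratic half is
     the penalty divided by eps. *)
  have term k : fk k * enorm (incr P k) <=
      2^-1 * (eps^-1 * (mesh a b N * be k * enorm (incr P k) ^+ 2)) + 2^-1 * (fk k * D k + fk k * eta).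
    rewrite hbe -mulrDr -(mulrDr (fk k)) !mulrA mulVf ?gt_eqF// mul1r -!mulrA.
    rewrite -mulrDr mulrCA ler_wpM2l ?f0//.
    set q := enorm _; set r := D k + eta; have r0 : 0 < r by exact: De.
    have -> : r^-1 * q ^+ 2 + r = 2 * q + (q - r) ^+ 2 / r by field; rewrite gt_eqF.
    by rewrite mulrDr mulKf ?pnatr_eq0// lerDl mulr_ge0// divr_ge0 ?sqr_ge0// ltW.
  apply: (@le_trans _ _ (2^-1 * (eps^-1 * Q) + 2^-1 * (S + N%:R * (M * eta)))).
    apply: (le_trans (ler_sum _ (fun k _ => term k))); rewrite big_split/= -!mulr_sumr.
    rewrite /Q [mesh a b N * \sum_(_ <= _ < _) _]mulr_sumr (eq_bigr (fun k => mesh a b N * (be k * enorm (incr P k) ^+ 2))); last first.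
      by move=> k _; rewrite -mulrA.
    rewrite lerD2l ler_pM2l ?invr_gt0// big_split/= lerD2l -mulr_suml.
    rewrite mulrA ler_wpM2r ?(ltW eta0)//.
    apply: (@le_trans _ _ (\sum_(1 <= k < N) M)); first by apply: ler_sum => k _; exact: fM.
    rewrite sumr_const_nat -[leLHS]mulr_natl ler_wpM2r ?ler_nat ?leq_subr//.
    exact: le_trans (fM 0).
  have -> : N%:R * (M * eta) = eps * M by rewrite /eta; field; rewrite gt_eqF.
  have : eps^-1 * Q <= d / eps + S.
    rewrite mulrC ler_pdivrMr// mulrDl divfK ?gt_eqF// (mulrC S).
    by apply: le_trans AQ; rewrite lerDr.
  have : 0 <= d / eps by rewrite divr_ge0 ?L2sq_ge0// ltW.
  have : 0 <= eps * M by rewrite mulr_ge0 ?(ltW eps0)// (le_trans _ (fM 0)).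
  by move: (eps * M) (d / eps) (eps^-1 * Q) => x1 x2 x3; clearbody S; lra.
apply: (le_trans (weak_deriv_step_le P e N0)); rewrite ler_wpM2l ?enorm_ge0// lerD//.
rewrite ler_wpM2r ?sqrtr_ge0// ler_wsqrtr//.
by apply: le_trans AQ; rewrite lerDl.
Qed.

(** As N grows all the errors of [weak_deriv_mesh_le] vanish, while the weighted jumps of v0 stay
    below the integral of |f| up to a multiple of the mesh. *)
Lemma enorm_weak_deriv_le : enorm weak_deriv <= \int[m]_(x in U) `|f x|.
Proof.
have [L [M [L0 M0 fM hS]]] := weighted_incr_le ab oU hBV tf.
set J := \int[m]_(x in U) `|f x|; have J0 : 0 <= J by apply: Rintegral_ge0.
apply: enorm_le_dual => // e.
pose d N := L2sq I (v0 - step a b N.+1 (cell_mean a b N.+1 v0)).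
have d0 N : 0 <= d N by exact: L2sq_ge0.
have cd : d N @[N --> \oo] --> (0 : R) by exact: L2sq_cell_mean_cvg.
(* The choice of eps: it tends to 0, and so does d / eps <= sqrt d. The harmonic term keeps it
   positive when d vanishes. *)
pose s N := Num.sqrt (d N) + N.+1%:R^-1.
have s0 N : 0 < s N by rewrite ltr_wpDl ?sqrtr_ge0// invr_gt0.
have cq : Num.sqrt (d N) @[N --> \oo] --> (0 : R).
  by rewrite -(sqrtr0 R); apply: cvg_comp cd _; exact: sqrt_continuous.
have cs : s N @[N --> \oo] --> (0 : R).
  by rewrite -(addr0 0); apply: cvgD cq _; exact: cvg_harmonic.
pose B N := J + L * mesh a b N.+1.
have cB : B N @[N --> \oo] --> J.
  rewrite -[X in _ --> X]addr0; apply: cvgD; first exact: cvg_cst.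
  by rewrite -(mulr0 L); apply: cvgMr; exact: mesh_cvg0.
set l := Num.sqrt (\int[mu]_(x in I) derive1 f x ^+ 2).
have cv : enorm e * (Num.sqrt (d N + s N * B N) * l + (B N + Num.sqrt (d N) + s N * M))
    @[N --> \oo] --> enorm e * (Num.sqrt (0 + 0 * J) * l + (J + 0 + 0 * M)).
  apply: cvgMr; apply: cvgD.
    apply: cvgMl; apply: (@cvg_comp _ _ _ (fun N => d N + s N * B N) Num.sqrt).
      by apply: cvgD cd _; exact: cvgM cs cB.
    exact: sqrt_continuous.
  by apply: cvgD; [exact: cvgD cB cq|exact: cvgMl].
rewrite mul0r addr0 sqrtr0 !mul0r add0r !addr0 in cv; rewrite mulrC.
apply: (ler_cvg_to (cvg_cst _) cv); near=> N.
have h := weak_deriv_mesh_le e (ltn0Sn N) (s0 N) fM; cbv zeta in h; apply: (le_trans h).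
rewrite ler_wpM2l ?enorm_ge0//.
have SB : \sum_(1 <= k < N.+1) `|f (node a b N.+1 k)| *
    enorm (incr (cell_mean a b N.+1 v0) k) <= B N by near: N; exact: hS.
apply: lerD.
  by rewrite ler_wpM2r ?sqrtr_ge0// ler_wsqrtr// lerD2l ler_pM2l.
rewrite lerD2r lerD// ler_pdivrMr//.
rewrite -/(d N) -[leLHS](sqr_sqrtr (d0 N)) expr2 ler_wpM2l ?sqrtr_ge0//.
by rewrite lerDl invr_ge0.
Unshelve. all: by end_near. Qed.

End weak_derivative_bound.

(** * Representation by charges *)

Section test_function_algebra.
Context {R : realType}.
Variable U : set R.
Implicit Types f g : R -> R.

Lemma test_fun_lin c f g : test_fun U f -> test_fun U g ->
  test_fun U (fun x => c * f x + g x).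
Proof.
move=> tf tg; have sf := test_fun_is_smooth tf; have sg := test_fun_is_smooth tg.
have [_ [K [cK KU f0]]] := tf; have [_ [L [cL LU g0]]] := tg.
apply: (@test_fun_smooth _ U (K `|` L)).
- exact: (smoothD (smoothZ c sf) sg).
- exact: compactU.
- by move=> x [/KU|/LU].
- by move=> x /not_orP[nK nL]; rewrite f0// g0// mulr0 addr0.
Qed.

Lemma test_fun_mul g f : smooth g -> test_fun U f -> test_fun U (fun x => g x * f x).
Proof.
move=> sg tf; have sf := test_fun_is_smooth tf; have [_ [K [cK KU f0]]] := tf.
apply: (test_fun_smooth _ cK KU); first exact: (smoothM sg sf).
by move=> x nK; rewrite f0// mulr0.
Qed.

Lemma test_fun0 : test_fun U (cst 0).
Proof.
by apply: (@test_fun_smooth _ U set0) => //; [exact: smooth_cst|exact: compact0].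
Qed.

(** Cutoffs of the rational closed intervals contained in U are joined by z + be - z be, so that 1 -
    z is the product of the 1 - be. One interval with x in its interior is then enough for the limit
    1 at x. *)
Lemma test_fun_exhaustion : open U -> exists z : nat -> R -> R,
  [/\ forall k, test_fun U (z k), forall k x, 0 <= z k x <= 1 &
    forall x, U x -> z k x @[k --> \oo] --> (1 : R)].
Proof.
move=> oU.
(* [unpickle] enumerates the pairs of rationals; numbers coding no pair and intervals not contained
   in U contribute 0. *)
pose be (j k : nat) (x : R) : R := if (unpickle j : option (rat * rat)) is Some pq then
  if `[< `[ratr pq.1, ratr pq.2]%classic `<=` U >] then
    plateau (ratr pq.2 - ratr pq.1) k (x - ratr pq.1) else 0 else 0.
have be01 j k x : 0 <= be j k x <= 1.
  rewrite /be; case: unpickle => [pq|]; last by rewrite lexx ler01.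
  by case: ifP => _; rewrite ?lexx ?ler01// plateau_ge0 plateau_le1.
have tbe j k : test_fun U (be j k).
  rewrite /be; case: unpickle => [pq|]; last exact: test_fun0.
  case: asboolP => [sub|_]; last exact: test_fun0.
  apply: (@test_fun_smooth _ U `[ratr pq.1, ratr pq.2]%classic) => //.
  - rewrite (_ : (fun x => plateau _ k (x - ratr pq.1)) =
        (fun x => plateau (ratr pq.2 - ratr pq.1) k (1 * x + - ratr pq.1))).
      exact: smooth_affine (smooth_plateau _ k).
    by apply: funext => y; rewrite mul1r.
  - exact: segment_compact.
  - move=> x nx; apply: plateau_out; apply/negP => /andP[h1 h2]; apply: nx.
    by rewrite /= in_itv/= -subr_ge0 (ltW h1)/= -(lerD2r (- ratr pq.1)) ltW.
pose z := fix z J (k : nat) (x : R) : R :=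
  if J is J'.+1 then z J' k x + be J' k x - z J' k x * be J' k x else 0.
have zS J k x : 1 - z J.+1 k x = (1 - z J k x) * (1 - be J k x) by rewrite /=; ring.
have z01 J k x : 0 <= z J k x <= 1.
  elim: J => [|J /andP[h1 h2]]; first by rewrite lexx ler01.
  have /andP[h3 h4] := be01 J k x; have e := zS J k x.
  have h5 : 0 <= (1 - z J k x) * (1 - be J k x) by rewrite mulr_ge0 ?subr_ge0.
  have h6 : (1 - z J k x) * (1 - be J k x) <= 1.
    by rewrite -[leRHS]mulr1 ler_pM ?subr_ge0// gerBl.
  by apply/andP; split; lra.
(* On the diagonal the first k intervals enter, each with sharpness k, so every fixed interval is
   eventually present and its cutoff tends to the indicator. *)
exists (fun k => z k k); split => [k|//|x Ux].
- elim: {1}k => [|J ih]; first exact: test_fun0.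
  have -> : z J.+1 k = (fun x => 1 * z J k x + (-1 * (z J k x * be J k x) + be J k x)).
    by apply: funext => x /=; ring.
  apply: test_fun_lin => //; apply: test_fun_lin => //; apply: test_fun_mul => //.
  exact: test_fun_is_smooth ih.
- have [e /= e0 he] := open_nbhs_nbhs (conj oU Ux).
  have [p + _] : exists2 p : rat, ratr p \in `]x - e, x[ & true.
    by have [|p hp] := @rat_in_itvoo R (x - e) x; [rewrite gtrBl|exists p].
  rewrite in_itv/= => /andP[p1 p2].
  have [q + _] : exists2 q : rat, ratr q \in `]x, x + e[ & true.
    by have [|q hq] := @rat_in_itvoo R x (x + e); [rewrite ltrDl|exists q].
  rewrite in_itv/= => /andP[q1 q2].
  pose j := pickle (p, q).
  have bej k : be j k x = plateau (ratr q - ratr p) k (x - ratr p).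
    rewrite /be /j pickleK /= ifT//; apply/asboolP => y; rewrite /= in_itv/= => /andP[y1 y2].
    apply: he; rewrite /= ltr_norml; apply/andP; split; lra.
  have cb : be j k x @[k --> \oo] --> (1 : R).
    under eq_fun do rewrite bej.
    have := @plateau_cvg _ (ratr q - ratr p) (x - ratr p); rewrite indicE mem_set//.
    by rewrite /= in_itv/= subr_gt0 p2/= ltrD2r.
  have le J k : (j < J)%N -> 1 - z J k x <= 1 - be j k x.
    elim: J => [//|J ih]; rewrite ltnS leq_eqVlt zS => /predU1P[<-|/ih h].
      rewrite ler_piMl//; last by have /andP[] := z01 j k x; lra.
      by have /andP[] := be01 j k x; lra.
    apply: le_trans h; rewrite ler_piMr//; last by have /andP[] := be01 J k x; lra.
    by have /andP[] := z01 J k x; lra.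
  apply: (@squeeze_cvgr _ _ _ _ (fun k => be j k x) (cst 1)) => //; last exact: cvg_cst.
  near=> k; apply/andP; split; last by have /andP[] := z01 k k x.
  by rewrite -lerN2 -(lerD2l 1); apply: le; near: k; exists j.+1.
Unshelve. all: by end_near. Qed.

End test_function_algebra.

(** * Density of test functions in L^1 of a finite measure *)

Section density.
Context {R : realType}.
Local Notation mT := (measurableTypeR R).
Variable U : set R.
Hypothesis oU : open U.
Variable m : {finite_measure set mT -> \bar R}.
Implicit Types f g : R -> R.

Let mU : measurable (U : set mT). Proof. exact: open_measurable. Qed.

Local Notation L1 g := (\int[m]_(x in U) `|g x|).
Local Notation integ g := (m.-integrable U (EFin \o (g : R -> R))).

Definition approximable g := integ g /\ forall e, 0 < e ->
  exists f, test_fun U f /\ L1 (fun x => g x - f x) <= e.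

Lemma test_fun_integrable f : test_fun U f -> integ f.
Proof.
move=> tf; have [M fM] := test_fun_bounded tf.
by apply: (@bounded_integrable _ _ _ _ M) => //; exact: test_fun_measurable tf.
Qed.

Lemma indic_integrable (E : set mT) : measurable E -> integ (\1_E).
Proof.
move=> mE; apply: (@bounded_integrable _ _ _ _ 1) => //.
by move=> x _; rewrite indicE ger0_norm ?ler0n//; case: (_ \in _).
Qed.

Lemma L1_integrable g : integ g -> integ (fun x => `|g x|).
Proof. exact: integrable_norm. Qed.

Lemma L1_le g h : integ g -> integ h -> (forall x, U x -> `|g x| <= h x) ->
  L1 g <= \int[m]_(x in U) h x.
Proof. by move=> ig ih gh; apply: le_Rintegral => //; exact: L1_integrable. Qed.

Lemma L1D g h k : integ g -> integ h -> integ k ->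
  (forall x, U x -> `|k x| <= `|g x| + `|h x|) -> L1 k <= L1 g + L1 h.
Proof.
move=> ig ih ik kgh; have ig' := L1_integrable ig; have ih' := L1_integrable ih.
by rewrite -RintegralD//; apply: L1_le => //; exact: integrable_RD.
Qed.

Lemma L1Z c g : integ g -> L1 (fun x => c * g x) = `|c| * L1 g.
Proof.
move=> ig; rewrite -RintegralZl//; last exact: L1_integrable.
by apply: eq_Rintegral => x _; rewrite normrM.
Qed.

Lemma integrable_lin c g h : integ g -> integ h -> integ (fun x => c * g x + h x).
Proof. by move=> ig ih; apply: integrable_RD => //; exact: integrable_RZ. Qed.

Lemma test_approximable f : test_fun U f -> approximable f.
Proof.
move=> tf; split => [|e e0]; first exact: test_fun_integrable.
exists f; split => //; rewrite (@eq_Rintegral _ _ _ m U (cst 0)) ?Rintegral_cst ?mul0r ?ltW//.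
by move=> x _; rewrite subrr normr0.
Qed.

Lemma approximable_lin c g h : approximable g -> approximable h ->
  approximable (fun x => c * g x + h x).
Proof.
move=> [ig ag] [ih ah]; split => [|e e0]; first exact: integrable_lin.
have c0 : 0 < `|c| + 1 by rewrite ltr_wpDl.
have [|f [tf hf]] := ag (e / (2 * (`|c| + 1))); first by rewrite divr_gt0// mulr_gt0.
have [|k [tk hk]] := ah (e / 2); first by rewrite divr_gt0.
have if_ := test_fun_integrable tf; have ik := test_fun_integrable tk.
exists (fun x => c * f x + k x); split; first exact: test_fun_lin.
have igf := integrable_RB mU ig if_; have ihk := integrable_RB mU ih ik.
apply: (@le_trans _ _ (L1 (fun x => c * (g x - f x)) + L1 (fun x => h x - k x))).
  apply: L1D => //; first exact: integrable_RZ.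
    by apply: integrable_RB => //; exact: integrable_lin.
  move=> x _; apply: le_trans (ler_normD _ _); rewrite le_eqVlt; apply/predU1P; left.
  by congr (`|_|); ring.
rewrite L1Z// [leRHS]splitr lerD//.
apply: (@le_trans _ _ (`|c| * (e / (2 * (`|c| + 1))))); first by rewrite ler_wpM2l.
rewrite mulrA ler_pdivrMr ?mulr_gt0// (_ : e / 2 * _ = (`|c| + 1) * e); last by field.
by rewrite ler_pM2r// lerDl.
Qed.

Lemma approximable_closed g : integ g -> (forall e, 0 < e -> exists h, approximable h /\
  L1 (fun x => g x - h x) <= e) -> approximable g.
Proof.
move=> ig ag; split => // e e0; have e2 : 0 < e / 2 by rewrite divr_gt0.
have [h [[ih ah] gh]] := ag _ e2; have [f [tf hf]] := ah _ e2.
have if_ := test_fun_integrable tf.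
exists f; split => //; rewrite [leRHS]splitr; apply: le_trans (lerD gh hf).
apply: L1D; try exact: integrable_RB.
move=> x _; apply: le_trans (ler_normD _ _); rewrite le_eqVlt; apply/predU1P; left.
by congr (`|_|); ring.
Qed.

Lemma L1_cvg0 (h : nat -> R -> R) g M : measurable_fun U g ->
  (forall k, measurable_fun U (h k)) -> (forall x, U x -> h k x @[k --> \oo] --> g x) ->
  (forall k x, U x -> `|g x - h k x| <= M) -> L1 (fun x => g x - h k x) @[k --> \oo] --> (0 : R).
Proof.
move=> mg mh hg hM.
have [||||_] := @Rdominated_cvg _ _ _ m U (fun k x => `|g x - h k x|) (cst 0) (cst M) mU.
- by move=> k; apply: measurableT_comp => //; apply: measurable_funB => //; exact: mh.
- move=> x Ux; rewrite (_ : cst 0 x = `|g x - g x|); last by rewrite subrr normr0.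
  by apply: cvg_norm; apply: cvgB; [exact: cvg_cst|exact: hg].
- by move=> k x Ux; rewrite normr_id; exact: hM.
- exact: finite_measure_integrable_cst.
by rewrite Rintegral_cst// mul0r.
Qed.

Lemma approximable_cvg (h : nat -> R -> R) g M : integ g -> (forall k, approximable (h k)) ->
  (forall x, U x -> h k x @[k --> \oo] --> g x) ->
  (forall k x, U x -> `|g x - h k x| <= M) -> approximable g.
Proof.
move=> ig ah hg hM; apply: approximable_closed => // e e0.
have mh k := integrable_Rmeasurable (ah k).1.
have := L1_cvg0 (integrable_Rmeasurable ig) mh hg hM.
move=> /(@cvgr0_norm_le _ _ _ _ _ _) /(_ _ e0)[k _ /(_ k (leqnn k)) hk].
by exists (h k); split => //; apply: le_trans hk; exact: ler_norm.
Qed.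

Lemma indic_sum_cvg (F : nat -> set mT) x : trivIset setT F ->
  \sum_(0 <= k < N) 1 * \1_(F k) x @[N --> \oo] --> (\1_(\bigcup_k F k) x : R).
Proof.
move=> tF; rewrite indicE; apply: cvg_near_cst.
have [Fx|nFx] := boolP (x \in \bigcup_k F k); last first.
  near=> N; rewrite big1// => k _; rewrite indicE memNset ?mulr0// => Fk.
  by move/negP: nFx; apply; rewrite inE; exists k.
move: Fx; rewrite inE => -[k _ Fk]; near=> N.
have kN : (k < N)%N by near: N; exists k.+1.
rewrite (bigD1_seq k) ?mem_index_iota ?iota_uniq//= indicE mem_set// big1 ?addr0 ?mulr1// => j jk.
rewrite indicE memNset ?mulr0// => Fj; move/eqP: jk; apply.
by apply: tF => //; exists x.
Unshelve. all: by end_near. Qed.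

Lemma indic_sum_bound (F : nat -> set mT) N x : trivIset setT F ->
  `|\1_(\bigcup_k F k) x - \sum_(0 <= k < N) 1 * \1_(F k) x| <= (1 : R).
Proof.
move=> tF; rewrite (eq_bigr (fun k => \1_(F k) x * 1)) => [|k _]; last by rewrite mulrC.
have h1 : \sum_(0 <= k < N) \1_(F k) x * 1 <= (1 : R).
  apply: sum_disjoint_indic_le => //; first exact: iota_uniq.
  by move=> j k Fj Fk; apply: tF => //; exists x.
have h2 : 0 <= \sum_(0 <= k < N) \1_(F k) x * (1 : R).
  by apply: sumr_ge0 => k _; rewrite mulr1 indicE ler0n.
have h5 : 0 <= (\1_(\bigcup_k F k) x : R) <= 1.
  by rewrite indicE ler0n; case: (_ \in _); rewrite ?lexx ?ler01.
by move/andP: h5 => [h5 h6]; rewrite ler_norml; apply/andP; split; lra.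
Qed.

Lemma approximable_sum (J : Type) (s : seq J) (c : J -> R) (F : J -> R -> R) :
  (forall j, approximable (F j)) -> approximable (fun x => \sum_(j <- s) c j * F j x).
Proof.
move=> aF; elim: s => [|j s ih].
  rewrite (_ : (fun x => _) = cst 0); first exact: test_approximable (test_fun0 U).
  by apply: funext => x; rewrite big_nil.
rewrite (_ : (fun x => _) = (fun x => c j * F j x + \sum_(j <- s) c j * F j x)).
  exact: approximable_lin.
by apply: funext => x; rewrite big_cons.
Qed.

(** A Dynkin class argument from the half-open intervals. Complements use that the constant 1 is
    approximable, and countable disjoint unions use dominated convergence. *)
Lemma indic_approximable (E : set mT) : measurable E -> approximable \1_E.
Proof.
have [z [tz z01 cz]] := test_fun_exhaustion oU.
have one : approximable (cst 1).
  apply: (@approximable_cvg z _ 1) => //; first exact: finite_measure_integrable_cst.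
    by move=> k; exact: test_approximable.
  move=> k x _; have /andP[h1 h2] := z01 k x.
  by rewrite ger0_norm ?subr_ge0// gerBl.
have itv x y : approximable \1_(`]x, y]%classic : set R).
  (* The two flat factors tend to the indicator of ]x, y], and [z k] cuts the product down to a test
     function on U. *)
  apply: (@approximable_cvg (fun k (t : R) => (flat (k.+1%:R * (t - x)) * (1 - flat (k.+1%:R * (t - y)))) * z k t) _ 1).
  - exact: indic_integrable (measurable_itv _).
  - move=> k; apply: test_approximable; apply: test_fun_mul => //.
    have aff (c : R) : smooth (fun t : R => flat (k.+1%:R * (t - c))).
      rewrite (_ : (fun t => _) = (fun t => flat (k.+1%:R * t + - (k.+1%:R * c)))).
        exact: (smooth_affine _ _ (@smooth_flat R)).
      by apply: funext => t; rewrite mulrBr.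
    by apply: (smoothM (aff x)); apply: smoothB; [exact: smooth_cst|exact: aff].
  - move=> t Ut; have czt := cz t Ut; rewrite indicE.
    have one_or_zero (c : R) : flat (k.+1%:R * (t - c)) @[k --> \oo] --> ((c < t)%R%:R : R).
      have [ct|tc] := ltP c t; first by apply: flat_cvg1; rewrite subr_gt0.
      apply: cvg_near_cst; near=> k; apply: flat_le0.
      by rewrite mulr_ge0_le0// subr_le0.
    rewrite (_ : (_ \in _)%:R = ((x < t)%R%:R * (1 - (y < t)%R%:R)) * 1); last first.
      rewrite mulr1 mem_setE in_itv/= (leNgt t y).
      by case: (x < t); case: (y < t) => /=; rewrite ?subrr ?subr0 ?mulr0 ?mul0r ?mul1r.
    apply: cvgM => //; apply: cvgM; first exact: one_or_zero.
    by apply: cvgB; [exact: cvg_cst|exact: one_or_zero].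
  - move=> k t _; have /andP[h1 h2] := z01 k t.
    have := flat_ge0 (k.+1%:R * (t - x)); have := flat_le1 (k.+1%:R * (t - x)).
    have := flat_ge0 (k.+1%:R * (t - y)); have := flat_le1 (k.+1%:R * (t - y)).
    move: (flat _) (flat _) => p q q1 q0 p1 p0.
    have h3 : 0 <= p * (1 - q) * z k t by rewrite !mulr_ge0// subr_ge0.
    have h4 : p * (1 - q) * z k t <= 1.
      rewrite -[leRHS]mulr1 ler_pM ?mulr_ge0 ?subr_ge0//.
      by rewrite -[leRHS]mulr1 ler_pM ?subr_ge0// gerBl.
    have h5 : 0 <= (\1_(`]x, y]%classic : set R) t : R) <= 1.
      by rewrite indicE ler0n; case: (_ \in _); rewrite ?lexx ?ler01.
    by move/andP: h5 => [h5 h6]; rewrite ler_norml; apply/andP; split; lra.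
move=> mE; move: E mE; apply: (@dynkin_induction _ mT (@ocitv R)) => //.
- exact: ocitvI.
- by rewrite indicT.
- by move=> _ [[x y] _ <-]; exact: itv.
- move=> S mS aS; rewrite (_ : \1_(~` S) = (fun x => -1 * \1_S x + cst 1 x)).
    exact: approximable_lin.
  by apply: funext => x; rewrite !indicE in_setC; case: (_ \in _); rewrite /= ; lra.
- move=> F mF tF aF.
  apply: (@approximable_cvg (fun N x => \sum_(0 <= k < N) 1 * \1_(F k) x) _ 1).
  + by apply: indic_integrable; exact: bigcupT_measurable.
  + by move=> N; exact: approximable_sum.
  + by move=> x _; exact: indic_sum_cvg.
  + by move=> N x _; exact: indic_sum_bound.
Unshelve. all: by end_near. Qed.

End density.

Section charge_of_set_function.
Context d (T : measurableType d) (R : realType).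
Variable F : set T -> R.
Hypotheses (F0 : F set0 = 0)
  (F_sigma : forall A : nat -> set T, (forall k, measurable (A k)) -> trivIset setT A ->
    \sum_(0 <= k < N) F (A k) @[N --> \oo] --> F (\bigcup_k A k)).

Lemma charge_of_sigma_additive : exists nu : {charge set T -> \bar R}, forall A, nu A = (F A)%:E.
Proof.
pose nu A := (F A)%:E.
have nu0 : nu set0 = 0%E by rewrite /nu F0.
have nu_finite A : measurable A -> nu A \is a fin_num by [].
have nu_sigma_additive : semi_sigma_additive nu.
  move=> A mA tA _; rewrite (_ : (fun N => _) = EFin \o (fun N => \sum_(0 <= k < N) F (A k))).
    by apply: cvg_EFin; [exact: nearW|exact: F_sigma].
  by apply: funext => N; rewrite /= -sumEFin.
pose mx := isCharge.Build _ _ _ nu nu0 nu_finite nu_sigma_additive.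
pose c : {charge set T -> \bar R} := HB.pack nu mx.
by exists c.
Qed.

End charge_of_set_function.

(** * Charges representing a bounded functional on test functions *)

Section functional_extension.
Context {R : realType} {n : nat}.
Local Notation mT := (measurableTypeR R).
Variable U : set R.
Hypothesis oU : open U.
Variable m : {finite_measure set mT -> \bar R}.
Implicit Types f g : R -> R.
Variable T : (R -> R) -> 'rV[R]_n.
Local Notation L1 g := (\int[m]_(x in U) `|g x|).
Hypothesis T_lin : forall c f g, test_fun U f -> test_fun U g ->
  T (fun x => c * f x + g x) = c *: T f + T g.
Hypothesis T_le : forall f, test_fun U f -> enorm (T f) <= L1 f.
Local Notation integ g := (m.-integrable U (EFin \o (g : R -> R))).
Local Notation approximable := (approximable U m).

Let mU : measurable (U : set mT). Proof. exact: open_measurable. Qed.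
Let integ_test f : test_fun U f -> integ f. Proof. exact: test_fun_integrable. Qed.

Lemma functional_dist f g i : test_fun U f -> test_fun U g ->
  `|T f 0 i - T g 0 i| <= L1 (fun x => f x - g x).
Proof.
move=> tf tg; have -> : T f 0 i - T g 0 i = T (fun x => -1 * g x + f x) 0 i.
  by rewrite T_lin// !mxE mulN1r addrC.
apply: (le_trans (coord_le_enorm _ _)); apply: (le_trans (T_le (test_fun_lin _ tg tf))).
by rewrite le_eqVlt; apply/predU1P; left; apply: eq_Rintegral => x _; congr (`|_|); ring.
Qed.

(* The extension of T to integrable functions by the infimal-convolution formula
   of McShane; it is linear where test functions are dense. *)
Definition ext i g : R :=
  sup [set T f 0 i - L1 (fun x => g x - f x) | f in test_fun U].

Lemma ext_dist i g f : integ g -> test_fun U f -> `|T f 0 i - ext i g| <= L1 (fun x => g x - f x).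
Proof.
move=> ig tf; pose S := [set T f 0 i - L1 (fun x => g x - f x) | f in test_fun U].
have ub h : test_fun U h -> ubound S (T h 0 i + L1 (fun x => g x - h x)).
  move=> th _ [k tk <-]; rewrite lerBlDr -addrA -lerBlDl.
  apply: (le_trans (ler_norm _)); apply: (le_trans (functional_dist _ tk th)).
  have ih := integ_test th; have ik := integ_test tk.
  apply: (L1D oU); try exact: integrable_RB.
  move=> x _; apply: le_trans (ler_normB _ _); rewrite le_eqVlt; apply/predU1P; left.
  by congr (`|_|); ring.
have Sf : S (T f 0 i - L1 (fun x => g x - f x)) by exists f.
have h1 : T f 0 i - L1 (fun x => g x - f x) <= ext i g.
  by apply: ub_le_sup => //; exists (T f 0 i + L1 (fun x => g x - f x)); exact: ub.
have h2 : ext i g <= T f 0 i + L1 (fun x => g x - f x).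
  by apply: ge_sup; [exists (T f 0 i - L1 (fun x => g x - f x))|exact: ub].
by rewrite ler_norml; apply/andP; split; lra.
Qed.

Lemma ext_test i f : test_fun U f -> ext i f = T f 0 i.
Proof.
move=> tf; apply/eqP; rewrite eq_sym -subr_eq0 -normr_le0.
apply: (le_trans (ext_dist i (integ_test tf) tf)).
rewrite (@eq_Rintegral _ _ _ m U (cst 0)) ?Rintegral_cst ?mul0r//.
by move=> x _; rewrite subrr normr0.
Qed.

Let eq_of_small (x y K : R) : 0 <= K -> (forall e, 0 < e -> `|x - y| <= K * e) -> x = y.
Proof.
move=> K0 h; apply/eqP; rewrite -subr_eq0 -normr_le0; apply/ler_addgt0Pr => e e0.
rewrite add0r; have K1 : 0 < K + 1 by rewrite ltr_wpDl.
have := h (e / (K + 1)); rewrite divr_gt0// => /(_ isT)/le_trans; apply.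
by rewrite mulrA ler_pdivrMr// mulrC ler_pM2l// lerDl.
Qed.

Lemma ext_lin i c g h : approximable g -> approximable h ->
  ext i (fun x => c * g x + h x) = c * ext i g + ext i h.
Proof.
move=> [ig ag] [ih ah]; apply: (@eq_of_small _ _ (2 * (`|c| + 1))).
  by rewrite mulr_ge0// addr_ge0.
move=> e e0; have [f [tf hf]] := ag e e0; have [k [tk hk]] := ah e e0.
have if_ := integ_test tf; have ik := integ_test tk.
have igf := integrable_RB mU ig if_; have ihk := integrable_RB mU ih ik.
have d1 := ext_dist i ig tf; have d2 := ext_dist i ih tk.
have d3 := ext_dist i (integrable_lin oU c ig ih) (test_fun_lin c tf tk).
rewrite T_lin// !mxE in d3.
have d4 : L1 (fun x => c * g x + h x - (c * f x + k x)) <= `|c| * e + e.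
  apply: (@le_trans _ _ (L1 (fun x => c * (g x - f x)) + L1 (fun x => h x - k x))).
    apply: (L1D oU) => //; first exact: integrable_RZ.
      by apply: integrable_RB => //; exact: integrable_lin.
    move=> x _; apply: le_trans (ler_normD _ _); rewrite le_eqVlt; apply/predU1P; left.
    by congr (`|_|); ring.
  by rewrite L1Z// lerD// ler_wpM2l.
have d5 : `|c * (T f 0 i - ext i g)| <= `|c| * e by rewrite normrM ler_wpM2l// (le_trans d1).
have {}d3 := le_trans d3 d4; have {}d2 := le_trans d2 hk.
rewrite mulrBr in d5.
rewrite (_ : 2 * (`|c| + 1) * e = (`|c| * e + e) + (`|c| * e + e)); last by ring.
rewrite (_ : _ - _ = ((c * T f 0 i - c * ext i g) + (T k 0 i - ext i h)) -
  (c * T f 0 i + T k 0 i - ext i (fun x => c * g x + h x))); last by ring.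
apply: (le_trans (ler_normB _ _)); apply: lerD => //.
by apply: (le_trans (ler_normD _ _)); apply: lerD.
Qed.

Lemma enorm_ext_le g : approximable g -> enorm (\row_i ext i g) <= L1 g.
Proof.
move=> [ig ag]; apply/ler_addgt0Pr => e e0.
have np : 0 < n%:R + 1 :> R by rewrite ltr_wpDl.
(* The error e / (n + 1) is spent once on the L^1 norm and once for each of the n coordinates. *)
have [|f [tf hf]] := ag (e / (n%:R + 1)); first by rewrite divr_gt0.
set d := e / _ in hf; have if_ := integ_test tf.
rewrite (_ : \row_i _ = T f - (T f - \row_i ext i g)); last by rewrite subKr.
apply: (le_trans (enormB _ _)).
have h1 : enorm (T f) <= L1 g + d.
  apply: (le_trans (T_le tf)); apply: le_trans (lerD (lexx _) hf).
  apply: (L1D oU) => //; first exact: integrable_RB.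
  move=> x _; rewrite -[X in _ + X]normrN opprB; apply: le_trans (ler_normD _ _).
  by rewrite subrKC.
have h2 : enorm (T f - \row_i ext i g) <= n%:R * d.
  apply: (le_trans (enorm_le_sum _)); rewrite -[n in n%:R]card_ord mulr_natl -sumr_const.
  by apply: ler_sum => i _; rewrite !mxE (le_trans (ext_dist i ig tf)).
apply: (le_trans (lerD h1 h2)); rewrite -addrA lerD2l.
by rewrite -[X in X + _]mul1r -mulrDl addrC /d mulrC divfK// gt_eqF.
Qed.

Lemma ext_sub_le i g h : approximable g -> approximable h ->
  `|ext i g - ext i h| <= L1 (fun x => g x - h x).
Proof.
move=> ag ah; rewrite (_ : ext i g - ext i h = ext i (fun x => -1 * h x + g x)); last first.
  by rewrite ext_lin// mulN1r addrC.
have := enorm_ext_le (approximable_lin oU (-1) ah ag).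
rewrite (@eq_Rintegral _ _ _ m U (fun x => `|g x - h x|)); last first.
  by move=> x _; congr (`|_|); ring.
apply: le_trans; apply: le_trans (coord_le_enorm _ i); by rewrite mxE.
Qed.

Lemma ext_sum i (J : Type) (s : seq J) (c : J -> R) (F : J -> R -> R) :
  (forall j, approximable (F j)) ->
  ext i (fun x => \sum_(j <- s) c j * F j x) = \sum_(j <- s) c j * ext i (F j).
Proof.
move=> aF; elim: s => [|j s ih].
  rewrite big_nil (_ : (fun x => _) = cst 0); last by apply: funext => x; rewrite big_nil.
  rewrite ext_test; last exact: test_fun0.
  apply/eqP; rewrite -normr_le0; apply: (le_trans (coord_le_enorm _ _)).
  apply: (le_trans (T_le (test_fun0 U))).
  rewrite (@eq_Rintegral _ _ _ m U (cst 0)) ?Rintegral_cst ?mul0r//.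
  by move=> x _; rewrite normr0.
rewrite big_cons -ih -ext_lin//; last exact: approximable_sum.
by congr (ext i); apply: funext => x; rewrite big_cons.
Qed.

(** A Riesz representation: [nu i E] is the extension evaluated at the indicator of E. Countable
    additivity follows from L^1 convergence of the partial sums, and the bound on |nu(E)| is the
    bound on the extension, since the indicator has L^1 norm m(E). *)
Lemma functional_representation : exists nu : 'I_n -> {charge set mT -> \bar R},
  (forall i f, test_fun U f -> charge_integral (nu i) U f = T f 0 i) /\
  forall E, measurable E -> E `<=` U -> ((enorm (vec_measure nu E))%:E <= m E)%E.
Proof.
have ai (E : set mT) : measurable E -> approximable \1_E by exact: indic_approximable.
have /choice[nu nuE] i : exists nu : {charge set mT -> \bar R},
    forall A, nu A = (ext i \1_A)%:E.
  apply: (@charge_of_sigma_additive _ mT R (fun A => ext i \1_A)).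
    rewrite indic0 ext_test; last exact: test_fun0.
    have := @ext_sum i nat [::] (fun=> 0) (fun _ => \1_(set0 : set mT)) (fun=> ai _ measurable0).
    rewrite big_nil (_ : (fun x => _) = cst 0); last by apply: funext => x; rewrite big_nil.
    by rewrite ext_test//; exact: test_fun0.
  move=> A mA tA; apply/cvgrPdist_le => e e0.
  have mUA : measurable (\bigcup_k A k) by exact: bigcupT_measurable.
  have aS N : approximable (fun x => \sum_(0 <= k < N) 1 * \1_(A k) x).
    by apply: approximable_sum => // k; exact: ai.
  have cv := @L1_cvg0 _ U oU m (fun N x => \sum_(0 <= k < N) 1 * \1_(A k) x) (\1_(\bigcup_k A k)) 1
    (integrable_Rmeasurable (ai _ mUA).1) (fun N => integrable_Rmeasurable (aS N).1)
    (fun x _ => @indic_sum_cvg _ A x tA) (fun N x _ => @indic_sum_bound _ A N x tA).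
  have [N0 _ hN0] := @cvgr0_norm_le _ _ _ _ _ _ cv _ e0.
  exists N0 => // N /hN0 hN; apply: le_trans (le_trans (ler_norm _) hN).
  apply: le_trans (ext_sub_le i (ai _ mUA) (aS N)).
  rewrite ext_sum; last by move=> k; exact: ai.
  by under [X in _ <= `|_ - X|]eq_bigr do rewrite mul1r.
exists nu; split.
  move=> i f tf; have [C C0 hC] := charge_integral_simple (nu i) mU.
  have [M fM] := test_fun_bounded tf; have mf := test_fun_measurable (D := U) tf.
  apply: (@eq_of_small _ _ (C + fine (m U))); first by rewrite addr_ge0// fine_ge0.
  move=> e e0.
  have [K [c [E [mE EU h1 _]]]] := level_approx mU mf (fun x _ => fM x) e0.
  have := hC f M e K c E mf (fun x _ => fM x) mE EU h1.
  (* On simple functions the sum against nu and the extension coincide. Both the charge integral and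
     [T f] lie within a multiple of e of this common value. *)
  have -> : \sum_(0 <= j < K) c j * fine (nu i (E j)) =
      ext i (fun x => \sum_(0 <= j < K) c j * \1_(E j) x).
    by rewrite ext_sum; [apply: eq_bigr => j _; rewrite nuE|move=> j; exact: ai].
  have aS : approximable (fun x => \sum_(0 <= j < K) c j * \1_(E j) x).
    by apply: approximable_sum => // j; exact: ai.
  have af : approximable f by exact: test_approximable.
  have := ext_sub_le i af aS; rewrite ext_test//.
  set s := ext i _; set y := charge_integral _ _ _ => h2 h3.
  have h4 : L1 (fun x => f x - \sum_(0 <= j < K) c j * \1_(E j) x) <= e * fine (m U).
    rewrite -Rintegral_cst//; apply: (L1_le oU) => //.
      exact: integrable_RB af.1 aS.1.
    exact: finite_measure_integrable_cst.
  rewrite (_ : y - T f 0 i = (y - s) - (T f 0 i - s)); last by rewrite opprB addrA subrK.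
  rewrite mulrDl (mulrC C) (mulrC _ e); apply: (le_trans (ler_normB _ _)).
  by apply: lerD => //; exact: le_trans h4.
move=> E mE EU; have := enorm_ext_le (ai E mE).
rewrite (_ : \row_i _ = vec_measure nu E); last by apply/rowP => i; rewrite !mxE nuE.
rewrite -lee_fin; move/le_trans; apply.
rewrite (@eq_Rintegral _ _ _ m U \1_E); last by move=> x _; rewrite ger0_norm ?indicE ?ler0n.
rewrite /Rintegral integral_indic// setIidl// fineK//; exact: fin_num_measure.
Qed.

End functional_extension.

Theorem corollary1p4 (R : realType) (n : nat) (hn : (0 < n)%N)
    (a b : R) (hab : a < b)
    (phi : 'rV[R]_n -> R) (hphi : anisotropy phi) (hcoer : coercive phi)
    (v0 : R -> 'rV[R]_n) (hv0 : is_L2 `]a, b[ v0)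
    (v : R -> R -> 'rV[R]_n) (hv : gradient_flow `]a, b[ phi v0 v)
    (U : set R) (hUopen : open U) (hUI : U `<=` `]a, b[)
    (nu0 : 'I_n -> {charge set (measurableTypeR R) -> \bar R})
    (hBV : BV_deriv nu0 U v0) :
  {ae @lebesgue_measure R, forall t, 0 < t ->
    exists nu : 'I_n -> {charge set (measurableTypeR R) -> \bar R},
      BV_deriv nu U (v t) /\
      forall E : set R, measurable E -> E `<=` U ->
        (vec_variation nu E <= vec_variation nu0 E)%E}.
Proof.
(* The estimate is obtained at every positive time, since [v t] is in L^2 and [key_estimate] applies
   for each of them. *)
apply: aeW => t t0.
have mU : measurable (U : set (measurableTypeR R)) by exact: open_measurable.
have [vL2 _ _ _] := hv; have hvt := vL2 t (ltW t0).
have key N be : (0 < N)%N -> (forall k, 0 <= be k) -> exists P,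
    penalized a b N be (v t) P <= penalized a b N be v0 (cell_mean a b N v0).
  by move=> N0 be0; exact: (key_estimate hab N0 be0 hphi hv0 hv t0).
have vi i : (@lebesgue_measure R).-integrable U (EFin \o (fun x => v t x 0 i)).
  by apply: integrableS (L2_coord_integrable i hvt) => //; exact: measurable_itv.
have vdf i f : test_fun U f ->
    (@lebesgue_measure R).-integrable U (EFin \o (fun x => v t x 0 i * derive1 f x)).
  move=> tf; have [L hL] := test_fun_bounded (test_fun_derive1 tf).
  apply: (integrable_Rle mU _ _ (integrable_RZ L mU (integrable_norm (vi i)))).
    apply: measurable_funM; first exact: integrable_Rmeasurable (vi i).
    exact: test_fun_measurable (test_fun_derive1 tf).
  by move=> x _; rewrite normrM mulrC ler_wpM2r.
have wlin c f g : test_fun U f -> test_fun U g ->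
    weak_deriv U (v t) (fun x => c * f x + g x) = c *: weak_deriv U (v t) f + weak_deriv U (v t) g.
  by move=> tf tg; apply: weak_deriv_lin => // i; exact: vdf.
have wle f : test_fun U f -> enorm (weak_deriv U (v t) f) <=
    \int[variation_measure nu0]_(x in U) `|f x|.
  exact: (enorm_weak_deriv_le hab hUopen hUI hv0 hvt hBV key).
have [nu [nuT nuE]] := functional_representation hUopen wlin wle.
exists nu; split.
  split => // i f tf; rewrite nuT// weak_derivE opprK.
  by [].
(* Countable additivity of the variation of nu0 reduces the claim to the bound on |nu(A k)| for each
   piece of a partition of E. *)
move=> E mE EU; apply: ge_ereal_sup => _ [A [mA tA AE] <-].
rewrite -(variation_measureE nu0 mE).
have -> : variation_measure nu0 E = (\sum_(0 <= k <oo) variation_measure nu0 (A k))%E.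
  rewrite -AE; apply/esym/cvg_lim => //; apply: measure_semi_sigma_additive => //.
  exact: bigcupT_measurable.
apply: lee_nneseries => [k _ _|k _]; first by rewrite lee_fin enorm_ge0.
by apply: nuE => // x Ax; apply: EU; rewrite -AE; exists k.
Qed.
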